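(* Let $\alpha,\beta>0$. For every sufficiently small $\epsilon>0$, the operator $-\alpha\mathcal{J}^\epsilon+\beta\mathcal{L}^\epsilon:\mathcal{Y}^\epsilon_\Pi\to\mathcal{X}^\epsilon$ is linear and invertible.
   Context: For $\epsilon>0$ let $\mathcal{X}^\epsilon$ be the space of measurable functions $\mu$ on $(-\epsilon,\epsilon)$ with $\|\mu\|_{\mathcal{X}^\epsilon}:=\big(\int_{-\epsilon}^{\epsilon}\sqrt{\epsilon^2-t^2}\,|\mu(t)|^2\,dt\big)^{1/2}<\infty$. Let $\mathcal{Y}^\epsilon:=\{\mu\in C^0([-\epsilon,\epsilon]):\ \mu'\in\mathcal{X}^\epsilon\}$ ($\mu'$ the distributional derivative) with norm $(\|\mu\|_{\mathcal{X}^\epsilon}^2+\|\mu'\|_{\mathcal{X}^\epsilon}^2)^{1/2}$, and $\mathcal{Y}^\epsilon_\Pi:=\{\mu\in\mathcal{Y}^\epsilon:\ \mu(-\epsilon)=\mu(\epsilon)=0\}$. Define $\mathcal{L}^\epsilon[\mu](\tau):=\int_{-\epsilon}^{\epsilon}\mu(t)\log|\tau-t|\,dt$ for $\tau\in(-\epsilon,\epsilon)$, and for $\mu\in\mathcal{Y}^\epsilon_\Pi$ the Hadamard finite-part operator $\mathcal{J}^\epsilon[\mu](\tau):=\mathrm{H.f.p.}\int_{-\epsilon}^{\epsilon}\frac{\mu(t)}{(\tau-t)^2}dt=-\,\mathrm{p.v.}\int_{-\epsilon}^{\epsilon}\frac{\mu'(t)}{\tau-t}dt=\lim_{h\to0^+}\int_{-\epsilon}^{\epsilon}\frac{((\tau-t)^2-h)\mu(t)}{((\tau-t)^2+h)^2}dt$.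 *)

(* Defs.v *)
From HB Require Import structures.
From mathcomp Require Import all_boot all_order all_algebra.
From mathcomp Require Import all_classical all_reals all_analysis.
Set Implicit Arguments. Unset Strict Implicit. Unset Printing Implicit Defensive.
Import Order.TTheory GRing.Theory Num.Theory.
Import numFieldNormedType.Exports.
Local Open Scope classical_set_scope.
Local Open Scope ring_scope.

Section Defs.
Variable R : realType.
Notation leb := (@lebesgue_measure R).

Definition Iopen (e : R) : set R := `]-e, e[.
Definition Iclosed (e : R) : set R := `[-e, e].

Definition wgt (e t : R) : R := Num.sqrt (e ^+ 2 - t ^+ 2).

Definition Xnorm2 (e : R) (f : R -> R) : \bar R :=
  (\int[leb]_(t in Iopen e) (wgt e t * f t ^+ 2)%:E)%E.

Definition inX (e : R) (f : R -> R) : Prop :=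
  measurable_fun (Iopen e) f /\ (Xnorm2 e f < +oo)%E.

Definition test_fun (e : R) (phi : R -> R) : Prop :=
  (forall n x, derivable (derive1n n phi) x 1) /\
  exists2 d : R, 0 < d & forall x, e - d <= `|x| -> phi x = 0.

Definition weak_deriv (e : R) (mu nu : R -> R) : Prop :=
  forall phi, test_fun e phi ->
    Rintegral leb (Iopen e) (fun t => mu t * (derive1 phi) t)
    = - Rintegral leb (Iopen e) (fun t => nu t * phi t).

Definition inY (e : R) (mu nu : R -> R) : Prop :=
  {within (Iclosed e), continuous mu} /\ inX e mu /\ inX e nu /\ weak_deriv e mu nu.

Definition inYPi (e : R) (mu nu : R -> R) : Prop :=
  inY e mu nu /\ mu (- e) = 0 /\ mu e = 0.

Definition Ynorm2 (e : R) (mu nu : R -> R) : \bar R :=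
  (Xnorm2 e mu + Xnorm2 e nu)%E.

Definition Lop (e : R) (mu : R -> R) (tau : R) : R :=
  Rintegral leb (Iopen e) (fun t => mu t * ln `|tau - t|).

(* Hadamard finite-part operator, via the regularized limit h -> 0+ *)
Definition Jop (e : R) (mu : R -> R) (tau : R) : R :=
  lim ((fun h : R => Rintegral leb (Iopen e)
          (fun t => ((tau - t) ^+ 2 - h) * mu t / ((tau - t) ^+ 2 + h) ^+ 2))
       @ 0^'+).

Definition Top (a b e : R) (mu : R -> R) (tau : R) : R :=
  - a * Jop e mu tau + b * Lop e mu tau.

(* almost-everywhere equality on (-eps, eps), i.e. equality in X^eps *)
Definition ae_eq_on (e : R) (f g : R -> R) : Prop :=
  {ae leb, forall t, Iopen e t -> f t = g t}.

End Defs.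

(* Main.v *)
(* Let [nu = mu'] and [w t = sqrt (e^2 - t^2)].  The functions [T_n (t/e) / w] and
   [U_(n-1) (t/e) / e], n >= 1, are orthogonal in X with equal norms; the first are
   complete among the mean-zero functions and the second in X, so the coefficients of
   [nu] define an isometry [nu |-> g] from the mean-zero functions onto X.  The Cauchy
   transform F satisfies [sqrt (z^2 - e^2) F_nu z = F_(w g) z], because this holds for
   Chebyshev functions; letting [z = tau + i y] tend to [tau] gives [J mu = pi g] almost
   everywhere.  Hence J is invertible from Y_Pi onto X, with [|J mu| = pi |mu'|].
   Since [|ln x| <= 2 / sqrt x] on ]0, 1], [|L mu| <= C e |mu'|], so for small e the
   operator [b L] is a small perturbation of [a J] and a Neumann iteration inverts
   [- a J + b L]. *)
Require Import Defs.
From HB Require Import structures.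
From mathcomp Require Import all_boot all_order all_algebra.
From mathcomp Require Import all_classical all_reals all_analysis.
From mathcomp Require Import measurable_realfun.
From mathcomp Require Import ring lra.
Set Implicit Arguments. Unset Strict Implicit. Unset Printing Implicit Defensive.
Import Order.TTheory GRing.Theory Num.Theory.
Import numFieldNormedType.Exports.
Local Open Scope classical_set_scope.
Local Open Scope ring_scope.
From mathcomp.real_closed Require Import complex.

(** * Real-valued integrable functions on a measurable set *)

Section L1.
Context d (T : measurableType d) (R : realType).
Variables (mu : {measure set T -> \bar R}) (D : set T) (mD : measurable D).
Implicit Types (f g k : T -> R).

(** The regularised kernel is the derivative in t of Re (1 / (tau + i sqrt h - t)), so one
    integration by parts turns the regularised J mu into - Re F_nu (tau + i sqrt h); there is no
    boundary term because [nu] has mean zero. The obstacle is the limit h -> 0 at almost every point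
    for an arbitrary [nu] in X: convergence in norm of a Chebyshev expansion says nothing about
    single points. The square root removes it. At fixed height y > 0 the identity for F_nu is an
    equality of continuous functionals of the two expansions, so checking it on Chebyshev functions
    is enough; as y -> 0 the root tends to i w(tau), which is not 0, and exchanges real and
    imaginary parts. What remains is the Poisson integral of w g, which converges wherever the
    primitive of w g has derivative w g (Fatou), and a conjugate part that carries a factor O(y).
    [Jop] is a [lim], with a default value where the limit fails to exist; hence linearity and
    values of J hold almost everywhere only, and the measurability of J mu is proved separately.
    Every estimate bears on [nu], because [mu] is the primitive of its weak derivative. *)

Definition L1 f := mu.-integrable D (EFin \o f).

Lemma L1_measurable f : L1 f -> measurable_fun D f.
Proof. by move=> /(measurable_int mu)/measurable_EFinP. Qed.

Lemma eq_L1 f g : (forall t, D t -> f t = g t) -> L1 f -> L1 g.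
Proof.
move=> fg; apply: eq_integrable => // t /set_mem Dt.
by rewrite /= fg.
Qed.

Lemma L1D f g : L1 f -> L1 g -> L1 (fun t => f t + g t).
Proof. by move=> Lf Lg; exact: (integrableD mD Lf Lg). Qed.

Lemma L1Z c f : L1 f -> L1 (fun t => c * f t).
Proof. by move=> Lf; exact: (integrableZl mD c Lf). Qed.

Lemma L1N f : L1 f -> L1 (fun t => - f t).
Proof. by move=> Lf; apply: eq_L1 (L1Z (-1) Lf) => t _; rewrite mulN1r. Qed.

Lemma L1B f g : L1 f -> L1 g -> L1 (fun t => f t - g t).
Proof. by move=> Lf /L1N Lg; exact: L1D. Qed.

Lemma L1_le f g : measurable_fun D f -> (forall t, D t -> `|f t| <= g t) ->
  L1 g -> L1 f.
Proof.
move=> mf fg; apply: le_integrable => //; first exact/measurable_EFinP.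
by move=> t Dt /=; rewrite lee_fin (le_trans (fg t Dt))// ler_norm.
Qed.

Lemma L1_norm f : L1 f -> L1 (fun t => `|f t|).
Proof. exact: integrable_norm. Qed.

Lemma L1Mbounded f k M : L1 f -> measurable_fun D k ->
  (forall t, D t -> `|k t| <= M) -> L1 (fun t => f t * k t).
Proof.
move=> Lf mk kM; apply: (@L1_le _ (fun t => M * `|f t|)).
- by apply: measurable_funM => //; exact: L1_measurable.
- by move=> t Dt; rewrite normrM mulrC ler_wpM2r// kM.
- exact/L1Z/L1_norm.
Qed.

Lemma L1_sum (I : Type) (s : seq I) (F : I -> T -> R) :
  (forall i, L1 (F i)) -> L1 (fun t => \sum_(i <- s) F i t).
Proof.
move=> LF; elim: s => [|i s ih].
  by apply: eq_L1 (L1Z 0 (integrable0 mu D)) => t _; rewrite big_nil mul0r.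
by apply: eq_L1 (L1D (LF i) ih) => t _; rewrite big_cons.
Qed.

Lemma Rintegral_sum (I : Type) (s : seq I) (F : I -> T -> R) :
  (forall i, L1 (F i)) ->
  Rintegral mu D (fun t => \sum_(i <- s) F i t) =
  \sum_(i <- s) Rintegral mu D (F i).
Proof.
move=> LF; elim: s => [|i s ih].
  rewrite big_nil; under eq_Rintegral do rewrite big_nil.
  by rewrite /Rintegral integral0.
rewrite big_cons -ih -RintegralD//; [|exact: LF|exact: L1_sum].
by apply: eq_Rintegral => t _; rewrite big_cons.
Qed.

Lemma EFin_Rintegral f : L1 f ->
  (Rintegral mu D f)%:E = (\int[mu]_(x in D) (f x)%:E)%E.
Proof. by move=> Lf; rewrite /Rintegral fineK//; exact: integrable_fin_num. Qed.

Lemma Rintegral_ae_eq f g : measurable_fun D f -> measurable_fun D g ->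
  {ae mu, forall t, D t -> f t = g t} -> Rintegral mu D f = Rintegral mu D g.
Proof.
move=> mf mg fg; rewrite /Rintegral; congr fine.
apply: ae_eq_integral => //; [exact/measurable_EFinP|exact/measurable_EFinP|].
by apply: filterS fg => t h Dt; rewrite h.
Qed.

Lemma Rintegral_eq0_ae f : L1 f -> (forall t, D t -> 0 <= f t) ->
  Rintegral mu D f = 0 -> {ae mu, forall t, D t -> f t = 0}.
Proof.
move=> Lf f0 If.
have : (\int[mu]_(x in D) `|(EFin \o f) x| = 0)%E.
  rewrite -[RHS]/(0%:E) -If EFin_Rintegral//; apply: eq_integral => t /set_mem Dt.
  by rewrite gee0_abs// lee_fin f0.
move=> /(ae_eq_integral_abs mu mD (measurable_int mu Lf)).
by apply: filterS => t h Dt; have [] := h Dt.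
Qed.

Lemma L1_dominated (f_ : nat -> T -> R) f g :
  (forall n, measurable_fun D (f_ n)) ->
  {ae mu, forall t, D t -> f_ n t @[n --> \oo] --> f t} ->
  measurable_fun D f -> L1 g ->
  (forall n t, D t -> `|f_ n t| <= g t) ->
  Rintegral mu D (f_ n) @[n --> \oo] --> Rintegral mu D f.
Proof.
move=> mf ff mff Lg fg.
have [] := @dominated_convergence _ _ _ mu _ mD (fun n => EFin \o f_ n) (EFin \o f)
  (EFin \o g).
- by move=> n; exact/measurable_EFinP.
- exact/measurable_EFinP.
- by apply: filterS ff => t h Dt; apply: cvg_EFin; [exact: nearW|exact: h].
- exact: Lg.
- by apply: aeW => t n Dt /=; rewrite lee_fin fg.
move=> Lf _ h; rewrite /Rintegral.
have -> : fine (\int[mu]_(x in D) (f x)%:E) = fine (Rintegral mu D f)%:E.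
  by rewrite EFin_Rintegral.
apply: fine_cvg; rewrite EFin_Rintegral//.
Qed.

End L1.

(** * Derivation rules for real functions *)

Section real_derivative.
Variable R : realType.
Implicit Types (f g : R -> R) (x a b : R).

Lemma der_cst c x : is_derive x 1 (fun=> c : R) 0.
Proof. exact: is_derive_cst. Qed.

Lemma der_id x : is_derive x 1 (fun t : R => t) 1.
Proof. exact: is_derive_id. Qed.

Lemma der_add f g x a b : is_derive x 1 f a -> is_derive x 1 g b ->
  is_derive x 1 (fun t => f t + g t) (a + b).
Proof. by move=> df dg; exact: is_deriveD. Qed.

Lemma der_opp f x a : is_derive x 1 f a -> is_derive x 1 (fun t => - f t) (- a).
Proof. by move=> df; exact: is_deriveN. Qed.

Lemma der_sub f g x a b : is_derive x 1 f a -> is_derive x 1 g b ->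
  is_derive x 1 (fun t => f t - g t) (a - b).
Proof. by move=> df dg; exact: is_deriveB. Qed.

Lemma der_mul f g x a b : is_derive x 1 f a -> is_derive x 1 g b ->
  is_derive x 1 (fun t => f t * g t) (a * g x + f x * b).
Proof.
move=> df dg; apply: (is_derive_eq (is_deriveM df dg)).
by rewrite /GRing.scale/= addrC (mulrC a).
Qed.

Lemma der_scale c f x a : is_derive x 1 f a ->
  is_derive x 1 (fun t => c * f t) (c * a).
Proof.
move=> df; apply: (is_derive_eq (der_mul (der_cst c x) df)).
by rewrite mul0r add0r.
Qed.

Lemma der_inv f x a : f x != 0 -> is_derive x 1 f a ->
  is_derive x 1 (fun t => (f t)^-1) (- a / f x ^+ 2).
Proof.
move=> fx df; apply: (is_derive_eq (is_deriveV fx df)).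
by rewrite /GRing.scale/= mulNr mulNr mulrC.
Qed.

Lemma der_sqr f x a : is_derive x 1 f a ->
  is_derive x 1 (fun t => f t ^+ 2) (2 * f x * a).
Proof.
move=> df; apply: (is_derive_eq (der_mul df df)); ring.
Qed.

Lemma der_comp f g x a b : is_derive x 1 g b -> is_derive (g x) 1 f a ->
  is_derive x 1 (fun t => f (g t)) (a * b).
Proof. by move=> dg df; exact: is_derive1_comp. Qed.

Lemma der_cont f x a : is_derive x 1 f a -> {for x, continuous f}.
Proof.
move=> [df _]; apply: differentiable_continuous; exact/derivable1_diffP.
Qed.

End real_derivative.

(** * Fundamental theorem of calculus for integrands unbounded at the ends *)

Section improper_FTC.
Variable R : realType.
Notation leb := (@lebesgue_measure R).
Implicit Types (f F g G : R -> R) (a b : R).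

Lemma continuous_subspace_itv f a b : {in `]a, b[, continuous f} ->
  measurable_fun `]a, b[ f.
Proof.
move=> cf; apply: open_continuous_measurable_fun; first exact: interval_open.
by move=> x /set_mem; exact: cf.
Qed.

(** The integrand may blow up at both ends, as 1 / w does. The usual theorem applies on
    [a + h n, b - h n]; positivity makes these integrals increase to the integral over ]a, b[, and
    continuity of F identifies the limit. Integrability is part of the conclusion. *)
Lemma ge0_FTC2_oo f F a b : a < b ->
  {within `[a, b], continuous F} ->
  (forall x, a < x < b -> is_derive x 1 F (f x)) ->
  {in `]a, b[, continuous f} -> (forall x, a < x < b -> 0 <= f x) ->
  L1 leb `]a, b[ f /\ Rintegral leb `]a, b[ f = F b - F a.
Proof.
move=> ab cF dF cf f0.
(* The denominators start at 3, so that a + h n < b - h n already for n = 0. *)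
pose h n : R := (b - a) / n.+3%:R.
have h0 n : 0 < h n by rewrite divr_gt0// subr_gt0.
have hab n : a + h n < b - h n.
  have : h n <= (b - a) / 3%:R.
    by rewrite /h ler_wpM2l ?subr_ge0 ?(ltW ab)// ?lef_pV2 ?posrE// ler_nat.
  by move: ab; lra.
have hcvg : h n @[n --> \oo] --> 0.
  rewrite -[X in _ --> X](mulr0 (b - a)); apply: cvgM; first exact: cvg_cst.
  have := @cvg_harmonic R.
  by rewrite -(cvg_shiftn 2); under eq_fun do rewrite /harmonic addn2.
have hle m n : (m <= n)%N -> h n <= h m.
  move=> mn; rewrite /h ler_wpM2l ?subr_ge0 ?(ltW ab)// ?lef_pV2 ?posrE//.
  by rewrite ler_nat !ltnS.
pose E (n : nat) : set R := `[a + h n, b - h n]%classic.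
have UE : \bigcup_i E i = `]a, b[%classic.
  apply/seteqP; split => [x [n _]|x]; rewrite /E /= !in_itv /=.
    move=> /andP[? ?]; apply/andP; split.
      by apply: lt_le_trans (_ : a + h n <= _) => //; rewrite ltrDl.
    by apply: le_lt_trans (_ : _ <= b - h n) _ => //; rewrite gtrBl.
  move=> /andP[ax xb].
  have [n [h1 h2]] : exists n, h n <= x - a /\ h n <= b - x.
    have m0 : 0 < Num.min (x - a) (b - x) by rewrite lt_min !subr_gt0 ax.
    have [n _ /(_ n (leqnn n)) hn] := cvgr0_norm_le _ hcvg _ m0.
    exists n; move: hn; rewrite /= gtr0_norm// le_min => /andP[]//.
  by exists n => //=; rewrite in_itv/= -lerBrDl h1 lerBrDr -lerBrDl h2.
have mf : measurable_fun `]a, b[ f by exact: continuous_subspace_itv.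
have EI n : E n `<=` `]a, b[ by rewrite -UE; exact: bigcup_sup.
have Eval n : (\int[leb]_(x in E n) (f x)%:E)%E = (F (b - h n) - F (a + h n))%:E.
  have inn x : x \in `[a + h n, b - h n] -> a < x < b.
    by move=> xE; have := EI n x xE; rewrite /= in_itv.
  rewrite (@continuous_FTC2 _ f F) ?EFinB//.
  - apply: continuous_in_subspaceT => x /set_mem xE; apply: cf.
    exact: (EI n x xE).
  - split.
    + move=> x xE; have /dF : a < x < b by apply: inn; exact: subset_itv_oo_cc xE.
      by case.
    + apply: cvg_at_right_filter; apply: (within_continuous_continuous ab cF).
      by rewrite in_itv/= ltrDl h0/= (lt_trans (hab n))// gtrBl.
    + apply: cvg_at_left_filter; apply: (within_continuous_continuous ab cF).
      by rewrite in_itv/= gtrBl h0/= (lt_trans _ (hab n))// ltrDl.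
  - move=> x xE; have /dF : a < x < b by apply: inn; exact: subset_itv_oo_cc xE.
    by move=> [_]; rewrite derive1E.
have lim1 : (\int[leb]_(x in E n) (f x)%:E)%E @[n --> \oo] -->
    (\int[leb]_(x in `]a, b[) (f x)%:E)%E.
  rewrite -UE; apply: ge0_nondecreasing_set_cvg_integral => //.
  - move=> m n mn; apply/subsetPset => x; rewrite /E/= !in_itv/=.
    move=> /andP[h1 h2]; rewrite (le_trans _ h1) ?lerD2l ?hle//=.
    by rewrite (le_trans h2)// lerB// hle.
  - by move=> n; exact: measurable_itv.
  - by move=> n; apply/measurable_EFinP; apply: measurable_funS mf => //; exact: EI.
  - by move=> n x /EI /=; rewrite in_itv/= lee_fin; exact: f0.
have lim2 : (F (b - h n) - F (a + h n))%:E @[n --> \oo] --> (F b - F a)%:E.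
  apply: cvg_EFin; first exact: nearW.
  have [_ Fa Fb] := (continuous_within_itvP _ ab).1 cF.
  apply: cvgB.
  - move/cvg_at_leftP : Fb; apply; split; first by move=> n; rewrite gtrBl.
    by rewrite -[X in _ --> X]subr0; apply: cvgB => //; exact: cvg_cst.
  - move/cvg_at_rightP : Fa; apply; split; first by move=> n; rewrite ltrDl.
    by rewrite -[X in _ --> X]addr0; apply: cvgD => //; exact: cvg_cst.
have val : (\int[leb]_(x in `]a, b[) (f x)%:E)%E = (F b - F a)%:E.
  apply: (cvg_unique _ lim1); first exact: ereal_hausdorff.
  by rewrite /=; under eq_fun do rewrite Eval.
split; last by rewrite /Rintegral val.
apply/integrableP; split; first exact/measurable_EFinP.
rewrite (_ : (\int[leb]_(x in `]a, b[) _)%E = (F b - F a)%:E) ?ltry// -val.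
by apply: eq_integral => x /set_mem/=; rewrite in_itv/= => /f0 fx; rewrite ?gee0_abs ?ger0_norm.
Qed.

(** The nonnegative case is applied to g and to f + g, and the results are subtracted. *)
Lemma dominated_FTC2_oo f F g G a b : a < b ->
  {within `[a, b], continuous F} ->
  (forall x, a < x < b -> is_derive x 1 F (f x)) ->
  {in `]a, b[, continuous f} ->
  {within `[a, b], continuous G} ->
  (forall x, a < x < b -> is_derive x 1 G (g x)) ->
  {in `]a, b[, continuous g} ->
  (forall x, a < x < b -> `|f x| <= g x) ->
  L1 leb `]a, b[ f /\ Rintegral leb `]a, b[ f = F b - F a.
Proof.
move=> ab cF dF cf cG dG cg fg.
have [Lg Ig] : L1 leb `]a, b[ g /\ Rintegral leb `]a, b[ g = G b - G a.
  by apply: ge0_FTC2_oo => // x /fg; exact: le_trans.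
have [Lfg Ifg] : L1 leb `]a, b[ (fun x => f x + g x) /\
    Rintegral leb `]a, b[ (fun x => f x + g x) = (F b + G b) - (F a + G a).
  apply: (@ge0_FTC2_oo _ (fun x => F x + G x)) => //.
  - by move=> x; apply: cvgD; [exact: cF|exact: cG].
  - by move=> x xab; apply: is_deriveD; [exact: dF|exact: dG].
  - by move=> x xab; apply: cvgD; [exact: cf|exact: cg].
  - by move=> x /fg; rewrite -lerBlDr sub0r ler_norml => /andP[].
have Lf : L1 leb `]a, b[ f.
  by apply: eq_L1 (L1B _ Lfg Lg) => // x _; rewrite addrK.
by split => //; move: Ifg; rewrite RintegralD// Ig; lra.
Qed.

End improper_FTC.

(** * Primitives of integrable functions and integration by parts *)

Section primitive.
Variable R : realType.
Notation leb := (@lebesgue_measure R).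
Implicit Types (f k : R -> R) (a b M : R).

(** Defined on the whole line: for t <= a the interval is empty and the value is 0, while to the
    right it sees every value of f, also outside the interval under study. *)
Definition prim a f t : R := Rintegral leb `]a, t] f.

Lemma L1_itv_closed a b f : L1 leb `]a, b[ f -> L1 leb `[a, b] f.
Proof.
move=> /integrableP[mf If].
have mf' : measurable_fun `[a, b] (EFin \o f).
  by apply/emeasurable_fun_itv_obnd_cbndP/emeasurable_fun_itv_bndo_bndcP.
apply/integrableP; split => //.
by rewrite integral_itv_bndoo//; exact: measurableT_comp.
Qed.

Lemma L1_subitv a b f (A : set R) : measurable A -> A `<=` `[a, b] ->
  L1 leb `]a, b[ f -> L1 leb A f.
Proof. by move=> mA Aab /L1_itv_closed; exact: integrableS. Qed.

Lemma primE a b f : L1 leb `]a, b[ f ->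
  prim a f b = Rintegral leb `]a, b[ f.
Proof. by move=> Lf; rewrite /prim Rintegral_itv_bndo_bndc. Qed.

Lemma prim_left a f : prim a f a = 0.
Proof. by rewrite /prim set_itv_ge ?Rintegral_set0// bnd_simp ltxx. Qed.

Lemma prim_continuous a b f : a <= b -> L1 leb `]a, b[ f ->
  {within `[a, b], continuous (prim a f)}.
Proof.
move=> ab Lf.
have := parameterized_integral_continuous ab (L1_itv_closed Lf).
apply: subspace_eq_continuous => t; rewrite inE/= in_itv/= => /andP[at_ tb].
rewrite /from_subspace/= /parameterized_integral /prim Rintegral_itv_obnd_cbnd//.
apply: L1_subitv Lf => //; apply: subset_itv; rewrite bnd_simp//.
Qed.

Lemma integral_restrict_itv (A : set R) f g : measurable A -> L1 leb A g ->
  f = g \_ A -> (\int[leb]_x (f x)%:E)%E = (Rintegral leb A g)%:E.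
Proof.
move=> mA Lg ->; rewrite EFin_Rintegral// [RHS]integral_mkcond.
by rewrite restrict_EFin.
Qed.

Lemma prim_measurable a b f : a < b -> L1 leb `]a, b[ f ->
  measurable_fun `]a, b[ (prim a f).
Proof.
move=> ab Lf; apply: continuous_subspace_itv => t tab.
exact: (within_continuous_continuous ab (prim_continuous (ltW ab) Lf)).
Qed.

Lemma prim_bound a b f t : a <= t <= b -> L1 leb `]a, b[ f ->
  `|prim a f t| <= Rintegral leb `]a, b[ (fun s => `|f s|).
Proof.
move=> /andP[at_ tb] Lf.
have sub : `]a, t] `<=` `[a, b] by apply: subset_itv; rewrite bnd_simp.
have Lt : L1 leb `]a, t] f by exact: L1_subitv sub Lf.
have Labs := L1_norm Lf.
apply: (le_trans (le_normr_Rintegral _ _)) => //.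
rewrite -(primE Labs) /prim -lee_fin !EFin_Rintegral//.
- apply: ge0_subset_integral => //.
  + apply: measurable_int; apply: (L1_subitv _ _ Labs) => //.
    exact: subset_itv_oc_cc.
  + by apply: subset_itvl; rewrite bnd_simp.
- by apply: (L1_subitv _ _ Labs) => //; exact: subset_itv_oc_cc.
- exact: L1_norm.
Qed.

Lemma L1_bounded_itv a b f M : measurable_fun `]a, b[ f ->
  (forall t, t \in `]a, b[ -> `|f t| <= M) -> L1 leb `]a, b[ f.
Proof.
move=> mf fM; apply: measurable_bounded_integrable => //.
- suff : (lebesgue_measure (`]a, b[ : set R) < +oo)%E by [].
  by rewrite lebesgue_measure_itv/=; case: ifP => _; rewrite ?ltry// -EFinB ltry.
- exists M; split; first exact: num_real.
  by move=> x Mx t tab; rewrite /= (le_trans (fM t _))// ltW.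
Qed.

Lemma continuous_bounded_itv a b f : continuous f ->
  exists2 M : R, 0 <= M & forall t, t \in `]a, b[ -> `|f t| <= M.
Proof.
move=> cf.
have [M [Mr fM]] : bounded_set (f @` `[a, b]).
  apply: compact_bounded; apply: continuous_compact; last exact: segment_compact.
  by apply: continuous_subspaceT => x; exact: cf.
exists (`|M| + 1); first by rewrite addr_ge0.
move=> t Dt; apply: (fM (`|M| + 1)).
  by rewrite (le_lt_trans (ler_norm M))// ltrDl.
by exists t => //; exact: subset_itv_oo_cc Dt.
Qed.

(** f is only integrable, so its primitive need not be differentiable everywhere and the product
    rule does not apply. Instead Fubini exchanges the order in the integral of f s * k' t over s <=
    t: integrating in s first gives prim a f t * k' t, in t first f s * (k b - k s). *)
Lemma prim_by_parts a b f k k' : a < b -> L1 leb `]a, b[ f ->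
  (forall x : R, is_derive x 1 k (k' x)) -> continuous k' ->
  Rintegral leb `]a, b[ (fun t => prim a f t * k' t) =
  k b * Rintegral leb `]a, b[ f - Rintegral leb `]a, b[ (fun t => f t * k t).
Proof.
move=> ab Lf dk ck'.
set D := `]a, b[%classic.
have mD : measurable D by exact: measurable_itv.
have ck : continuous k by move=> x; apply: differentiable_continuous; apply/derivable1_diffP; case: (dk x).
have mk' : measurable_fun setT k' by exact: continuous_measurable_fun.
have mk : measurable_fun setT k by exact: continuous_measurable_fun.
have [M' M'0 k'M] := continuous_bounded_itv a b ck'.
have [M M0 kM] := continuous_bounded_itv a b ck.
pose F (p : R * R) : R := (f \_ D) p.1 * ((k' \_ D) p.2 * (p.1 <= p.2)%R%:R).
have LfD : L1 leb setT (f \_ D).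
  rewrite /L1 -restrict_EFin; apply/integrable_restrict => //=.
  by rewrite setTI.
have mfD := L1_measurable LfD.
have mk'D : measurable_fun setT (k' \_ D).
  by apply/(measurable_restrictT _ _).1 => //; exact: measurable_funS mk'.
have lD : leb D = (b - a)%:E by rewrite lebesgue_measure_itv/= lte_fin ab.
have mle : measurable_fun setT (fun p : R * R => (p.1 <= p.2)%R%:R : R).
  rewrite (_ : (fun p : R * R => _) = \1_[set p | p.1 <= p.2]).
    apply: measurable_indic.
    have := @measurable_fun_ler _ _ R setT (@fst R R) (@snd R R) measurable_fst
      measurable_snd measurableT [set true].
    by rewrite setTI; exact.
  by apply/funext => p; rewrite indicE/= mem_setE.
have mF : measurable_fun setT F.
  apply: measurable_funM; first exact: measurableT_comp.
  by apply: measurable_funM => //; exact: measurableT_comp.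
have F0s s t : ~ D s -> F (s, t) = 0.
  by move=> Ds; rewrite /F/= patchE memNset// mul0r.
have F0t s t : ~ D t -> F (s, t) = 0.
  by move=> Dt; rewrite /F/= [X in _ * (X * _)]patchE memNset// mul0r mulr0.
have iF : (leb \x leb)%E.-integrable setT (EFin \o F).
  apply/integrable12ltyP; first exact/measurable_EFinP.
  (* Since |k'| <= M' on ]a, b[, the integral of |F (s, t)| in t is at most C * |f s|, which is
     integrable in s. *)
  pose C := M' * (b - a).
  have inner s : (\int[leb]_t `|(EFin \o F) (s, t)| <= (C * `|(f \_ D) s|)%:E)%E.
    apply: (@le_trans _ _ (\int[leb]_t ((cst (M' * `|(f \_ D) s|)%:E) \_ D) t)%E).
      apply: ge0_le_integral => //.
      - by apply: measurableT_comp => //; apply/measurable_EFinP; exact: measurableT_comp.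
      - by apply/(measurable_restrictT _ _).1 => //; exact: measurable_cst.
      - move=> t _; have [Dt|Dt] := pselect (D t); last first.
          by rewrite /= F0t// normr0 patchE memNset.
        rewrite patchE mem_set// lee_fin /F/= normrM mulrC ler_wpM2r//.
        rewrite patchE mem_set// normrM; case: (s <= t)%R; rewrite ?normr1 ?normr0 ?mulr1 ?mulr0//.
        exact: k'M.
    rewrite -integral_mkcond integral_cst//.
    rewrite [X in (_ * X)%E](_ : _ = (b - a)%:E); last exact: lD.
    by rewrite -EFinM lee_fin /C mulrAC.
  have LC : L1 leb setT (fun s => C * `|(f \_ D) s|) by exact/L1Z/L1_norm.
  apply: (@le_lt_trans _ _ (\int[leb]_s (C * `|(f \_ D) s|)%:E)%E).
    apply: ge0_le_integral => //.
    - by move=> s _; exact: integral_ge0.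
    - apply: (@measurable_fun_fubini_tonelli_F _ _ _ _ _ leb (abse \o (EFin \o F))) => //.
        by apply: measurableT_comp => //; exact/measurable_EFinP.
      by move=> p; exact: abse_ge0.
    - exact: (measurable_int leb LC).
  by rewrite -EFin_Rintegral// ltry.
have H1 t : D t -> (\int[leb]_s (F (s, t))%:E)%E = (prim a f t * k' t)%:E.
  rewrite /D/= in_itv/= => /andP[at_ tb].
  have sub : `]a, t] `<=` `[a, b] by apply: subset_itv; rewrite bnd_simp// ltW.
  have Lt : L1 leb `]a, t] f by exact: L1_subitv sub Lf.
  rewrite (@integral_restrict_itv `]a, t] _ (fun s => k' t * f s))//.
  - by rewrite RintegralZl// mulrC.
  - exact: L1Z.
  - apply/funext => s; rewrite /F/= !patchE !mem_setE /= !in_itv/= at_ tb/=.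
    have [as_|] := boolP (a < s); last by rewrite /= mul0r.
    have [st|] := leP s t; last by rewrite !mulr0.
    by rewrite (le_lt_trans st tb) mulr1 mulrC.
have H2 s : D s -> (\int[leb]_t (F (s, t))%:E)%E = (f s * (k b - k s))%:E.
  rewrite /D/= in_itv/= => /andP[as_ sb].
  have Lk' : L1 leb `[s, b] k'.
    apply: continuous_compact_integrable; first exact: segment_compact.
    by apply: continuous_subspaceT => x; exact: ck'.
  have Lk'' : L1 leb `[s, b[ k'.
    by apply: integrableS Lk' => //; apply: subset_itvl; rewrite bnd_simp.
  rewrite (@integral_restrict_itv `[s, b[ _ (fun t => f s * k' t))//.
  - rewrite RintegralZl// Rintegral_itv_bndo_bndc//.
    rewrite [X in _ * X]/Rintegral (@continuous_FTC2 _ k' k)//.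
    + by apply: continuous_subspaceT => x; exact: ck'.
    + split; first by move=> x _; case: (dk x).
      * by apply: cvg_at_right_filter; exact: ck.
      * by apply: cvg_at_left_filter; exact: ck.
    + by move=> x _; rewrite derive1E; case: (dk x).
  - exact: L1Z.
  - apply/funext => t; rewrite /F/= !patchE !mem_setE /= !in_itv/= as_ sb/=.
    have [st|ts] := leP s t; last by rewrite !mulr0.
    by rewrite (lt_le_trans as_ st) mulr1; case: ifP; rewrite ?mulr0.
have Lprim : L1 leb D (fun t => prim a f t * k' t).
  apply: (@L1Mbounded _ _ _ _ _ _ _ _ M') => //.
  + apply: (@L1_bounded_itv _ _ _ (Rintegral leb D (fun s => `|f s|))).
      exact: prim_measurable.
    move=> t; rewrite in_itv/= => /andP[at_ tb].
    by apply: prim_bound => //; rewrite !ltW.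
  + exact: measurable_funS mk'.
have Lfk : L1 leb D (fun s => f s * k s).
  by apply: (@L1Mbounded _ _ _ _ _ _ _ _ M) => //; exact: measurable_funS mk.
have := Fubini iF.
rewrite (_ : (\int[leb]_s _)%E = (Rintegral leb D (fun s => k b * f s - f s * k s))%:E); last first.
  rewrite -(@integral_restrict_itv D (((fun s => k b * f s - f s * k s)) \_ D))//.
    apply: eq_integral => s _; have [Ds|Ds] := pselect (D s).
      by rewrite H2// patchE mem_set// mulrBr (mulrC (k b)).
    rewrite patchE memNset//; under eq_integral do rewrite /= F0s//.
    by rewrite integral0.
  by apply: L1B => //; exact: L1Z.
rewrite (_ : (\int[leb]_t _)%E = (Rintegral leb D (fun t => prim a f t * k' t))%:E); last first.
  rewrite -(@integral_restrict_itv D (((fun t => prim a f t * k' t)) \_ D))//.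
  apply: eq_integral => t _; have [Dt|Dt] := pselect (D t).
    by rewrite H1// patchE mem_set.
  rewrite patchE memNset//; under eq_integral do rewrite /= F0t//.
  by rewrite integral0.
by move=> [<-]; rewrite RintegralB ?RintegralZl//; exact: L1Z.
Qed.

End primitive.

(** * Weighted L2 spaces *)

Section weighted_L2.
Context d (T : measurableType d) (R : realType).
Variables (mu : {measure set T -> \bar R}) (D : set T) (mD : measurable D).
Variables (w : T -> R) (mw : measurable_fun D w) (w0 : forall t, D t -> 0 < w t).
Implicit Types (f g : T -> R) (c : R).

(** Functions, not classes. Measurability of f is asked for separately, since that of w * f^2 does
    not imply it. *)
Definition L2 f := measurable_fun D f /\ L1 mu D (fun t => w t * f t ^+ 2).

Definition ip f g : R := Rintegral mu D (fun t => w t * (f t * g t)).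

Lemma eq_L2 f g : (forall t, D t -> f t = g t) -> L2 f -> L2 g.
Proof.
move=> fg [mf Lf]; split.
  by apply: eq_measurable_fun mf => t /set_mem Dt; rewrite fg.
by apply: (eq_L1 mD _ Lf) => t Dt; rewrite fg.
Qed.

Lemma L2_mul f g : L2 f -> L2 g -> L1 mu D (fun t => w t * (f t * g t)).
Proof.
move=> [mf Lf] [mg Lg]; apply: (L1_le mD _ _ (L1D mD Lf Lg)).
  by apply: measurable_funM => //; exact: measurable_funM.
move=> t Dt; rewrite -mulrDr normrM (gtr0_norm (w0 Dt)) ler_pM2l ?w0//.
have := sqr_ge0 (f t - g t); have := sqr_ge0 (f t + g t).
by case: (ler0P (f t * g t)) => _; lra.
Qed.

Lemma L2_sq f : measurable_fun D f -> L1 mu D (fun t => w t * (f t * f t)) -> L2 f.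
Proof. by move=> mf Lf; split => //; apply: (eq_L1 mD _ Lf) => t _; rewrite expr2. Qed.

Lemma L2Z c f : L2 f -> L2 (fun t => c * f t).
Proof.
move=> [mf Lf]; split; first exact: measurable_funM.
by apply: (eq_L1 mD _ (L1Z mD (c ^+ 2) Lf)) => t _; rewrite exprMn mulrCA.
Qed.

Lemma L2D f g : L2 f -> L2 g -> L2 (fun t => f t + g t).
Proof.
move=> Lf Lg; have Lfg := L2_mul Lf Lg; case: Lf Lg => [mf Lf] [mg Lg].
split; first exact: measurable_funD.
apply: (eq_L1 mD _ (L1D mD (L1D mD Lf Lg) (L1Z mD 2 Lfg))) => t _; ring.
Qed.

Lemma L2B f g : L2 f -> L2 g -> L2 (fun t => f t - g t).
Proof.
move=> Lf Lg; apply: eq_L2 (L2D Lf (L2Z (-1) Lg)) => t _.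
by rewrite mulN1r.
Qed.

Lemma L2_0 : L2 (fun=> 0).
Proof.
split; first exact: measurable_cst.
apply: (eq_L1 mD _ (integrable0 mu D)) => t _; by rewrite expr0n mulr0.
Qed.

Lemma L2_sum (I : Type) (s : seq I) (F : I -> T -> R) :
  (forall i, L2 (F i)) -> L2 (fun t => \sum_(i <- s) F i t).
Proof.
move=> LF; elim: s => [|i s ih].
  by apply: eq_L2 L2_0 => t _; rewrite big_nil.
by apply: eq_L2 (L2D (LF i) ih) => t _; rewrite big_cons.
Qed.

Lemma eq_ip f f' g g' : (forall t, D t -> f t = f' t) ->
  (forall t, D t -> g t = g' t) -> ip f g = ip f' g'.
Proof.
by move=> ff gg; apply: eq_Rintegral => t /set_mem Dt; rewrite ff// gg.
Qed.

Lemma ipC f g : ip f g = ip g f.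
Proof. by apply: eq_Rintegral => t _; rewrite (mulrC (f t)). Qed.

Lemma ipDl f g h : L2 f -> L2 g -> L2 h ->
  ip (fun t => f t + g t) h = ip f h + ip g h.
Proof.
move=> Lf Lg Lh; rewrite -RintegralD//; [|exact: L2_mul..].
by apply: eq_Rintegral => t _; ring.
Qed.

Lemma ipZl c f g : L2 f -> L2 g -> ip (fun t => c * f t) g = c * ip f g.
Proof.
move=> Lf Lg; rewrite -RintegralZl//; last exact: L2_mul.
by apply: eq_Rintegral => t _; ring.
Qed.

Lemma ipBl f g h : L2 f -> L2 g -> L2 h ->
  ip (fun t => f t - g t) h = ip f h - ip g h.
Proof.
move=> Lf Lg Lh; rewrite -RintegralB//; [|exact: L2_mul..].
by apply: eq_Rintegral => t _; ring.
Qed.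

Lemma ip_suml (I : Type) (s : seq I) (F : I -> T -> R) g :
  (forall i, L2 (F i)) -> L2 g ->
  ip (fun t => \sum_(i <- s) F i t) g = \sum_(i <- s) ip (F i) g.
Proof.
move=> LF Lg; rewrite -Rintegral_sum//; last by move=> i; exact: L2_mul.
by apply: eq_Rintegral => t _; rewrite mulr_suml mulr_sumr.
Qed.

Lemma ip_ge0 f : 0 <= ip f f.
Proof.
apply: Rintegral_ge0 => t Dt; apply: mulr_ge0; first exact: ltW (w0 Dt).
by rewrite -expr2 sqr_ge0.
Qed.

Lemma ip_expand c f g : L2 f -> L2 g ->
  ip (fun t => f t + c * g t) (fun t => f t + c * g t) =
  ip f f + 2 * c * ip f g + c ^+ 2 * ip g g.
Proof.
move=> Lf Lg; have Lcg := L2Z c Lg; have Ls := L2D Lf Lcg.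
rewrite ipDl// ipZl// (ipC f) (ipC g) !ipDl// !ipZl// (ipC g f); ring.
Qed.

(** The quadratic c -> |f + c g|^2 is nonnegative. When ip g g = 0 it is affine in c, and if ip f g
    were not 0 the chosen c would give it the value -1. *)
Lemma ip_CS f g : L2 f -> L2 g -> ip f g ^+ 2 <= ip f f * ip g g.
Proof.
move=> Lf Lg.
have P c : 0 <= ip f f + 2 * c * ip f g + c ^+ 2 * ip g g.
  by rewrite -ip_expand//; exact: ip_ge0.
have := ip_ge0 g; rewrite le_eqVlt => /predU1P[g0|g0].
  move: P; rewrite -g0 mulr0.
  have [->|n0] := eqVneq (ip f g) 0; first by rewrite expr0n.
  move=> /(_ (- (ip f f + 1) / (2 * ip f g))).
  rewrite mulr0 addr0.
  rewrite (_ : _ + _ = -1); last by field.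
  by rewrite ler0N1.
have := P (- ip f g / ip g g).
rewrite (_ : _ + _ = ip f f - ip f g ^+ 2 / ip g g); last by field; rewrite gt_eqF.
by rewrite subr_ge0 ler_pdivrMr.
Qed.

Lemma ip_add_le f g : L2 f -> L2 g ->
  ip (fun t => f t + g t) (fun t => f t + g t) <= 2 * ip f f + 2 * ip g g.
Proof.
move=> Lf Lg.
have H1 := ip_expand 1 Lf Lg; have H2 := ip_expand (-1) Lf Lg.
have := ip_ge0 (fun t => f t + -1 * g t); rewrite H2.
under eq_fun do rewrite -(mul1r (g _)).
by rewrite H1; lra.
Qed.

Lemma ip_ae_eq f f' g : L2 f -> L2 f' -> L2 g ->
  {ae mu, forall t, D t -> f t = f' t} -> ip f g = ip f' g.
Proof.
move=> Lf Lf' Lg ff; apply: Rintegral_ae_eq => //.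
- exact: L1_measurable (L2_mul Lf Lg).
- exact: L1_measurable (L2_mul Lf' Lg).
by apply: filterS ff => t h Dt; rewrite h.
Qed.

Lemma ip_eq0_ae f : L2 f -> ip f f = 0 -> {ae mu, forall t, D t -> f t = 0}.
Proof.
move=> Lf If.
have := Rintegral_eq0_ae mD (L2_mul Lf Lf) _ If.
have h : forall t, D t -> 0 <= w t * (f t * f t).
  move=> t Dt; rewrite mulr_ge0 ?(ltW (w0 Dt))// -expr2 sqr_ge0//.
move=> /(_ h); apply: filterS => t ht Dt.
by move/eqP : (ht Dt); rewrite mulf_eq0 gt_eqF ?w0//= -expr2 sqrf_eq0 => /eqP.
Qed.

End weighted_L2.

(** * Completeness of weighted L2 *)

Section Riesz_Fischer.
Context d (T : measurableType d) (R : realType).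
Variables (mu : {measure set T -> \bar R}) (D : set T) (mD : measurable D).
Variables (w : T -> R) (mw : measurable_fun D w) (w0 : forall t, D t -> 0 < w t).
Implicit Types (f g : T -> R) (c : R).
Notation L2 := (L2 mu D w).
Notation ip := (ip mu D w).
Notation nrm f := (ip f f).

(** Telescoping against a geometric series. The exact factor 1 - 2^-j in the bound for |u (k + j) -
    u k| is what lets the induction on j close. *)
Lemma geo_increments (u : nat -> R) (r : R) :
  (forall k, `|u k.+1 - u k| <= r / 2 ^+ k) ->
  cvgn u /\ forall k, `|limn u - u k| <= 2 * r / 2 ^+ k.
Proof.
move=> H.
have r0 : 0 <= r by have := H 0%N; rewrite expr0 divr1; exact: le_trans.
have H2 k j : `|u (k + j)%N - u k| <= 2 * r / 2 ^+ k * (1 - (2 ^+ j)^-1).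
  elim: j => [|j ih]; first by rewrite addn0 subrr normr0 expr0 invr1 subrr mulr0.
  rewrite (_ : u (k + j.+1)%N - u k = (u (k + j).+1 - u (k + j)%N) + (u (k + j)%N - u k)); last first.
    by rewrite addnS; ring.
  apply: (le_trans (ler_normD _ _)); apply: (le_trans (lerD (H _) ih)).
  rewrite le_eqVlt; apply/orP; left; apply/eqP; rewrite exprD exprS; field.
  by rewrite !expf_neq0//= ?pnatr_eq0.
have H3 k m : (k <= m)%N -> `|u m - u k| <= 2 * r / 2 ^+ k.
  move=> km; rewrite -(subnKC km); apply: (le_trans (H2 _ _)).
  by rewrite ler_piMr// divr_ge0 ?mulr_ge0// exprn_ge0.
have c : cvgn u.
  rewrite (_ : u = fun n => u 0%N + series (telescope u) n); last first.
    by apply/funext => n; exact: eq_sum_telescope.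
  apply: is_cvgD; first exact: is_cvg_cst.
  apply: normed_cvg; apply: (@series_le_cvg _ _ (geometric r (2^-1))) => //.
  - by move=> n; exact: normr_ge0.
  - by move=> n /=; rewrite mulr_ge0// exprn_ge0// invr_ge0.
  - by move=> n /=; rewrite exprVn; exact: H.
  - by apply: is_cvg_geometric_series; rewrite ger0_norm ?invr_ge0// invf_lt1// ltr1n.
split => // k.
have ck : `|u m - u k| @[m --> \oo] --> `|limn u - u k|.
  by apply: cvg_norm; apply: cvgB => //; exact: cvg_cst.
rewrite -(cvg_lim _ ck)//; apply: limr_le; first by apply/cvg_ex; exists (`|limn u - u k|).
by exists k => // m /= km; exact: H3.
Qed.

(* The series of [4^k w (u_(k+1) - u_k)^2] has finite integral, hence is finite almost
   everywhere, where it forces [|u_(k+1) - u_k| <= r / 2^k]. *)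
Lemma L2_complete (u : nat -> T -> R) (C : R) :
  (forall k, L2 (u k)) ->
  (forall k, nrm (fun t => u k.+1 t - u k t) <= C / 16%:R ^+ k) ->
  exists2 f, L2 f & exists B : R, forall k, nrm (fun t => f t - u k t) <= B / 4%:R ^+ k.
Proof.
move=> Lu uC.
pose dd k t := u k.+1 t - u k t.
have Ld k : L2 (dd k) by exact: L2B.
(* The factor 4^k splits the decay 16^-k in two: the integrals of h k still decay like 4^-k and can
   be summed, while h k t <= S t gives pointwise increments of order 2^-k. *)
pose h k t := 4 ^+ k * (w t * (dd k t) ^+ 2).
have h0 k t : D t -> 0 <= h k t.
  move=> Dt; apply: mulr_ge0; first exact: exprn_ge0.
  by apply: mulr_ge0; [exact: ltW (w0 Dt)|exact: sqr_ge0].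
have Lh k : L1 mu D (h k) by apply: L1Z => //; case: (Ld k).
pose S t : \bar R := (\sum_(k <oo) (h k t)%:E)%E.
have C0 : 0 <= C.
  have := uC 0%N; rewrite expr0 divr1; apply: le_trans; exact: ip_ge0.
have mh k : measurable_fun D (EFin \o h k) by exact: (measurable_int mu (Lh k)).
have mS : measurable_fun D S.
  apply: (@ge0_emeasurable_sum _ T R D (fun k t => (h k t)%:E) xpredT) => [k t Dt _|k _].
    by rewrite lee_fin h0.
  exact: mh.
have S0 t : D t -> (0 <= S t)%E.
  by move=> Dt; apply: nneseries_ge0 => k _ _; rewrite lee_fin h0.
have intS : (\int[mu]_(t in D) S t < +oo)%E.
  rewrite integral_nneseries//.
  apply: (@le_lt_trans _ _ (2 * C)%:E); last exact: ltry.
  apply: lime_le.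
    apply: is_cvg_nneseries => k _ _; apply: integral_ge0 => t Dt.
    by rewrite lee_fin h0.
  apply: nearW => n.
  have hk k : (\int[mu]_(x in D) (h k x)%:E <= (C / 4 ^+ k)%:E)%E.
    rewrite -EFin_Rintegral//; rewrite lee_fin /h RintegralZl//; last by case: (Ld k).
    have e4 : (16%:R : R) = 4 * 4 by rewrite -natrM.
    rewrite -ler_pdivlMl ?exprn_gt0//; apply: (le_trans _ (le_trans (uC k) _)).
      by rewrite /ip/=; under eq_Rintegral do rewrite expr2.
    by rewrite e4 exprMn invfM mulrCA mulrA.
  apply: (le_trans (lee_sum _ (fun k _ => hk k))).
  rewrite sumEFin lee_fin.
  suff -> : \sum_(0 <= i < n) C / 4 ^+ i = 4 / 3 * C * (1 - (4 ^+ n)^-1).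
    have : 0 <= (4 ^+ n : R)^-1 by rewrite invr_ge0 exprn_ge0.
    have : 0 <= C * (4 ^+ n : R)^-1 by rewrite mulr_ge0// invr_ge0 exprn_ge0.
    by move: C0; lra.
  elim: n => [|n ih]; first by rewrite big_nil expr0 invr1 subrr mulr0.
  rewrite big_nat_recr//= ih exprS; field.
  by rewrite expf_neq0//= ?pnatr_eq0.
have iS : mu.-integrable D S.
  apply/integrableP; split => //; apply: le_lt_trans intS.
  apply: ge0_le_integral => //; first exact: measurableT_comp.
  by move=> t Dt; rewrite gee0_abs// S0.
pose E := D `&` [set t | (S t < +oo)%E].
have mE : measurable E.
  by apply: measurable_lte => //; exact: measurable_cst.
have ED : E `<=` D by move=> t [].
pose s t := fine (S t).
have s0 t : D t -> 0 <= s t by move=> Dt; rewrite fine_ge0// S0.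
have Ls : L1 mu D s.
  apply: le_integrable iS => //.
    by apply/measurable_EFinP; apply: (measurable_comp (F := setT)).
  move=> t Dt; rewrite /= ger0_norm ?s0// gee0_abs ?S0//.
  by have := S0 _ Dt; rewrite /s; case: (S t) => //= _; exact: leey.
have hs k t : E t -> h k t <= s t.
  move=> [Dt Sy]; rewrite -lee_fin /s fineK; last by rewrite ge0_fin_numE ?S0.
  have /= := @nneseries_lim_ge R (fun k => (h k t)%:E) xpredT 0%N k.+1.
  move=> /(_ (fun n _ _ => _)) H; apply: (le_trans _ (H _)).
    rewrite big_nat_recr//= leeDr//; apply: sume_ge0 => i _.
    by rewrite lee_fin h0.
  by move=> n; rewrite lee_fin h0.
have geo t : E t -> cvgn (u ^~ t) /\ forall k, w t * (limn (u ^~ t) - u k t) ^+ 2 <= 4 * s t / 4 ^+ k.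
  move=> Et; have Dt := ED _ Et; have wt := w0 Dt.
  pose r := Num.sqrt (s t / w t).
  have r2 : r ^+ 2 = s t / w t by rewrite sqr_sqrtr// divr_ge0 ?s0// ltW.
  have inc k : `|u k.+1 t - u k t| <= r / 2 ^+ k.
    rewrite -(@ler_pXn2r _ 2)// ?nnegrE ?divr_ge0 ?sqrtr_ge0 ?exprn_ge0//.
    rewrite real_normK ?num_real// expr_div_n r2 -exprM mulnC exprM.
    rewrite (_ : 2 ^+ 2 = 4 :> R); last by rewrite -natrX.
    have := hs k _ Et; rewrite /h /dd.
    rewrite ler_pdivlMr ?exprn_gt0// ler_pdivlMr//.
    by move=> H; apply: le_trans H; rewrite le_eqVlt; apply/orP; left; apply/eqP; ring.
  have [c H] := geo_increments inc; split => // k.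
  have := H k.
  rewrite -(@ler_pXn2r _ 2)// ?nnegrE ?divr_ge0 ?mulr_ge0 ?sqrtr_ge0 ?exprn_ge0//.
  rewrite real_normK ?num_real// expr_div_n exprMn r2 -exprM mulnC exprM.
  rewrite (_ : 2 ^+ 2 = 4 :> R); last by rewrite -natrX.
  rewrite -(ler_pM2l wt) => /le_trans; apply.
  rewrite le_eqVlt; apply/orP; left; apply/eqP; field.
  by rewrite (gt_eqF wt)// andbT expf_neq0// pnatr_eq0.
(* Where S is infinite, which is a null set, u may diverge. The value 0 there makes f the limit of u
   k * \1_E everywhere on D, hence measurable. *)
pose f t := if t \in E then limn (u ^~ t) else 0.
have mf : measurable_fun D f.
  apply: (@measurable_fun_cvg _ _ _ D (fun k t => u k t * \1_E t)).
    by move=> k; apply: measurable_funM; [case: (Lu k)|exact: measurable_indic].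
  move=> t Dt; rewrite /f indicE; case: ifPn => [/set_mem Et|_].
    by under eq_fun do rewrite mulr1; case: (geo _ Et).
  by under eq_fun do rewrite mulr0; exact: cvg_cst.
have aeE : {ae mu, forall t, D t -> E t}.
  apply: filterS (integrable_ae mD iS) => t St Dt; split => //=.
  by rewrite ltey_eq St.
have bE k t : D t -> w t * ((f t - u k t) * \1_E t) ^+ 2 <= 4 / 4 ^+ k * s t.
  move=> Dt; rewrite /f indicE; case: ifPn => [/set_mem Et|_].
    by rewrite mulr1 mulrAC; exact: (geo _ Et).2.
  by rewrite mulr0 expr0n mulr0 mulr_ge0 ?s0// divr_ge0// exprn_ge0.
have mfE k : measurable_fun D (fun t => (f t - u k t) * \1_E t).
  apply: measurable_funM; last exact: measurable_indic.
  by apply: measurable_funB => //; case: (Lu k).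
have LfE k : L2 (fun t => (f t - u k t) * \1_E t).
  split => //.
  apply: (L1_le mD _ _ (L1Z mD (4 / 4 ^+ k) Ls)).
    by apply: measurable_funM => //; exact: measurable_funX.
  move=> t Dt; rewrite ger0_norm; first exact: bE.
  by rewrite mulr_ge0 ?sqr_ge0// ltW// w0.
have LuE k : L2 (fun t => u k t * \1_E t).
  case: (Lu k) => muk Luk; split.
    by apply: measurable_funM => //; exact: measurable_indic.
  apply: (L1_le mD _ _ Luk).
    apply: measurable_funM => //; apply: measurable_funX.
    by apply: measurable_funM => //; exact: measurable_indic.
  move=> t Dt; have wt := ltW (w0 Dt); rewrite indicE; case: (t \in E) => /=.
    by rewrite mulr1 ger0_norm// mulr_ge0// sqr_ge0.
  by rewrite mulr0 expr0n mulr0 normr0 mulr_ge0// sqr_ge0.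
have Lf : L2 f.
  apply: (eq_L2 mD _ (L2D mD mw w0 (LfE 0%N) (LuE 0%N))) => t Dt.
  rewrite -mulrDl subrK /f indicE; by case: ifPn => _; rewrite ?mulr1 ?mulr0.
exists f => //; exists (4 * Rintegral mu D s) => k.
have LB : L2 (fun t => f t - u k t) by exact: L2B.
have ae1 : {ae mu, forall t, D t -> f t - u k t = (f t - u k t) * \1_E t}.
  apply: filterS aeE => t H Dt; rewrite indicE mem_set ?mulr1//; exact: H.
rewrite (ip_ae_eq mD mw w0 LB (LfE k) LB ae1) ipC.
rewrite (ip_ae_eq mD mw w0 LB (LfE k) (LfE k) ae1).
rewrite mulrAC -RintegralZl//; apply: le_Rintegral => //.
- exact: L2_mul.
- exact: L1Z.
- by move=> t Dt; rewrite -expr2; exact: bE.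
Qed.

End Riesz_Fischer.

(** * Orthogonal expansions and transfer of coefficients *)

Section orthogonal_expansion.
Context d (T : measurableType d) (R : realType).
Variables (mu : {measure set T -> \bar R}) (D : set T) (mD : measurable D).
Variables (w : T -> R) (mw : measurable_fun D w) (w0 : forall t, D t -> 0 < w t).
Implicit Types (f g : T -> R) (c : nat -> R).
Notation L2 := (L2 mu D w).
Notation ip := (ip mu D w).
Notation nrm f := (ip f f).

Lemma sqr_cvg0 (x : nat -> R) : x n ^+ 2 @[n --> \oo] --> 0 ->
  x n @[n --> \oo] --> 0.
Proof.
move=> x2; apply/norm_cvg0P.
rewrite (_ : (fun n => _) = (fun n => Num.sqrt (x n ^+ 2))); last first.
  by apply/funext => n; rewrite sqrtr_sqr.
rewrite -[X in _ --> X](sqrtr0 R).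
by apply: continuous_cvg => //; exact: sqrt_continuous.
Qed.

Lemma ip_cvg (u : nat -> T -> R) f g : (forall n, L2 (u n)) -> L2 f -> L2 g ->
  nrm (fun t => f t - u n t) @[n --> \oo] --> 0 ->
  ip (u n) g @[n --> \oo] --> ip f g.
Proof.
move=> Lu Lf Lg cu.
have Ld n : L2 (fun t => f t - u n t) by exact: L2B.
have d0 : ip (fun t => f t - u n t) g @[n --> \oo] --> 0.
  apply: sqr_cvg0; apply: (@squeeze_cvgr _ _ _ _ (cst 0) (fun n => nrm (fun t => f t - u n t) * nrm g)).
  - by apply: nearW => n; rewrite sqr_ge0 ip_CS.
  - exact: cvg_cst.
  - by rewrite -[X in _ --> X](mul0r (nrm g)); apply: cvgM => //; exact: cvg_cst.
rewrite (_ : (fun n => _) = (fun n => ip f g - ip (fun t => f t - u n t) g)); last first.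
  by apply/funext => n; rewrite ipBl//; ring.
by rewrite -[X in _ --> X]subr0; apply: cvgB => //; exact: cvg_cst.
Qed.

Lemma nrm_cvg (u : nat -> T -> R) f : (forall n, L2 (u n)) -> L2 f ->
  nrm (fun t => f t - u n t) @[n --> \oo] --> 0 ->
  nrm (u n) @[n --> \oo] --> nrm f.
Proof.
move=> Lu Lf cu.
have Ld n : L2 (fun t => f t - u n t) by exact: L2B.
have E n : nrm (u n) = 2 * ip (u n) f - nrm f + nrm (fun t => f t - u n t).
  by rewrite ipBl// ![ip _ (fun t => f t - u n t)]ipC ipBl// ipBl// (ipC _ _ _ (u n) f); ring.
suff : 2 * ip (u n) f - nrm f + nrm (fun t => f t - u n t) @[n --> \oo] -->
    2 * nrm f - nrm f + 0.
  rewrite -(funext E : (fun n => nrm (u n)) = _).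
  by rewrite (_ : 2 * nrm f - nrm f + 0 = nrm f)//; ring.
apply: cvgD => //; apply: cvgB; last exact: cvg_cst.
by apply: cvgM; [exact: cvg_cst|exact: ip_cvg].
Qed.

Definition psum (e_ : nat -> T -> R) c n t : R := \sum_(i < n) c i * e_ i t.

Section system.
Variables (e_ : nat -> T -> R) (kp : R) (kp0 : 0 < kp) (Le : forall n, L2 (e_ n)).
Hypothesis orth : forall m n, ip (e_ m) (e_ n) = kp * (m == n)%:R.

Lemma L2_psum c n : L2 (psum e_ c n).
Proof. by apply: L2_sum => // i; exact: L2Z. Qed.

Lemma ip_psum c n g : L2 g -> ip (psum e_ c n) g = \sum_(i < n) c i * ip (e_ i) g.
Proof.
move=> Lg; rewrite ip_suml//; last by move=> i; exact: L2Z.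
by apply: eq_bigr => i _; rewrite ipZl.
Qed.

Lemma ip_psum_basis c n m : ip (psum e_ c n) (e_ m) = kp * c m * (m < n)%:R.
Proof.
rewrite ip_psum//; have [mn|nm] := ltnP m n.
  rewrite (bigD1 (Ordinal mn))//= orth eqxx big1 => [|i].
    by rewrite !mulr1 addr0 mulrC.
  by rewrite -val_eqE/= => /negbTE im; rewrite orth im !mulr0.
rewrite big1 ?mulr0// => i _; rewrite orth ltn_eqF ?mulr0//.
exact: leq_trans (ltn_ord i) nm.
Qed.

Lemma nrm_psum c n : nrm (psum e_ c n) = kp * \sum_(i < n) c i ^+ 2.
Proof.
rewrite ip_psum; last exact: L2_psum.
rewrite mulr_sumr; apply: eq_bigr => i _.
by rewrite ipC ip_psum_basis ltn_ord mulr1 mulrCA expr2.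
Qed.

(** Pythagoras: for m <= n the difference is the partial sum up to n for the coefficients with those
    below m replaced by 0. The absolute value makes the formula symmetric in m and n. *)
Lemma nrm_psumB c m n : nrm (fun t => psum e_ c n t - psum e_ c m t) =
  kp * `|\sum_(i < n) c i ^+ 2 - \sum_(i < m) c i ^+ 2|.
Proof.
wlog mn : m n / (m <= n)%N => [hw|].
  have [|/ltnW] := leqP m n; first exact: hw.
  move=> /hw H; rewrite distrC -H; apply: eq_Rintegral => t _; ring.
pose cut (F : nat -> R) i := if (i < m)%N then 0 else F i.
have cutE F : \sum_(i < n) cut F i = \sum_(i < n) F i - \sum_(i < m) F i.
  rewrite -!(big_mkord xpredT) !(@big_cat_nat _ _ _ m 0 n)//= addrAC subrr add0r.
  rewrite big_nat big1 ?add0r => [|i /andP[_ im]]; last by rewrite /cut im.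
  by apply: eq_big_nat => i /andP[mi _]; rewrite /cut ltnNge mi.
have -> : nrm (fun t => psum e_ c n t - psum e_ c m t) = nrm (psum e_ (cut c) n).
  have E t : psum e_ c n t - psum e_ c m t = psum e_ (cut c) n t.
    rewrite /psum -(cutE (fun i => c i * e_ i t)); apply: eq_bigr => i _.
    by rewrite /cut; case: ifP; rewrite ?mul0r.
  by apply: eq_ip => t _.
rewrite nrm_psum (eq_bigr (fun i : 'I_n => cut (fun j => c j ^+ 2) i)); last first.
  by move=> i _; rewrite /cut; case: ifP; rewrite ?expr0n.
rewrite -(cutE (fun j => c j ^+ 2)) ger0_norm//; apply: sumr_ge0 => i _.
by rewrite /cut; case: ifP => _; rewrite ?sqr_ge0.
Qed.

Lemma bessel f n : L2 f ->
  kp * \sum_(i < n) (ip f (e_ i) / kp) ^+ 2 <= nrm f.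
Proof.
move=> Lf; pose c i := ip f (e_ i) / kp.
have Lp := L2_psum c n.
have := ip_ge0 mu w0 (fun t => f t + (-1) * psum e_ c n t).
rewrite ip_expand// nrm_psum ipC ip_psum//.
rewrite (_ : \sum_(i < n) c i * ip (e_ i) f = kp * \sum_(i < n) c i ^+ 2); last first.
  rewrite mulr_sumr; apply: eq_bigr => i _; rewrite (ipC _ _ _ (e_ i)) /c; field.
  by rewrite gt_eqF.
by rewrite /c; lra.
Qed.

(** Along indices N k beyond which the sum of squares grows by at most 16^-k, the partial sums
    satisfy the hypothesis of [L2_complete]. For n >= N k the partial sum up to n stays within the
    same tail of that up to N k, so the whole sequence converges. *)
Lemma synthesis c B : (forall n, \sum_(i < n) c i ^+ 2 <= B) ->
  exists2 f, L2 f & nrm (fun t => f t - psum e_ c n t) @[n --> \oo] --> 0.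
Proof.
move=> cB; pose s n := \sum_(i < n) c i ^+ 2.
have nds : nondecreasing_seq s.
  apply/nondecreasing_seqP => n; rewrite /s big_ord_recr/= lerDl sqr_ge0//.
have cs : cvgn s.
  apply: nondecreasing_is_cvgn => //; exists B => _ [n _ <-]; exact: cB.
have sl n : s n <= limn s by exact: nondecreasing_cvgn_le.
have H k : exists N, limn s - s N <= 1 / 16%:R ^+ k.
  have p : 0 < 1 / 16%:R ^+ k :> R by rewrite divr_gt0// exprn_gt0.
  have /cvgrPdist_le/(_ _ p) [N _ /(_ N (leqnn N))/=] := cs.
  by rewrite ger0_norm ?subr_ge0// => h; exists N.
have [N hN] := choice H.
have hN2 k m : limn s - 1 / 16%:R ^+ k <= s m -> kp * `|s m - s (N k)| <= kp / 16 ^+ k.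
  move=> km; rewrite ler_wpM2l ?(ltW kp0)// ler_norml -div1r.
  by have := hN k; have := sl m; have := sl (N k); move: km; lra.
have [|f Lf [B' fB]] := @L2_complete _ _ _ mu _ mD _ mw w0 (fun k => psum e_ c (N k)) kp (fun k => L2_psum _ _).
  move=> k; rewrite nrm_psumB hN2//; have := hN k.+1.
  have : 1 / 16 ^+ k.+1 <= 1 / 16 ^+ k :> R.
    by rewrite !div1r lef_pV2 ?posrE ?exprn_gt0// ler_eXn2l ?ltr1n// leqnSn.
  lra.
exists f => //; apply/cvgrPdist_le => eps eps0.
pose M := 2 * `|B'| + 2 * kp.
have : geometric M (4^-1) n @[n --> \oo] --> 0.
  by apply: cvg_geometric; rewrite ger0_norm ?invr_ge0// invf_lt1// ltr1n.
move=> /cvgrPdist_le/(_ _ eps0)[k _ /(_ k (leqnn k))/=].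
rewrite sub0r normrN => hk.
exists (N k) => // n /= kn; rewrite sub0r normrN ger0_norm; last exact: ip_ge0.
apply: le_trans hk; apply: le_trans (ler_norm _); rewrite exprVn.
have Lk := L2_psum c (N k); have Ln := L2_psum c n.
have := ip_add_le mD mw w0 (L2B mD mw w0 Lf Lk) (L2B mD mw w0 Lk Ln).
rewrite (_ : nrm (fun t => f t - _ + _) = nrm (fun t => f t - psum e_ c n t)); last first.
  by apply: eq_Rintegral => t _; ring.
move=> /le_trans; apply.
rewrite nrm_psumB distrC.
have h1 : kp * `|s n - s (N k)| <= kp / 16 ^+ k.
  by apply: hN2; have := hN k; have := nds _ _ kn; lra.
have h2 : kp / 16 ^+ k <= kp / 4 ^+ k.
  rewrite ler_wpM2l ?(ltW kp0)// lef_pV2 ?posrE ?exprn_gt0//.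
  by rewrite lerXn2r// ?nnegrE// ler_nat.
have h3 : B' / 4 ^+ k <= `|B'| / 4 ^+ k.
  by rewrite ler_wpM2r ?ler_norm// invr_ge0 exprn_ge0.
have := fB k; rewrite /M -/(s _) -/(s _) in h1 *.
by move: h1 h2 h3; lra.
Qed.

(** f and the sum g of its own series have the same coefficients and are both orthogonal to e'.
    Completeness, assumed only for functions orthogonal to e', then makes f - g vanish. *)
Lemma expansion f e' : L2 f -> L2 e' -> ip f e' = 0 ->
  (forall n, ip (e_ n) e' = 0) ->
  (forall h, L2 h -> ip h e' = 0 -> (forall n, ip h (e_ n) = 0) ->
    {ae mu, forall t, D t -> h t = 0}) ->
  nrm (fun t => f t - psum e_ (fun i => ip f (e_ i) / kp) n t) @[n --> \oo] --> 0.
Proof.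
move=> Lf Le' fe' ee' compl; pose c i := ip f (e_ i) / kp; rewrite -/c.
have [|g Lg cg] := @synthesis c (nrm f / kp).
  by move=> n; rewrite ler_pdivlMr// mulrC; exact: bessel.
have Lfg := L2B mD mw w0 Lf Lg.
have ge' : ip g e' = 0.
  have := ip_cvg (L2_psum c) Lg Le' cg.
  under eq_fun do [rewrite ip_psum//; under eq_bigr do rewrite ee' mulr0; rewrite big1//].
  by move=> h; apply: (cvg_unique _ h (cvg_cst _)); exact: Rhausdorff.
have gc m : ip g (e_ m) = kp * c m.
  have h := ip_cvg (L2_psum c) Lg (Le m) cg.
  apply: (cvg_unique _ h); first exact: Rhausdorff.
  apply: cvg_near_cst; exists m.+1 => // n /= mn.
  by rewrite ip_psum_basis mn mulr1.
have fg0 : {ae mu, forall t, D t -> f t = g t}.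
  have : {ae mu, forall t, D t -> f t - g t = 0}.
    apply: compl => //; first by rewrite ipBl// fe' ge' subrr.
    by move=> n; rewrite ipBl// gc /c; field; rewrite gt_eqF.
  by apply: filterS => t h Dt; apply/eqP; rewrite -subr_eq0 h.
rewrite (_ : (fun n => _) = (fun n => nrm (fun t => g t - psum e_ c n t)))//.
apply/funext => n.
have L1' := L2B mD mw w0 Lf (L2_psum c n); have L2' := L2B mD mw w0 Lg (L2_psum c n).
have ae' : {ae mu, forall t, D t -> f t - psum e_ c n t = g t - psum e_ c n t}.
  by apply: filterS fg0 => t h Dt; rewrite h.
by rewrite (ip_ae_eq mD mw w0 L1' L2' L1' ae') ipC (ip_ae_eq mD mw w0 L1' L2' L2' ae').
Qed.

End system.

(** By Bessel the coefficients of f along e_ are square summable, hence they are also the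
    coefficients of some g along v_. The vector e' allows e_ to be complete in a hyperplane only: it
    is 1 / w for [sysT] and 0 for [sysU]. *)
Lemma transfer (e_ v_ : nat -> T -> R) (kp : R) f e' : 0 < kp ->
  (forall n, L2 (e_ n)) -> (forall n, L2 (v_ n)) ->
  (forall m n, ip (e_ m) (e_ n) = kp * (m == n)%:R) ->
  (forall m n, ip (v_ m) (v_ n) = kp * (m == n)%:R) ->
  L2 f -> L2 e' -> ip f e' = 0 -> (forall n, ip (e_ n) e' = 0) ->
  (forall h, L2 h -> ip h e' = 0 -> (forall n, ip h (e_ n) = 0) ->
    {ae mu, forall t, D t -> h t = 0}) ->
  exists2 g, L2 g & exists c,
    nrm (fun t => f t - psum e_ c n t) @[n --> \oo] --> 0 /\
    nrm (fun t => g t - psum v_ c n t) @[n --> \oo] --> 0.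
Proof.
move=> kp0 Le Lv oe ov Lf Le' fe' ee' compl.
pose c i := ip f (e_ i) / kp.
have [|g Lg cg] := @synthesis v_ kp kp0 Lv ov c (nrm f / kp).
  by move=> n; rewrite ler_pdivlMr// mulrC; exact: bessel.
by exists g => //; exists c; split => //; exact: expansion Le' _ _ _.
Qed.

End orthogonal_expansion.

(** * Chebyshev polynomials of both kinds *)

Section Chebyshev.
Variable R : realType.

(** One step adds the angle s to n s, with X = cos s; the addition formulas for cosine and sine need
    each other, whence the pair. *)
Fixpoint chebTU (n : nat) : {poly R} * {poly R} :=
  if n is m.+1 then
    let: (p, q) := chebTU m in ('X * p - (1 - 'X ^+ 2) * q, 'X * q + p)
  else (1, 0).

(* [chebT n] is T_n and [chebU n] is U_(n-1): chebT n (cos s) = cos (n s) and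
   sin s * chebU n (cos s) = sin (n s). *)
Definition chebT n := (chebTU n).1.
Definition chebU n := (chebTU n).2.

Lemma chebT0 : chebT 0 = 1. Proof. by []. Qed.
Lemma chebU0 : chebU 0 = 0. Proof. by []. Qed.
Lemma chebTS n : chebT n.+1 = 'X * chebT n - (1 - 'X ^+ 2) * chebU n.
Proof. by rewrite /chebT /chebU/=; case: (chebTU n). Qed.
Lemma chebUS n : chebU n.+1 = 'X * chebU n + chebT n.
Proof. by rewrite /chebT /chebU/=; case: (chebTU n). Qed.

Lemma chebTSE n x : (chebT n.+1).[x] = x * (chebT n).[x] - (1 - x ^+ 2) * (chebU n).[x].
Proof. by rewrite chebTS !hornerE. Qed.

Lemma chebUSE n x : (chebU n.+1).[x] = x * (chebU n).[x] + (chebT n).[x].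
Proof. by rewrite chebUS !hornerE. Qed.

Lemma chebTSS n x : (chebT n.+2).[x] = 2 * x * (chebT n.+1).[x] - (chebT n).[x].
Proof. by rewrite !(chebTSE, chebUSE); ring. Qed.

(** cos^2 + sin^2 = 1 as a polynomial identity, from which the bound on [-1, 1] and the product
    formulas follow without trigonometry. *)
Lemma cheb_Pell n x : (chebT n).[x] ^+ 2 + (1 - x ^+ 2) * (chebU n).[x] ^+ 2 = 1.
Proof.
elim: n => [|n ih]; first by rewrite chebT0 chebU0 horner0 -polyC1 hornerC; ring.
by rewrite chebTSE chebUSE -[RHS]ih; ring.
Qed.

Lemma chebT_le1 n x : `|x| <= 1 -> `|(chebT n).[x]| <= 1.
Proof.
move=> x1; rewrite -(@ler_pXn2r _ 2)// ?nnegrE// expr1n real_normK ?num_real//.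
rewrite -(cheb_Pell n x) lerDl mulr_ge0 ?sqr_ge0// subr_ge0 -real_normK ?num_real//.
exact: exprn_ile1.
Qed.

Lemma chebTU_add m n x : (chebT (m + n)).[x] =
  (chebT m).[x] * (chebT n).[x] - (1 - x ^+ 2) * (chebU m).[x] * (chebU n).[x] /\
  (chebU (m + n)).[x] = (chebT m).[x] * (chebU n).[x] + (chebU m).[x] * (chebT n).[x].
Proof.
elim: m => [|m [ihP ihQ]]; first by rewrite chebT0 chebU0 horner0 -polyC1 hornerC add0n; split; ring.
by rewrite addSn !chebTSE !chebUSE ihP ihQ; split; ring.
Qed.

Lemma chebT_sub m n x : (n <= m)%N -> (chebT (m - n)).[x] =
  (chebT m).[x] * (chebT n).[x] + (1 - x ^+ 2) * (chebU m).[x] * (chebU n).[x].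
Proof.
move=> nm; rewrite -{2 3}(subnK nm); have [-> ->] := chebTU_add (m - n) n x.
transitivity ((chebT (m - n)).[x] * ((chebT n).[x] ^+ 2 + (1 - x ^+ 2) * (chebU n).[x] ^+ 2)).
  by rewrite cheb_Pell mulr1.
by ring.
Qed.

(** The identities are the derivatives of cos (n s) and sin (n s) / sin s with respect to cos s; the
    factor 1 - X^2 keeps the second one polynomial. Each enters the induction step of the other. *)
Lemma deriv_chebTU n : (chebT n)^`() = n%:R * chebU n /\
  (1 - 'X ^+ 2) * (chebU n)^`() = 'X * chebU n - n%:R * chebT n.
Proof.
elim: n => [|n [ihP ihQ]].
  by rewrite chebT0 chebU0 -polyC1 derivC deriv0 !mul0r !mulr0 subrr.
have hP : (chebT n.+1)^`() = n.+1%:R * chebU n.+1.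
  rewrite chebTS derivB !derivM derivX ihP derivB derivC derivXn sub0r.
  rewrite [_ * (chebU n)^`()]ihQ chebUS -natr1 expr1; ring.
split=> //.
transitivity ((1 - 'X ^+ 2) * (chebU n + (chebT n)^`()) + 'X * ((1 - 'X ^+ 2) * (chebU n)^`())).
  by rewrite chebUS derivD derivM derivX; ring.
by rewrite ihP ihQ chebTS chebUS -natr1; ring.
Qed.

End Chebyshev.

(** * The weight w, its inverse and the arcsine *)

Section weight.
Variables (R : realType) (e : R) (he : 0 < e).
Notation leb := (@lebesgue_measure R).
Notation D := (Iopen e).
Notation w := (wgt e).

Lemma itvNe : - e < e. Proof. by rewrite (lt_trans _ he)// oppr_lt0. Qed.

Lemma IopenP t : D t <-> - e < t < e.
Proof. by rewrite /Iopen /= in_itv. Qed.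

Lemma measurable_Iopen : measurable (D : set (measurableTypeR R)).
Proof. exact: measurable_itv. Qed.

(** The square root is 0 on negative numbers, so w extends continuously by 0 to the whole line. *)
Lemma wgt_cont : continuous w.
Proof.
move=> t; apply: (@continuous_comp R R R (fun t => e ^+ 2 - t ^+ 2) Num.sqrt).
  by apply: cvgB; [exact: cvg_cst|exact: exprn_continuous].
exact: sqrt_continuous.
Qed.

Lemma wgt_measurable (A : set (measurableTypeR R)) : measurable_fun A w.
Proof. by apply: measurable_funTS; exact: continuous_measurable_fun wgt_cont. Qed.

Lemma wgt_sqr t : - e <= t <= e -> w t ^+ 2 = e ^+ 2 - t ^+ 2.
Proof.
move=> te; rewrite sqr_sqrtr// subr_ge0 -real_normK ?num_real//.
by rewrite lerXn2r// ?nnegrE ?(ltW he)// ler_norml.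
Qed.

Lemma wgt_gt0 t : D t -> 0 < w t.
Proof.
move=> /IopenP te; rewrite sqrtr_gt0 subr_gt0 -real_normK ?num_real//.
by rewrite ltrXn2r// ?nnegrE ?(ltW he)// ltr_norml.
Qed.

Lemma wgt_le t : w t <= e.
Proof.
rewrite -[leRHS](ger0_norm (ltW he)) -sqrtr_sqr ler_wsqrtr// gerBl sqr_ge0//.
Qed.

Lemma wgt_ge0 t : 0 <= w t. Proof. exact: sqrtr_ge0. Qed.

Lemma wgt_bnd : w e = 0 /\ w (- e) = 0.
Proof. by rewrite /wgt sqrrN subrr sqrtr0. Qed.

Lemma is_derive_wgt t : D t -> is_derive t 1 w (- t / w t).
Proof.
move=> Dt; have wt := wgt_gt0 Dt.
have p : 0 < e ^+ 2 - t ^+ 2 by move: wt; rewrite sqrtr_gt0.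
have d1 := @is_derive1_sqrt R _ p.
have d2 := der_sub (der_cst (e ^+ 2) t) (der_sqr (der_id t)).
apply: (is_derive_eq (der_comp d2 d1)).
by rewrite -/(w t); field; rewrite gt_eqF.
Qed.

(* [asin (t / e)], in the half-angle form, which is visibly continuous at [e] and [- e]. *)
Definition asinw t : R := 2 * atan (t / (e + w t)).

Let ew0 t : 0 < e + w t.
Proof. by rewrite ltr_wpDr ?wgt_ge0. Qed.

Lemma asinw_cont : continuous asinw.
Proof.
move=> t; apply: cvgM; first exact: cvg_cst.
apply: (@continuous_comp R R R (fun t => t / (e + w t)) atan).
  apply: cvgM; first exact: cvg_id.
  apply: cvgV; first by rewrite gt_eqF.
  by apply: cvgD; [exact: cvg_cst|exact: wgt_cont].
exact: continuous_atan.
Qed.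

Lemma is_derive_asinw t : D t -> is_derive t 1 asinw (w t)^-1.
Proof.
move=> Dt; have wt := wgt_gt0 Dt; have dw := is_derive_wgt Dt.
have w2 : w t ^+ 2 = e ^+ 2 - t ^+ 2.
  by apply: wgt_sqr; move/IopenP : Dt => /andP[? ?]; rewrite !ltW.
have t2 : t ^+ 2 = e ^+ 2 - w t ^+ 2 by rewrite w2; ring.
have e0 := gt_eqF he; have wt0 := gt_eqF wt; have ewt := gt_eqF (ew0 t).
have d1 : is_derive t 1 (fun t => t / (e + w t)) (e / (w t * (e + w t))).
  apply: (is_derive_eq (der_mul (der_id t) (der_inv _ (der_add (der_cst e t) dw)))).
    by rewrite ewt.
  transitivity ((w t * (e + w t) + t ^+ 2) / (w t * (e + w t) ^+ 2)).
    by field; rewrite wt0 ewt.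
  by rewrite t2; field; rewrite wt0 ewt.
apply: (is_derive_eq (der_scale 2 (der_comp d1 (is_derive1_atan _)))).
have -> : 1 + (t / (e + w t)) ^+ 2 = 2 * e / (e + w t).
  by rewrite expr_div_n t2; field; rewrite ewt.
by field; rewrite e0 wt0 ewt.
Qed.

Lemma asinw_total : asinw e - asinw (- e) = pi.
Proof.
have [we wNe] := wgt_bnd; rewrite /asinw we wNe addr0 mulNr atanN divff ?gt_eqF//.
by rewrite atan1; field.
Qed.

Lemma wgtV_cont : {in `]-e, e[, continuous (fun t => (w t)^-1)}.
Proof.
move=> t; rewrite in_itv/= => /IopenP /wgt_gt0 wt.
by apply: cvgV; [rewrite gt_eqF|exact: wgt_cont].
Qed.

Lemma wgtV_int : L1 leb D (fun t => (w t)^-1) /\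
  Rintegral leb D (fun t => (w t)^-1) = pi.
Proof.
rewrite -asinw_total; apply: ge0_FTC2_oo; first exact: itvNe.
- by apply: continuous_subspaceT => t; exact: asinw_cont.
- by move=> t /IopenP; exact: is_derive_asinw.
- exact: wgtV_cont.
- by move=> t /IopenP/wgt_gt0 wt; rewrite invr_ge0 ltW.
Qed.

End weight.

(** * The two orthogonal systems of X *)

Section Chebyshev_systems.
Variables (R : realType) (e : R) (he : 0 < e).
Notation leb := (@lebesgue_measure R).
Notation D := (Iopen e).
Notation w := (wgt e).
Notation X := (L2 leb D w).
Notation ipX := (ip leb D w).

Let mD := @measurable_Iopen R e.
Let mw := @wgt_measurable R e D.
Let w0 t (Dt : D t) : 0 < w t := wgt_gt0 Dt.

Lemma scaled_le1 t : D t -> `|t / e| <= 1.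
Proof.
move=> /IopenP te; rewrite normrM normfV (gtr0_norm he) ler_pdivrMr// mul1r.
by rewrite ler_norml; case/andP: te => h1 h2; rewrite !ltW.
Qed.

Lemma wgt_scaled t : D t -> 1 - (t / e) ^+ 2 = (w t / e) ^+ 2.
Proof.
move=> /IopenP/andP[h1 h2]; rewrite !expr_div_n wgt_sqr ?ltW//.
by field; rewrite gt_eqF.
Qed.

Lemma der_scaled (p : {poly R}) (t : R) :
  is_derive t 1 (fun t => p.[t / e]) (p^`().[t / e] / e).
Proof.
apply: (is_derive_eq (der_comp (der_mul (der_id t) (der_cst e^-1 t)) (is_derive_poly p _))).
by rewrite mulr0 addr0 mul1r.
Qed.

Lemma scaled_cont (p : {poly R}) : continuous (fun t : R => p.[t / e]).
Proof. by move=> t; exact: der_cont (der_scaled p t). Qed.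

Lemma scaled_measurable (p : {poly R}) (A : set (measurableTypeR R)) :
  measurable_fun A (fun t : R => p.[t / e]).
Proof. by apply: measurable_funTS; apply: continuous_measurable_fun; exact: scaled_cont. Qed.

Lemma scaled_bounded (p : {poly R}) : exists M : R, forall t, D t -> `|p.[t / e]| <= M.
Proof.
have [M _ hM] := continuous_bounded_itv (- e) e (@scaled_cont p).
by exists M.
Qed.

(** For n >= 1 a primitive of T_n (t/e) / w is - w U_(n-1) (t/e) / (n e), which is 0 at both ends
    because w is. The integrand is dominated by 1 / w, since |T_n| <= 1 on [-1, 1]. *)
Lemma chebT_wgt_int n :
  L1 leb D (fun t => (chebT R n).[t / e] / w t) /\
  Rintegral leb D (fun t => (chebT R n).[t / e] / w t) = pi * (n == 0)%:R.
Proof.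
have [Lw Iw] := wgtV_int he.
have e0 : e != 0 by rewrite gt_eqF.
case: n => [|n].
  have E t : D t -> (w t)^-1 = (chebT R 0).[t / e] / w t.
    by move=> _; rewrite chebT0 -polyC1 hornerC mul1r.
  split; first by apply: (eq_L1 mD _ Lw) => t Dt; exact: E.
  by rewrite mulr1 -Iw; apply: eq_Rintegral => t /set_mem/E.
rewrite mulr0.
have [we wNe] := wgt_bnd e.
pose F t : R := - (w t * (chebU R n.+1).[t / e]) / (e * n.+1%:R).
have Fe : F e - F (- e) = 0 by rewrite /F we wNe; ring.
rewrite -Fe.
apply: (@dominated_FTC2_oo R (fun t => (chebT R n.+1).[t / e] / w t) F (fun t => (w t)^-1) (asinw e) (- e) e).
- exact: itvNe.
- apply: continuous_subspaceT => t; apply: cvgM; last exact: cvg_cst.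
  by apply: cvgN; apply: cvgM; [exact: wgt_cont|exact: scaled_cont].
- move=> t /IopenP Dt; have wt := w0 Dt; have dw := is_derive_wgt Dt.
  apply: (is_derive_eq (der_mul (der_opp (der_mul dw (der_scaled _ t))) (der_cst _ t))).
  have [_ /(congr1 (fun p : {poly R} => p.[t / e])) E] := deriv_chebTU R n.+1.
  rewrite !(hornerE, hornerMn) (wgt_scaled Dt) in E.
  have n0 : n.+1%:R != 0 :> R by rewrite pnatr_eq0.
  move: n0 E; move: (n.+1%:R : R) => m n0 E.
  have -> : (chebT R n.+1).[t / e] = (t / e * (chebU R n.+1).[t / e] -
      (w t / e) ^+ 2 * ((chebU R n.+1)^`()).[t / e]) / m.
    by rewrite E; field; rewrite ?n0 ?e0.
  by field; rewrite n0 e0 gt_eqF.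
- move=> t /[!in_itv]/= /IopenP Dt; apply: cvgM; first exact: scaled_cont.
  by apply: wgtV_cont _; rewrite in_itv/=; apply/IopenP.
- by apply: continuous_subspaceT => t; exact: asinw_cont.
- by move=> t /IopenP; exact: is_derive_asinw.
- exact: wgtV_cont.
- move=> t /IopenP Dt; rewrite normrM normfV (gtr0_norm (w0 Dt)).
  by rewrite ler_piMl ?invr_ge0 ?(ltW (w0 Dt))// chebT_le1// scaled_le1.
Qed.

(** The index is shifted: [sysT n] comes from T_(n+1) and [sysU n] from U_n. T_0 is left out because
    1 / w spans the direction orthogonal to the mean-zero functions. *)
Definition sysT n t : R := (chebT R n.+1).[t / e] / w t.
Definition sysU n t : R := (chebU R n.+1).[t / e] / e.

Lemma wgtV_L2 : X (fun t => (w t)^-1).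
Proof.
have [Lw _] := wgtV_int he; split.
  by apply: L1_measurable Lw.
by apply: (eq_L1 mD _ Lw) => t Dt; rewrite expr2 mulrA divff ?mul1r// gt_eqF// w0.
Qed.

Lemma sysT_L2 n : X (sysT n).
Proof.
have [Lw _] := wgtV_int he; have [M hM] := scaled_bounded (chebT R n.+1 ^+ 2).
split; first by apply: measurable_funM; [exact: scaled_measurable|exact: L1_measurable Lw].
have LL := L1Mbounded mD Lw (@scaled_measurable (chebT R n.+1 ^+ 2) D) hM.
apply: (eq_L1 mD _ LL).
by move=> t Dt; rewrite /sysT horner_exp; field; rewrite gt_eqF// w0.
Qed.

Lemma bounded_L2 (f : R -> R) M : measurable_fun D f -> (forall t, D t -> `|f t| <= M) ->
  X f.
Proof.
move=> mf fM; split=> //.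
apply: (@L1_bounded_itv _ _ _ _ (e * M ^+ 2)).
  by apply: measurable_funM => //; exact: measurable_funX.
move=> t Dt; rewrite normrM (ger0_norm (wgt_ge0 e t)) ler_pM ?wgt_ge0 ?wgt_le//.
rewrite normrX lerXn2r ?nnegrE ?fM//.
exact: le_trans (fM t Dt).
Qed.

Lemma sysU_L2 n : X (sysU n).
Proof.
have [M hM] := scaled_bounded (chebU R n.+1 * (e^-1)%:P).
apply: (@bounded_L2 _ M); first by apply: measurable_funM => //; exact: scaled_measurable.
by move=> t /hM; rewrite !hornerE.
Qed.

(** 2 T_m T_n = T_(m+n) + T_(m-n); the weight cancels one of the two factors 1 / w, which leaves
    integrals known from [chebT_wgt_int]. *)
Lemma sysT_orth m n : ipX (sysT m) (sysT n) = pi / 2 * (m == n)%:R.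
Proof.
wlog nm : m n / (n <= m)%N => [hw|].
  have [/hw//|/ltnW/hw] := leqP n m.
  by rewrite ipC eq_sym.
have [L1' I1] := chebT_wgt_int (m.+1 + n.+1); have [L2' I2] := chebT_wgt_int (m - n).
transitivity (Rintegral leb D (fun t => 2^-1 *
    ((chebT R (m.+1 + n.+1)).[t / e] / w t + (chebT R (m - n)).[t / e] / w t))).
  apply: eq_Rintegral => t /set_mem Dt.
  have -> : (m - n = m.+1 - n.+1)%N by rewrite subSS.
  rewrite chebT_sub// (chebTU_add _ _ _).1 /sysT.
  by field; rewrite (gt_eqF he) (gt_eqF (w0 Dt)).
rewrite RintegralZl//; last exact: L1D.
rewrite RintegralD// I1 I2 addSn mulr0 add0r subn_eq0 mulrCA mulrA.
by congr (_ * _); congr (_ %:R); rewrite eqn_leq nm andbT.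
Qed.

(** 2 (1 - x^2) U_(m-1) U_(n-1) = T_(m-n) - T_(m+n), where 1 - x^2 is (w / e)^2. The factor 1 / e in
    [sysU] is chosen so that the norms agree with those of [sysT]. *)
Lemma sysU_orth m n : ipX (sysU m) (sysU n) = pi / 2 * (m == n)%:R.
Proof.
wlog nm : m n / (n <= m)%N => [hw|].
  have [/hw//|/ltnW/hw] := leqP n m.
  by rewrite ipC eq_sym.
have [L1' I1] := chebT_wgt_int (m.+1 + n.+1); have [L2' I2] := chebT_wgt_int (m - n).
transitivity (Rintegral leb D (fun t => 2^-1 *
    ((chebT R (m - n)).[t / e] / w t - (chebT R (m.+1 + n.+1)).[t / e] / w t))).
  apply: eq_Rintegral => t /set_mem Dt.
  have -> : (m - n = m.+1 - n.+1)%N by rewrite subSS.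
  rewrite chebT_sub// (chebTU_add _ _ _).1 /sysU (wgt_scaled Dt).
  by field; rewrite (gt_eqF he) (gt_eqF (w0 Dt)).
rewrite RintegralZl//; last exact: L1B.
rewrite RintegralB// I1 I2 addSn mulr0 subr0 subn_eq0 mulrCA mulrA.
by congr (_ * _); congr (_ %:R); rewrite eqn_leq nm andbT.
Qed.

End Chebyshev_systems.

(** * Lebesgue differentiation of primitives *)

Section primitive_derivative.
Variable R : realType.
Notation leb := (@lebesgue_measure R).
Implicit Types (f : R -> R) (a b : R).

(** Lebesgue differentiation holds for the extension of f by 0, whose primitive agrees with that of
    f near every point of ]a, b[. *)
Lemma prim_derive_ae a b f : L1 leb `]a, b[ f ->
  {ae leb, forall x, a < x < b -> is_derive x 1 (prim a f) (f x)}.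
Proof.
move=> Lf; pose g := f \_ `]a, b[.
have mab : measurable (`]a, b[ : set (measurableTypeR R)) by exact: measurable_itv.
have Lg : L1 leb setT g.
  rewrite /L1 -restrict_EFin; apply/integrable_restrict => //=.
  by rewrite setTI.
have locg : locally_integrable [set: R] g by exact: integrable_locally.
have ig y : leb.-integrable [set` Interval (BRight a) (BRight y)] (EFin \o g).
  by apply: integrableS Lg => //; exact: measurable_itv.
have := FTC1 ig locg; apply: filterS; first exact: (ae_filter_ringOfSetsType leb).
move=> x H /andP[ax xb].
have [/= dF F'] : derivable (prim a g) x 1 /\ derive1 (prim a g) x = g x by exact: H.
have gx : g x = f x by rewrite /g patchE mem_set//= in_itv/= ax.
rewrite derive1E gx in F'.
apply: near_eq_is_derive (DeriveDef dF F').
near=> y; apply: eq_Rintegral => t /set_mem/=; rewrite in_itv/= => /andP[at_ ty].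
rewrite mem_set//= in_itv/= at_/= (le_lt_trans ty)//.
by near: y; exact: lt_nbhsl.
Unshelve. all: by end_near. Qed.

Lemma prim0_ae0 a b f : L1 leb `]a, b[ f ->
  (forall x, a < x < b -> prim a f x = 0) ->
  {ae leb, forall x, a < x < b -> f x = 0}.
Proof.
move=> Lf p0; have := prim_derive_ae Lf.
apply: filterS; first exact: (ae_filter_ringOfSetsType leb).
move=> x H /[dup] xab /H dp.
have d0 : is_derive x 1 (prim a f) 0.
  apply: near_eq_is_derive (der_cst 0 x).
  have /near_in_itvoo nx : x \in `]a, b[ by rewrite in_itv.
  near=> y; rewrite p0//; suff : y \in `]a, b[ by rewrite in_itv.
  by near: y.
by rewrite -(@derive_val _ _ _ _ _ _ _ dp) (@derive_val _ _ _ _ _ _ _ d0).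
Unshelve. all: by end_near. Qed.

End primitive_derivative.

(** * Functions with vanishing moments *)

Section moments.
Variables (R : realType) (e : R) (he : 0 < e).
Notation leb := (@lebesgue_measure R).
Notation D := (Iopen e).
Let mD := @measurable_Iopen R e.
Variables (f : R -> R) (Lf : L1 leb D f).

Lemma L1_scaled (p : {poly R}) : L1 leb D (fun t => f t * p.[t / e]).
Proof.
have [M hM] := scaled_bounded e p.
exact: (L1Mbounded mD Lf (@scaled_measurable _ e p D) hM).
Qed.

(** By the recurrence, multiplication by X maps the span of the r n into itself, so vanishing
    against all r n spreads to all multiples p * r n by induction on p. *)
Lemma poly_moments (r : nat -> {poly R}) :
  (forall n, exists i j, exists alpha beta : R, 'X * r n = alpha *: r i + beta *: r j) ->
  (forall n, Rintegral leb D (fun t => f t * (r n).[t / e]) = 0) ->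
  forall p n, Rintegral leb D (fun t => f t * (p * r n).[t / e]) = 0.
Proof.
move=> rec r0; elim/poly_ind => [|p c ih] n.
  by under eq_Rintegral do rewrite mul0r horner0 mulr0; rewrite /Rintegral integral0.
have [i [j [al [be E]]]] := rec n.
transitivity (Rintegral leb D (fun t => (al * (f t * (p * r i).[t / e]) + be * (f t * (p * r j).[t / e]))
   + c * (f t * (r n).[t / e]))).
  apply: eq_Rintegral => t _; rewrite mulrDl -mulrA E !(hornerM, hornerD, hornerZ, hornerC); ring.
have L1' := L1_scaled.
have A := L1Z mD al (L1' (p * r i)); have B := L1Z mD be (L1' (p * r j)).
have C := L1Z mD c (L1' (r n)).
rewrite (RintegralD mD (L1D mD A B) C) (RintegralD mD A B).
rewrite !(RintegralZl _ mD (L1' _)) !ih r0; ring.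
Qed.

(** Bernoulli's inequality (1 - x)^m >= 1 - m x with x = s^n and m = 2^n. Here m x = (2 s)^n, which
    puts the jump of the limit at s = 1/2. *)
Lemma step_le0 (s : R) n : 0 <= s <= 1 -> 1 - (2 * s) ^+ n <= (1 - s ^+ n) ^+ (2 ^ n).
Proof.
move=> /andP[s0 s1].
have s1n : s ^+ n <= 1 by exact: exprn_ile1.
have : forall m x, 0 <= x <= 1 -> 1 - m%:R * x <= (1 - x) ^+ m :> R.
  move=> m x /andP[x0 x1]; elim: m => [|m ih]; first by rewrite mul0r subr0 expr0.
  rewrite exprS; apply: (@le_trans _ _ ((1 - x) * (1 - m%:R * x))); last first.
    by rewrite ler_wpM2l// subr_ge0.
  have : 0 <= m%:R * x ^+ 2 by rewrite mulr_ge0// sqr_ge0.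
  by rewrite -natr1; lra.
move=> /(_ (2 ^ n)%N (s ^+ n)); rewrite exprn_ge0//= s1n => /(_ isT).
by rewrite exprMn natrX.
Qed.

(** m x <= (1 + x)^m and (1 + x)^m (1 - x)^m <= 1, again with x = s^n and m = 2^n. *)
Lemma step_ge0 (s : R) n : 0 <= s <= 1 ->
  (2 * s) ^+ n * (1 - s ^+ n) ^+ (2 ^ n) <= 1.
Proof.
move=> /andP[s0 s1].
have s1n : s ^+ n <= 1 by exact: exprn_ile1.
have sn0 : 0 <= s ^+ n by exact: exprn_ge0.
have H : forall m x, 0 <= x <= 1 -> m%:R * x * (1 - x) ^+ m <= 1 :> R.
  move=> m x /andP[x0 x1].
  apply: (@le_trans _ _ ((1 + x) ^+ m * (1 - x) ^+ m)).
    rewrite ler_wpM2r ?exprn_ge0 ?subr_ge0//.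
    have : 1 + m%:R * x <= (1 + x) ^+ m.
      elim: m => [|m ih]; first by rewrite mul0r expr0 addr0.
      rewrite exprS -natr1; apply: (@le_trans _ _ ((1 + x) * (1 + m%:R * x))).
        have : 0 <= m%:R * x ^+ 2 by rewrite mulr_ge0// sqr_ge0.
        lra.
      by rewrite ler_wpM2l// addr_ge0.
    lra.
  rewrite -exprMn exprn_ile1//.
    by rewrite mulr_ge0 ?subr_ge0// addr_ge0.
  have := sqr_ge0 x; lra.
by rewrite exprMn -natrX; apply: H; rewrite sn0.
Qed.

Lemma cvg_step (s : R) : 0 <= s <= 1 -> s != 2^-1 ->
  (1 - s ^+ n) ^+ (2 ^ n) @[n --> \oo] --> (if s < 2^-1 then 1 else 0 : R).
Proof.
move=> /[dup] s01 /andP[s0 s1] sn.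
have b01 n : 0 <= (1 - s ^+ n) ^+ (2 ^ n) <= 1.
  have h : 0 <= 1 - s ^+ n <= 1.
    by rewrite subr_ge0 exprn_ile1//= gerBl exprn_ge0.
  by case/andP: h => h1 h2; rewrite exprn_ge0//= exprn_ile1.
case: ifPn => [sl|]; last rewrite -leNgt le_eqVlt eq_sym (negbTE sn)/= => sg.
  apply: (@squeeze_cvgr _ _ _ _ (fun n => 1 - (2 * s) ^+ n) (cst 1)).
  - by apply: nearW => n; rewrite step_le0//=; case/andP: (b01 n).
  - rewrite -[X in _ --> X]subr0; apply: cvgB; first exact: cvg_cst.
    apply: cvg_expr; rewrite ger0_norm ?mulr_ge0//.
    by rewrite mulrC -ltr_pdivlMr// mul1r.
  - exact: cvg_cst.
apply: (@squeeze_cvgr _ _ _ _ (cst 0) (fun n => ((2 * s)^-1) ^+ n)).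
- apply: nearW => n; case/andP: (b01 n) => -> _ /=.
  have p : 0 < (2 * s) ^+ n by rewrite exprn_gt0// mulr_gt0// (le_lt_trans _ sg).
  by rewrite exprVn -[leRHS]mul1r ler_pdivlMr// mulrC step_ge0.
- exact: cvg_cst.
- have p : 1 < 2 * s by rewrite mulrC -ltr_pdivrMr// mul1r.
  apply: cvg_expr; rewrite ger0_norm ?invr_ge0 ?(ltW (lt_trans _ p))//.
  by rewrite invf_lt1// (lt_trans _ p).
Qed.

(* The polynomials [(1 - s^n)^(2^n)] are bounded by 1 on [0, 1] and tend to the
   indicator of [s < 1/2], so vanishing moments kill every primitive. *)
Lemma moments0_ae0 (r : nat -> {poly R}) :
  (forall n, exists i j, exists alpha beta : R, 'X * r n = alpha *: r i + beta *: r j) ->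
  (exists n, r n = 1) ->
  (forall n, Rintegral leb D (fun t => f t * (r n).[t / e]) = 0) ->
  {ae leb, forall t, D t -> f t = 0}.
Proof.
move=> rec [n0 rn0] r0.
have poly0 p : Rintegral leb D (fun t => f t * p.[t / e]) = 0.
  by rewrite -(poly_moments rec r0 p n0); under [RHS]eq_Rintegral do rewrite rn0 mulr1.
suff p0 x : - e < x < e -> prim (- e) f x = 0.
  have := prim0_ae0 Lf p0; apply: filterS; first exact: (ae_filter_ringOfSetsType leb).
  by move=> x H /IopenP/H.
move=> /andP[x1 x2].
(* An affine map sending x to 1/2; since |t - x| < 2 e on D, the slope 1 / (4 e) keeps its values in
   [0, 1]. *)
pose s t : R := 2^-1 + (t - x) / (4 * e).
have e4 : 0 < 4 * e by rewrite mulr_gt0.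
have s01 t : D t -> 0 <= s t <= 1.
  move=> /IopenP/andP[t1 t2]; rewrite /s.
  have h1 : - 2^-1 <= (t - x) / (4 * e) by rewrite ler_pdivlMr//; lra.
  have h2 : (t - x) / (4 * e) <= 2^-1 by rewrite ler_pdivrMr//; lra.
  by apply/andP; split; lra.
pose S : {poly R} := (4^-1) *: 'X + (2^-1 - x / (4 * e))%:P.
have SE t : S.[t / e] = s t.
  by rewrite /S /s !(hornerD, hornerZ, hornerX, hornerC); field; rewrite (gt_eqF he).
pose q n : {poly R} := (1 - S ^+ n) ^+ (2 ^ n).
have qE n t : (q n).[t / e] = (1 - s t ^+ n) ^+ (2 ^ n).
  have -> (S' : {poly R}) m y : ((1 - S' ^+ n) ^+ m).[y] = (1 - S'.[y] ^+ n) ^+ m.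
    by rewrite !(horner_exp, hornerD, hornerN) -polyC1 hornerC.
  by rewrite SE.
have sx t : (s t < 2^-1) = (t < x).
  by rewrite /s gtrDl pmulr_llt0 ?invr_gt0// subr_lt0.
have lim : Rintegral leb D (fun t => f t * (q n).[t / e]) @[n --> \oo] -->
    Rintegral leb D (f \_ `]-oo, x[).
  apply: (L1_dominated mD (g := fun t => `|f t|)).
  - by move=> n; apply: L1_measurable (L1_scaled _).
  (* At t = x, where s t = 1/2, the steps tend neither to 0 nor to 1; this one point is
     negligible. *)
  - exists [set x]; split; first exact: measurable_set1.
      exact: lebesgue_measure_set1.
    move=> t /= /not_implyP[Dt]; apply: contra_notP => /eqP tx.
    have sn : s t != 2^-1.
      rewrite /s -subr_eq0 addrAC subrr add0r mulf_neq0 ?subr_eq0//.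
      by rewrite invr_neq0// gt_eqF.
    under eq_fun do rewrite qE.
    rewrite patchE mem_setE in_itv/= -(sx t).
    rewrite (_ : (if s t < 2^-1 then f t else point) = f t * (if s t < 2^-1 then 1 else 0)); last first.
      by case: ifP; rewrite ?mulr1 ?mulr0.
    by apply: cvgM; [exact: cvg_cst|exact: cvg_step (s01 _ Dt) sn].
  - apply/measurable_restrict => //.
    by apply: measurable_funS (L1_measurable Lf) => // t [].
  - exact: L1_norm.
  - move=> n t Dt; rewrite qE normrM ler_piMr//.
    have /andP[h1 h2] : 0 <= 1 - s t ^+ n <= 1.
      by case/andP: (s01 t Dt) => ? ?; rewrite subr_ge0 exprn_ile1//= gerBl exprn_ge0.
    by rewrite ger0_norm ?exprn_ge0// exprn_ile1.
have : Rintegral leb D (f \_ `]-oo, x[) = 0.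
  apply: (cvg_unique _ lim); first exact: Rhausdorff.
  by rewrite /=; under eq_fun do rewrite poly0; exact: cvg_cst.
rewrite -Rintegral_mkcondr (_ : D `&` _ = `]- e, x[%classic); last first.
  apply/seteqP; split => [t [/IopenP/andP[t1 _]]|t]/=; rewrite !in_itv/=.
    by rewrite t1.
  by move=> /andP[t1 t2]; split => //; apply/IopenP; rewrite t1 (lt_trans t2).
rewrite /prim -Rintegral_itv_bndo_bndc//.
apply: L1_subitv Lf; first exact: measurable_itv.
by apply: subset_itv; rewrite bnd_simp// ltW.
Qed.

End moments.

(** * The isometry between mean-zero functions and X *)

Section conjugate_functions.
Variables (R : realType) (e : R) (he : 0 < e).
Notation leb := (@lebesgue_measure R).
Notation D := (Iopen e).
Notation w := (wgt e).
Notation X := (L2 leb D w).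
Notation ipX := (ip leb D w).
Notation N f := (ipX f f).
Let mD := @measurable_Iopen R e.
Let mw := @wgt_measurable R e D.
Let w0 t (Dt : D t) : 0 < w t := wgt_gt0 Dt.

Lemma ip_divw f k : ipX f (fun t => k t / w t) = Rintegral leb D (fun t => f t * k t).
Proof.
apply: eq_Rintegral => t /set_mem Dt; field; by rewrite gt_eqF// w0.
Qed.

(** f is the product w * f * (1 / w), and 1 / w belongs to X. *)
Lemma X_L1 f : X f -> L1 leb D f.
Proof.
move=> Xf; apply: (eq_L1 mD _ (L2_mul mD mw w0 Xf (wgtV_L2 he))) => t Dt.
by field; rewrite gt_eqF// w0.
Qed.

Lemma X_L1w f : X f -> L1 leb D (fun t => w t * f t).
Proof.
move=> Xf; apply: (L1_le mD _ _ (L1Z mD e (L1_norm (X_L1 Xf)))).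
  by apply: measurable_funM => //; case: Xf.
by move=> t Dt; rewrite normrM (gtr0_norm (w0 Dt)) ler_wpM2r// wgt_le.
Qed.

Lemma ip_wgtV f : ipX f (fun t => (w t)^-1) = Rintegral leb D f.
Proof.
transitivity (ipX f (fun t => 1 / w t)); first by apply: eq_ip => // t _; rewrite div1r.
by rewrite ip_divw; under eq_Rintegral do rewrite mulr1.
Qed.

Lemma sysT_mean0 n : ipX (sysT e n) (fun t => (w t)^-1) = 0.
Proof. by rewrite ip_wgtV (chebT_wgt_int he n.+1).2 mulr0. Qed.

Lemma sysT_complete h : X h -> ipX h (fun t => (w t)^-1) = 0 ->
  (forall n, ipX h (sysT e n) = 0) -> {ae leb, forall t, D t -> h t = 0}.
Proof.
move=> Xh; rewrite ip_wgtV => h0 hn.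
apply: (@moments0_ae0 _ _ he _ (X_L1 Xh) (chebT R)); last first.
- move=> [|n]; last by rewrite -ip_divw; exact: hn.
  by rewrite -h0; apply: eq_Rintegral => t _; rewrite chebT0 -polyC1 hornerC mulr1.
- by exists 0%N.
case=> [|n].
  exists 1%N, 1%N, 1, 0; rewrite scale1r scale0r chebTS chebT0 chebU0; ring.
exists n.+2, n, (2^-1), (2^-1).
rewrite !chebTS chebUS -scalerDr; apply: (@scalerI _ _ 2); first by rewrite pnatr_eq0.
rewrite scalerA divff ?pnatr_eq0// scale1r scaler_nat; ring.
Qed.

Lemma sysU_complete h : X h -> (forall n, ipX h (sysU e n) = 0) ->
  {ae leb, forall t, D t -> h t = 0}.
Proof.
move=> Xh hn; have Lwh := X_L1w Xh.
suff : {ae leb, forall t, D t -> w t * h t = 0}.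
  apply: filterS; first exact: (ae_filter_ringOfSetsType leb).
  move=> t H Dt; move/eqP : (H Dt); rewrite mulf_eq0 gt_eqF ?w0//=.
  by move/eqP.
apply: (@moments0_ae0 _ _ he _ Lwh (chebU R)); last first.
- move=> [|n].
    under eq_Rintegral do rewrite chebU0 horner0 mulr0.
    by rewrite /Rintegral integral0.
  transitivity (e * ipX h (sysU e n)); last by rewrite hn mulr0.
  rewrite -RintegralZl//; last exact: (L2_mul mD mw w0 Xh (sysU_L2 he n)).
  by apply: eq_Rintegral => t _; rewrite /sysU; field; rewrite gt_eqF.
- by exists 1%N; rewrite chebUS chebU0 chebT0 mulr0 add0r.
case=> [|n].
  exists 0%N, 0%N, 0, 0; rewrite chebU0 !scaler0; ring.
exists n.+2, n, (2^-1), (2^-1).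
rewrite !chebUS chebTS -scalerDr; apply: (@scalerI _ _ 2); first by rewrite pnatr_eq0.
rewrite scalerA divff ?pnatr_eq0// scale1r scaler_nat; ring.
Qed.

(** A relation rather than a map: one coefficient sequence expands nu in [sysT] and g in [sysU]. It
    can be entered from either side, which gives the isometry and its surjectivity. *)
Definition conj_pair (nu g : R -> R) := exists c : nat -> R,
  N (fun t => nu t - psum (sysT e) c n t) @[n --> \oo] --> 0 /\
  N (fun t => g t - psum (sysU e) c n t) @[n --> \oo] --> 0.

Let pi2 : 0 < pi / 2 :> R. Proof. by rewrite divr_gt0// pi_gt0. Qed.

Lemma conj_pair_exists nu : X nu -> Rintegral leb D nu = 0 ->
  exists2 g, X g & conj_pair nu g.
Proof.
move=> Xnu nu0.
apply: (transfer mD mw w0 pi2 (sysT_L2 he) (sysU_L2 he) (sysT_orth he) (sysU_orth he)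
  Xnu (wgtV_L2 he) _ sysT_mean0 sysT_complete).
by rewrite ip_wgtV.
Qed.

(** [sysU] is complete in the whole of X, so [transfer] is used with the systems exchanged and the
    excluded vector equal to 0. *)
Lemma conj_pair_exists_inv g : X g -> exists2 nu, X nu & conj_pair nu g.
Proof.
move=> Xg.
have Z : X (fun=> 0) by exact: L2_0.
have [|n|h Xh _|nu Xnu [c [c1 c2]]] := @transfer _ _ _ leb _ mD _ mw w0 _ _ _ g (fun=> 0)
  pi2 (sysU_L2 he) (sysT_L2 he) (sysU_orth he) (sysT_orth he) Xg Z.
- by rewrite /ip; under eq_Rintegral do rewrite !mulr0; rewrite /Rintegral integral0.
- by rewrite /ip; under eq_Rintegral do rewrite !mulr0; rewrite /Rintegral integral0.
- exact: sysU_complete.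
- by exists nu => //; exists c.
Qed.

(** Inner products are continuous in norm, so an equality between a functional of nu and a
    functional of g need only be checked on corresponding basis functions. *)
Lemma conj_pairing nu g k l : X nu -> X g -> X k -> X l ->
  (forall n, ipX (sysT e n) k = ipX (sysU e n) l) ->
  conj_pair nu g -> ipX nu k = ipX g l.
Proof.
move=> Xnu Xg Xk Xl kl [c [c1 c2]].
have LT := L2_psum mD mw w0 (sysT_L2 he) c.
have LU := L2_psum mD mw w0 (sysU_L2 he) c.
have h1 := ip_cvg mD mw w0 LT Xnu Xk c1.
have h2 := ip_cvg mD mw w0 LU Xg Xl c2.
apply: (cvg_unique _ h1); first exact: Rhausdorff.
rewrite /= (_ : (fun n => _) = (fun n => ipX (psum (sysU e) c n) l))//.
apply/funext => n; rewrite !(ip_psum mD mw w0 (sysT_L2 he)) ?(ip_psum mD mw w0 (sysU_L2 he))//.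
by apply: eq_bigr => i _; rewrite kl.
Qed.

Lemma conj_pair_mean0 nu g : X nu -> X g -> conj_pair nu g -> Rintegral leb D nu = 0.
Proof.
move=> Xnu Xg; rewrite -ip_wgtV.
have Z : X (fun=> 0) by exact: L2_0.
move=> /(conj_pairing Xnu Xg (wgtV_L2 he) Z) ->.
  by rewrite /ip; under eq_Rintegral do rewrite !mulr0; rewrite /Rintegral integral0.
move=> n; rewrite sysT_mean0.
by rewrite /ip; under eq_Rintegral do rewrite !mulr0; rewrite /Rintegral integral0.
Qed.

Lemma conj_pair_norm nu g : X nu -> X g -> conj_pair nu g -> N nu = N g.
Proof.
move=> Xnu Xg [c [c1 c2]].
have LT := L2_psum mD mw w0 (sysT_L2 he) c.
have LU := L2_psum mD mw w0 (sysU_L2 he) c.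
have h1 := nrm_cvg mD mw w0 LT Xnu c1.
have h2 := nrm_cvg mD mw w0 LU Xg c2.
apply: (cvg_unique _ h1); first exact: Rhausdorff.
rewrite /= (_ : (fun n => _) = (fun n => N (psum (sysU e) c n)))//.
apply/funext => n.
by rewrite (nrm_psum mD mw w0 (sysT_L2 he) (sysT_orth he))
  (nrm_psum mD mw w0 (sysU_L2 he) (sysU_orth he)).
Qed.

End conjugate_functions.

(** * Bounded solutions of a three-term recurrence *)

Section bounded_recurrence.
Local Open Scope complex_scope.
Variable R : realType.
Implicit Types (x y z : R[i]).

(** The squared modulus with values in R, whereas the norm of [R[i]] is itself complex-valued. *)
Definition n2 x : R := Re x ^+ 2 + Im x ^+ 2.

Lemma n2_ge0 x : 0 <= n2 x. Proof. by rewrite addr_ge0 ?sqr_ge0. Qed.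

Lemma n2M x y : n2 (x * y) = n2 x * n2 y.
Proof. by case: x y => [a b] [c d]; rewrite /n2/=; ring. Qed.

Lemma n2_sub_le x y : n2 (x - y) <= 2 * n2 x + 2 * n2 y.
Proof.
case: x y => [a b] [c d]; rewrite /n2/=.
by have := sqr_ge0 (a + c); have := sqr_ge0 (b + d); lra.
Qed.

Lemma n2_eq0 x : n2 x = 0 -> x = 0.
Proof.
case: x => [a b]; rewrite /n2/= => /eqP.
rewrite paddr_eq0 ?sqr_ge0// !sqrf_eq0 => /andP[/eqP -> /eqP ->] //.
Qed.

(** The characteristic roots are zeta and 1 / zeta. The defect dd n = a (n+1) - zeta a n is divided
    by zeta at each step, so unless it is 0 it grows geometrically, against boundedness. *)
Lemma bounded_recurrence (a : nat -> R[i]) (Z zeta : R[i]) (M : R) :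
  zeta ^+ 2 = 2 * Z * zeta - 1 -> n2 zeta < 1 ->
  (forall n, a n.+2 = 2 * Z * a n.+1 - a n) -> (forall n, n2 (a n) <= M) ->
  forall n, a n.+1 = zeta * a n.
Proof.
move=> hz z1 rec aM.
pose dd n := a n.+1 - zeta * a n.
have hd n : dd n = zeta * dd n.+1.
  rewrite /dd rec.
  transitivity (zeta * (2 * Z * a n.+1 - a n) - (2 * Z * zeta - 1) * a n.+1); first by ring.
  by rewrite -hz; ring.
have hdn n k : n2 (dd n) = n2 zeta ^+ k * n2 (dd (n + k)%N).
  elim: k => [|k ih]; first by rewrite expr0 mul1r addn0.
  by rewrite ih [in LHS]hd n2M addnS exprSr mulrA.
have M0 : 0 <= M := le_trans (n2_ge0 _) (aM 0%N).
have dM n : n2 (dd n) <= 4 * M.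
  apply: (le_trans (n2_sub_le _ _)); rewrite n2M.
  have : n2 zeta * n2 (a n) <= 1 * M by rewrite ler_pM ?n2_ge0 ?aM// ltW.
  by have := aM n.+1; lra.
have d0 n : n2 (dd n) = 0.
  apply/eqP; rewrite eq_le n2_ge0 andbT.
  have c : n2 zeta ^+ k * (4 * M) @[k --> \oo] --> 0.
    rewrite -[X in _ --> X](mul0r (4 * M)); apply: cvgM; last exact: cvg_cst.
    by apply: cvg_expr; rewrite ger0_norm ?n2_ge0.
  rewrite -(cvg_lim _ c)//; apply: limr_ge; first by apply/cvg_ex; exists 0.
  by apply: nearW => k; rewrite (hdn n k) ler_wpM2l// exprn_ge0// n2_ge0.
by move=> n; apply/eqP; rewrite -subr_eq0; apply/eqP; exact: n2_eq0 (d0 n).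
Qed.

End bounded_recurrence.

(** * Cauchy transforms in the upper half plane *)

Section Cauchy_transform.
Local Open Scope complex_scope.
Variables (R : realType) (e : R) (he : 0 < e).
Notation leb := (@lebesgue_measure R).
Notation D := (Iopen e).
Notation w := (wgt e).
Notation X := (L2 leb D w).
Notation ipX := (ip leb D w).
Let mD := @measurable_Iopen R e.
Let mw := @wgt_measurable R e D.
Let w0 t (Dt : D t) : 0 < w t := wgt_gt0 Dt.

(** [kerA] and [kerB] are the real part and minus the imaginary part of 1 / (tau + i y - t); [kerB]
    is pi times the Poisson kernel. *)
Definition kerA (tau y t : R) : R := (tau - t) / ((tau - t) ^+ 2 + y ^+ 2).
Definition kerB (tau y t : R) : R := y / ((tau - t) ^+ 2 + y ^+ 2).

Variables (tau y : R) (y0 : 0 < y).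
Notation kA := (kerA tau y).
Notation kB := (kerB tau y).

Lemma ker_den_gt0 t : 0 < (tau - t) ^+ 2 + y ^+ 2.
Proof. by rewrite ltr_wpDl ?sqr_ge0// exprn_gt0. Qed.
Let den t := gt_eqF (ker_den_gt0 t).

Lemma kerA_cont : continuous kA.
Proof.
move=> t; apply: cvgM; first by apply: cvgB; [exact: cvg_cst|exact: cvg_id].
apply: cvgV; first by rewrite den.
apply: cvgD; last exact: cvg_cst.
by apply: cvgM; apply: cvgB; (exact: cvg_cst || exact: cvg_id).
Qed.

Lemma kerB_cont : continuous kB.
Proof.
move=> t; apply: cvgM; first exact: cvg_cst.
apply: cvgV; first by rewrite den.
apply: cvgD; last exact: cvg_cst.
by apply: cvgM; apply: cvgB; (exact: cvg_cst || exact: cvg_id).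
Qed.

Lemma kerA_le t : `|kA t| <= y^-1.
Proof.
rewrite normrM normfV (gtr0_norm (ker_den_gt0 t)) ler_pdivrMr ?ker_den_gt0//.
rewrite ler_pdivlMl// -[(tau - t) ^+ 2]real_normK ?num_real//.
have := sqr_ge0 (`|tau - t| - y); have := sqr_ge0 (`|tau - t| + y); lra.
Qed.

Lemma kerB_ge0 t : 0 <= kB t.
Proof. by rewrite divr_ge0 ?ltW// ker_den_gt0. Qed.

Lemma kerB_le t : `|kB t| <= y^-1.
Proof.
rewrite ger0_norm ?kerB_ge0// ler_pdivrMr ?ker_den_gt0// ler_pdivlMl//.
by rewrite -expr2 lerDr sqr_ge0.
Qed.

Lemma kerA_measurable (A : set (measurableTypeR R)) : measurable_fun A kA.
Proof. by apply: measurable_funTS; exact: continuous_measurable_fun kerA_cont. Qed.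

Lemma kerB_measurable (A : set (measurableTypeR R)) : measurable_fun A kB.
Proof. by apply: measurable_funTS; exact: continuous_measurable_fun kerB_cont. Qed.

Lemma L1_kerA f : L1 leb D f -> L1 leb D (fun t => f t * kA t).
Proof. by move=> Lf; exact: (L1Mbounded mD Lf (@kerA_measurable D) (fun t _ => kerA_le t)). Qed.

Lemma L1_kerB f : L1 leb D f -> L1 leb D (fun t => f t * kB t).
Proof. by move=> Lf; exact: (L1Mbounded mD Lf (@kerB_measurable D) (fun t _ => kerB_le t)). Qed.

(* [cauchy f] is the integral of [f t / (tau + i y - t)]. *)
Definition cauchy (f : R -> R) : R[i] :=
  Rintegral leb D (fun t => f t * kA t) -i* Rintegral leb D (fun t => f t * kB t).

(** With z = tau + i y this integrates t / (z - t) = z / (z - t) - 1 against f. *)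
Lemma cauchy_id f : L1 leb D f -> L1 leb D (fun t => t * f t) ->
  cauchy (fun t => t * f t) = (tau +i* y) * cauchy f - (Rintegral leb D f)%:C.
Proof.
move=> Lf Ltf; have LA := L1_kerA Lf; have LB := L1_kerB Lf.
apply/eqP; rewrite eq_complex /=; apply/andP; split; apply/eqP.
- rewrite mulrN opprK -!RintegralZl// -RintegralD//; [|exact: L1Z..].
  rewrite -RintegralB//; last by apply: L1D => //; exact: L1Z.
  by apply: eq_Rintegral => t _; rewrite /kerA /kerB; field; rewrite den.
- rewrite mulrN subr0 -!RintegralZl// addrC -RintegralB//; [|exact: L1Z..].
  rewrite -[LHS]mulN1r -RintegralZl//; last exact: L1_kerB.
  by apply: eq_Rintegral => t _; rewrite /kerA /kerB; field; rewrite den.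
Qed.

Lemma cauchy_lin f g a b : L1 leb D f -> L1 leb D g ->
  cauchy (fun t => a * f t + b * g t) = a%:C * cauchy f + b%:C * cauchy g.
Proof.
move=> Lf Lg.
have LA := L1_kerA Lf; have LB := L1_kerB Lf.
have LA' := L1_kerA Lg; have LB' := L1_kerB Lg.
apply/eqP; rewrite eq_complex /=; apply/andP; split; apply/eqP.
- rewrite !mul0r !subr0 -!RintegralZl// -RintegralD//; [|exact: L1Z..].
  by apply: eq_Rintegral => t _; ring.
- rewrite !mul0r !addr0 !mulrN -opprD -!RintegralZl// -RintegralD//; [|exact: L1Z..].
  by congr (- _); apply: eq_Rintegral => t _; ring.
Qed.

Lemma eq_cauchy f g : (forall t, D t -> f t = g t) -> cauchy f = cauchy g.
Proof.
by move=> fg; congr Complex; [|congr (- _)]; apply: eq_Rintegral => t /set_mem Dt; rewrite fg.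
Qed.

Lemma n2_cauchy_le f g : L1 leb D f -> L1 leb D g -> (forall t, D t -> `|f t| <= g t) ->
  n2 (cauchy f) <= 2 * (Rintegral leb D g / y) ^+ 2.
Proof.
move=> Lf Lg fg.
have bnd (k : R -> R) : measurable_fun (D : set (measurableTypeR R)) k -> (forall t, `|k t| <= y^-1) ->
    Rintegral leb D (fun t => f t * k t) ^+ 2 <= (Rintegral leb D g / y) ^+ 2.
  move=> mk ky; have Lfk := L1Mbounded mD Lf mk (fun t _ => ky t).
  rewrite -real_normK ?num_real// lerXn2r// ?nnegrE//.
    rewrite divr_ge0 ?(ltW y0)//; apply: Rintegral_ge0 => t Dt.
    exact: le_trans (fg t Dt).
  apply: (le_trans (le_normr_Rintegral mD Lfk)).
  rewrite -RintegralZr//; apply: le_Rintegral => //; first exact: L1_norm.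
    by apply: (eq_L1 mD _ (L1Z mD y^-1 Lg)) => t _; rewrite mulrC.
  by move=> t Dt; rewrite normrM ler_pM// fg.
rewrite /n2/= sqrrN mulr2n mulrDl mul1r lerD//; apply: bnd.
- exact: kerA_measurable.
- exact: kerA_le.
- exact: kerB_measurable.
- exact: kerB_le.
Qed.

(** z^2 - e^2 = - u + i v has modulus r, hence q^2 = (u + r) / 2, and p is read off from p q = tau
    y. The bound w tau <= q is uniform in y and keeps the root away from 0 as y tends to 0. *)
Lemma sqrt_upper_half : D tau -> exists p q : R,
  [/\ (p +i* q) ^+ 2 = (tau +i* y) ^+ 2 - (e ^+ 2)%:C, w tau <= q & p * q = tau * y].
Proof.
move=> Dt; have wt := w0 Dt.
have w2 : w tau ^+ 2 = e ^+ 2 - tau ^+ 2.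
  by apply: wgt_sqr => //; move/IopenP : Dt => /andP[? ?]; rewrite !ltW.
pose u := w tau ^+ 2 + y ^+ 2; pose v := 2 * tau * y.
have u0 : 0 < u by rewrite addr_gt0 ?exprn_gt0.
pose r := Num.sqrt (u ^+ 2 + v ^+ 2).
have r2 : r ^+ 2 = u ^+ 2 + v ^+ 2 by rewrite sqr_sqrtr// addr_ge0 ?sqr_ge0.
have ur : u <= r.
  by rewrite -[u]gtr0_norm// -sqrtr_sqr ler_wsqrtr// lerDl sqr_ge0.
pose q := Num.sqrt ((u + r) / 2).
have ur0 : 0 < (u + r) / 2 by rewrite divr_gt0// addr_gt0// (lt_le_trans u0).
have q0 : 0 < q by rewrite sqrtr_gt0.
have q2 : q ^+ 2 = (u + r) / 2 by rewrite sqr_sqrtr// ltW.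
have v2 : v ^+ 2 = (r - u) * (2 * q ^+ 2) by rewrite q2; lra.
have pq : tau * y / q * q = tau * y by field; rewrite gt_eqF.
exists (tau * y / q), q; split => //.
- have p2 : (tau * y / q) ^+ 2 - q ^+ 2 = - u.
    have -> : (tau * y / q) ^+ 2 = v ^+ 2 / (4 * q ^+ 2) by rewrite /v; field; rewrite gt_eqF.
    rewrite v2; transitivity ((r - u) / 2 - q ^+ 2); last by rewrite q2; field.
    by field; rewrite gt_eqF.
  apply/eqP; rewrite eq_complex /= -!expr2; apply/andP; split; apply/eqP.
    rewrite p2 /u w2; ring.
  by rewrite (mulrC q) pq; ring.
- rewrite -(@ler_pXn2r _ 2)// ?nnegrE ?(ltW wt) ?(ltW q0)// q2.
  have : 0 <= y ^+ 2 by exact: sqr_ge0.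
  by rewrite /u in ur *; lra.
Qed.

(* The transforms of the [T_n / w] are bounded and satisfy the Chebyshev three-term
   recurrence, so they form a geometric sequence whose ratio is the root of modulus
   < 1 of the characteristic equation. *)
Lemma cauchy_sys n (S : R[i]) : S ^+ 2 = (tau +i* y) ^+ 2 - (e ^+ 2)%:C ->
  0 < tau * Re S + y * Im S ->
  S * cauchy (sysT e n) = cauchy (fun t => w t * sysU e n t).
Proof.
move=> S2 zS; pose z := tau +i* y.
pose ie : R[i] := (e^-1)%:C.
have eie : e%:C * ie = 1.
  by rewrite /ie -rmorphM/= divff// gt_eqF.
pose Z := ie * z; pose zeta := ie * (z - S).
have eZ : e%:C * Z = z by rewrite mulrA eie mul1r.
have ez : e%:C * zeta = z - S by rewrite mulrA eie mul1r.
have S2' : S ^+ 2 = z ^+ 2 - e%:C ^+ 2 by rewrite S2 -rmorphXn.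
have hz : zeta ^+ 2 = 2 * Z * zeta - 1.
  transitivity (2 * Z * zeta - (e%:C * ie) ^+ 2); last by rewrite eie expr1n.
  transitivity (ie ^+ 2 * (z ^+ 2 - 2 * z * S + S ^+ 2)); first by rewrite /zeta; ring.
  by rewrite S2' /Z /zeta; ring.
(* zeta and zeta' = (z + S) / e are inverse to each other, and the sign hypothesis on S amounts to
   |z - S| < |z + S|. *)
have z1 : n2 zeta < 1.
  pose zeta' := ie * (z + S).
  have P : n2 zeta * n2 zeta' = 1.
    rewrite -n2M (_ : zeta * zeta' = 1); first by rewrite /n2/= expr0n addr0 expr1n.
    transitivity (ie ^+ 2 * (z ^+ 2 - S ^+ 2)); first by rewrite /zeta /zeta'; ring.
    by transitivity ((e%:C * ie) ^+ 2); [rewrite S2'; ring|rewrite eie expr1n].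
  have L : n2 zeta < n2 zeta'.
    rewrite -subr_gt0 (_ : _ - _ = 4 / e ^+ 2 * (tau * Re S + y * Im S)).
      by rewrite mulr_gt0// divr_gt0// exprn_gt0.
    by rewrite /zeta /zeta' /z; case: (S) => p q; rewrite /n2/=; field; rewrite gt_eqF.
  rewrite ltNge; apply/negP => z1.
  have : n2 zeta' <= 1 by rewrite -P ler_peMl// n2_ge0.
  by move/(lt_le_trans L); rewrite ltNge z1.
pose T_ m t : R := (chebT R m).[t / e] / w t.
have LT m : L1 leb D (T_ m) := (chebT_wgt_int he m).1.
have LtT m : L1 leb D (fun t => t * T_ m t).
  have me : measurable_fun (D : set (measurableTypeR R)) (fun t : R => t) by exact: measurable_id.
  have be t : D t -> `|t| <= e.
    by move=> /IopenP /andP[? ?]; rewrite ler_norml !ltW.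
  by apply: (eq_L1 mD _ (L1Mbounded mD (LT m) me be)) => t _; rewrite mulrC.
(* The constant produced by [cauchy_id] is the mean of T_(m+1) / w, which is 0; so the recurrence is
   homogeneous from m = 0 on. *)
have rec m : cauchy (T_ m.+2) = 2 * Z * cauchy (T_ m.+1) - cauchy (T_ m).
  have -> : cauchy (T_ m.+2) = cauchy (fun t => (2 / e) * (t * T_ m.+1 t) + (-1) * T_ m t).
    by apply: eq_cauchy => t _; rewrite /T_ chebTSS; ring.
  rewrite cauchy_lin// cauchy_id// (chebT_wgt_int he m.+1).2 mulr0 subr0.
  rewrite rmorphN rmorph1 mulN1r rmorphM/= (_ : 2%:C = 2) ?rmorph_nat//.
  by rewrite -/ie /Z -/z; ring.
have bnd m : n2 (cauchy (T_ m)) <= 2 * (pi / y) ^+ 2.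
  have [Lw <-] := wgtV_int he; apply: n2_cauchy_le => // t Dt.
  rewrite normrM normfV (gtr0_norm (w0 Dt)).
  by rewrite ler_piMl ?invr_ge0 ?(ltW (w0 Dt))// chebT_le1// scaled_le1.
have geo := bounded_recurrence hz z1 rec bnd.
(* This is 2 (1 - x^2) U_n = T_n - T_(n+2). *)
have -> : cauchy (fun t => w t * sysU e n t) = (e / 2)%:C * (cauchy (T_ n) - cauchy (T_ n.+2)).
  rewrite mulrBr -mulNr -rmorphN -cauchy_lin//; apply: eq_cauchy => t Dt.
  rewrite /T_ /sysU (_ : (chebT R n).[t / e] = 2 * (t / e) * (chebT R n.+1).[t / e] - (chebT R n.+2).[t / e]).
    rewrite [(chebT R n.+2).[_]]chebTSE (wgt_scaled he Dt).
    by field; rewrite (gt_eqF he) (gt_eqF (w0 Dt)).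
  by rewrite chebTSS; ring.
rewrite -[sysT e n]/(T_ n.+1) !geo.
have SE : S = z - e%:C * zeta by rewrite ez; ring.
transitivity (z * zeta * cauchy (T_ n) - e%:C * zeta ^+ 2 * cauchy (T_ n)).
  by rewrite {1}SE; ring.
rewrite rmorphM/= -[z]eZ.
transitivity (e%:C * (2^-1)%:C * (1 - zeta ^+ 2) * cauchy (T_ n)); last by ring.
rewrite hz; have h2 : 2 * (2^-1)%:C = 1 :> R[i].
  by rewrite -[2]/(2%:R) -(rmorph_nat (real_complex R)) -rmorphM/= divff// pnatr_eq0.
transitivity (e%:C * (2 * (2^-1)%:C) * (1 - Z * zeta) * cauchy (T_ n)); last by ring.
by rewrite h2; ring.
Qed.

Lemma divw_L2 (k : R -> R) M : measurable_fun (D : set (measurableTypeR R)) k ->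
  (forall t, `|k t| <= M) -> X (fun t => k t / w t).
Proof.
move=> mk kM; have [Lw _] := wgtV_int he.
split; first by apply: measurable_funM => //; exact: L1_measurable Lw.
have mk2 : measurable_fun (D : set (measurableTypeR R)) (fun t => k t ^+ 2) by exact: measurable_funX.
have k2M t : D t -> `|k t ^+ 2| <= M ^+ 2.
  move=> _; rewrite normrX lerXn2r ?nnegrE//; exact: le_trans (kM t).
apply: (eq_L1 mD _ (L1Mbounded mD Lw mk2 k2M)) => t Dt.
by field; rewrite (gt_eqF (w0 Dt)).
Qed.

(* Real part of [S * cauchy nu = cauchy (w g)], where [S = p + i q] is the square root
   of [(tau + i y)^2 - e^2] in the upper half plane. *)
Lemma conj_pair_kernel nu g : D tau -> X nu -> X g -> conj_pair e nu g ->
  exists p q : R, [/\ w tau <= q, p * q = tau * y, q ^+ 2 - p ^+ 2 = w tau ^+ 2 + y ^+ 2 &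
    Rintegral leb D (fun t => nu t * kA t) =
    (p * Rintegral leb D (fun t => w t * g t * kA t) -
     q * Rintegral leb D (fun t => w t * g t * kB t)) / (p ^+ 2 + q ^+ 2)].
Proof.
move=> Dt Xnu Xg cp; have wt := w0 Dt.
have [p [q [S2 wq pq]]] := sqrt_upper_half Dt.
have q0 : 0 < q := lt_le_trans wt wq.
have pq2 : p ^+ 2 + q ^+ 2 != 0 by rewrite gt_eqF// ltr_wpDl ?sqr_ge0// exprn_gt0.
have w2 : w tau ^+ 2 = e ^+ 2 - tau ^+ 2.
  by apply: wgt_sqr => //; move/IopenP : Dt => /andP[? ?]; rewrite !ltW.
exists p, q; split => //.
  have := congr1 (@Re R) S2; rewrite /= -!expr2 w2 => H; lra.
(* In the inner product of X, l represents the right-hand side as a functional of g, and kA / w the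
   left-hand side as a functional of nu; both are in X because the kernels are bounded for y > 0.
   [conj_pairing] then leaves only the Chebyshev functions. *)
pose l t := (p * kA t - q * kB t) / (p ^+ 2 + q ^+ 2).
have ml : measurable_fun (D : set (measurableTypeR R)) l.
  apply: measurable_funM => //; apply: measurable_funB; apply: measurable_funM => //.
    exact: kerA_measurable.
  exact: kerB_measurable.
have Xl : X l.
  apply: (@bounded_L2 _ _ he _ ((`|p| * y^-1 + `|q| * y^-1) / (p ^+ 2 + q ^+ 2))) => // t _.
  rewrite normrM normfV (@ger0_norm _ (p ^+ 2 + _)) ?addr_ge0 ?sqr_ge0//.
  rewrite ler_wpM2r ?invr_ge0 ?addr_ge0 ?sqr_ge0//.
  apply: (le_trans (ler_normB _ _)); rewrite (normrM p) (normrM q).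
  by rewrite lerD// ler_wpM2l// ?kerA_le// kerB_le.
have Xk : X (fun t => kA t / w t) by apply: (divw_L2 _ kerA_le); exact: kerA_measurable.
have lE f : X f -> ipX f l = (p * Rintegral leb D (fun t => w t * f t * kA t) -
     q * Rintegral leb D (fun t => w t * f t * kB t)) / (p ^+ 2 + q ^+ 2).
  move=> Xf; have Lwf := X_L1w he Xf; have LA := L1_kerA Lwf; have LB := L1_kerB Lwf.
  rewrite -!RintegralZl// -RintegralB//; [|exact: L1Z..].
  rewrite mulrC -RintegralZl//; last by apply: L1B => //; exact: L1Z.
  by apply: eq_Rintegral => t _; rewrite /l; ring.
rewrite -lE// -ip_divw; apply: (conj_pairing he Xnu Xg Xk Xl _ cp) => n.
rewrite ip_divw (lE _ (sysU_L2 he n)).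
have := @cauchy_sys n (p +i* q) S2.
have -> : 0 < tau * p + y * q.
  have -> : p = tau * y / q by rewrite -pq mulfK// gt_eqF.
  have -> : tau * (tau * y / q) + y * q = tau ^+ 2 * (y / q) + y * q by ring.
  by rewrite ltr_wpDl// ?mulr_gt0// mulr_ge0 ?sqr_ge0// divr_ge0// ltW.
move=> /(_ isT) /eqP; rewrite eq_complex/= => /andP[/eqP + /eqP].
set A := Rintegral _ _ _; set B := Rintegral _ _ _.
set A' := Rintegral _ _ _; set B' := Rintegral _ _ _ => hA hB.
have -> : A' = p * A + q * B by rewrite -hA; ring.
have -> : B' = p * B - q * A by apply: oppr_inj; rewrite -hB; ring.
by field.
Qed.

End Cauchy_transform.

(** * Boundary values of the Poisson integral *)

Section Fatou.
Variables (R : realType) (e : R) (he : 0 < e).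
Notation leb := (@lebesgue_measure R).
Notation D := (Iopen e).
Notation w := (wgt e).
Notation X := (L2 leb D w).
Let mD := @measurable_Iopen R e.
Let mw := @wgt_measurable R e D.
Let w0 t (Dt : D t) : 0 < w t := wgt_gt0 Dt.

Lemma Rintegral_FTC (k k' : R -> R) (a b : R) : a < b ->
  (forall x : R, is_derive x 1 k (k' x)) -> continuous k' ->
  Rintegral leb `]a, b[ k' = k b - k a.
Proof.
move=> ab dk ck'.
have ck : continuous k by move=> x; exact: der_cont (dk x).
have L0 : L1 leb `]a, b[ (fun=> 0) by exact: integrable0.
have Lk' : L1 leb `]a, b[ k'.
  have [M _ hM] := continuous_bounded_itv a b ck'.
  by apply: L1_bounded_itv hM; apply: measurable_funTS; exact: continuous_measurable_fun.
rewrite -(primE Lk') /prim Rintegral_itv_obnd_cbnd; last first.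
  by apply: L1_subitv Lk' => //; exact: subset_itv_oc_cc.
rewrite /Rintegral (@continuous_FTC2 _ k' k)//.
- by apply: continuous_subspaceT => x; exact: ck'.
- split; first by move=> x _; case: (dk x).
  + by apply: cvg_at_right_filter; exact: ck.
  + by apply: cvg_at_left_filter; exact: ck.
- by move=> x _; rewrite derive1E; case: (dk x).
Qed.

Section fixed_point.
Variables (tau y : R) (y0 : 0 < y).

Let den t := gt_eqF (ker_den_gt0 tau y0 t).

Let der_den (t : R) : is_derive t 1 (fun t => (tau - t) ^+ 2 + y ^+ 2) (- 2 * (tau - t)).
Proof.
apply: (is_derive_eq (der_add (der_sqr (der_sub (der_cst tau t) (der_id t))) (der_cst _ t))).
ring.
Qed.

Lemma der_kerA (t : R) : is_derive t 1 (kerA tau y)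
  (((tau - t) ^+ 2 - y ^+ 2) / ((tau - t) ^+ 2 + y ^+ 2) ^+ 2).
Proof.
apply: (is_derive_eq (der_mul (der_sub (der_cst tau t) (der_id t)) (der_inv _ (der_den t)))).
  by rewrite den.
by field; rewrite den.
Qed.

Definition kerB' t : R := 2 * y * (tau - t) / ((tau - t) ^+ 2 + y ^+ 2) ^+ 2.

Lemma der_kerB (t : R) : is_derive t 1 (kerB tau y) (kerB' t).
Proof.
apply: (is_derive_eq (der_mul (der_cst y t) (der_inv _ (der_den t)))).
  by rewrite den.
by rewrite /kerB'; field; rewrite den.
Qed.

Lemma ker_den_cont : continuous (fun t : R => (tau - t) ^+ 2 + y ^+ 2).
Proof. by move=> t; exact: der_cont (der_den t). Qed.

Lemma kerA'_cont :
  continuous (fun t : R => ((tau - t) ^+ 2 - y ^+ 2) / ((tau - t) ^+ 2 + y ^+ 2) ^+ 2).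
Proof.
move=> t; apply: cvgM.
  apply: cvgB; last exact: cvg_cst.
  by apply: cvgM; apply: cvgB; (exact: cvg_cst || exact: cvg_id).
apply: cvgV; first by rewrite expf_neq0// den.
by apply: cvgM; exact: ker_den_cont.
Qed.

Lemma kerB'_cont : continuous kerB'.
Proof.
move=> t; apply: cvgM.
  apply: cvgM; first exact: cvg_cst.
  by apply: cvgB; [exact: cvg_cst|exact: cvg_id].
apply: cvgV; first by rewrite expf_neq0// den.
by apply: cvgM; exact: ker_den_cont.
Qed.

Lemma int_kerB : Rintegral leb D (kerB tau y) =
  atan ((e - tau) / y) + atan ((e + tau) / y).
Proof.
have d (t : R) : is_derive t 1 (fun t => atan ((t - tau) / y)) (kerB tau y t).
  apply: (is_derive_eq (der_comp (der_mul (der_sub (der_id t) (der_cst tau t)) (der_cst y^-1 t))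
    (is_derive1_atan _))).
  rewrite /kerB; have : 1 + ((t - tau) / y) ^+ 2 = ((tau - t) ^+ 2 + y ^+ 2) / y ^+ 2.
    by field; rewrite gt_eqF.
  by move=> ->; field; rewrite den gt_eqF.
rewrite (Rintegral_FTC (itvNe he) d (@kerB_cont _ _ _ y0)).
have -> : (- e - tau) / y = - ((e + tau) / y) by ring.
by rewrite atanN opprK.
Qed.

Lemma int_kerB_bound : 0 <= Rintegral leb D (kerB tau y) <= pi.
Proof.
rewrite int_kerB.
have := atan_ltpi2 ((e - tau) / y); have := atan_ltpi2 ((e + tau) / y).
move=> h1 h2; apply/andP; split; last by lra.
by rewrite -int_kerB; apply: Rintegral_ge0 => t _; exact: kerB_ge0.
Qed.

End fixed_point.

Variables (u : nat -> R) (u0 : forall n, 0 < u n) (ucvg : u n @[n --> \oo] --> 0).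

Lemma cvg_div_y (c : R) : 0 < c -> c / u n @[n --> \oo] --> +oo.
Proof.
move=> c0; apply/cvgryPge => A.
have p : 0 < c / (`|A| + 1) by rewrite divr_gt0// ltr_wpDl.
have /cvgrPdist_le/(_ _ p)[N _ hN] := ucvg.
exists N => // n /hN /=; rewrite sub0r normrN gtr0_norm// => h.
rewrite ler_pdivlMr//; apply: le_trans (_ : (`|A| + 1) * u n <= _).
  by rewrite ler_wpM2r ?(ltW (u0 n))// (le_trans (ler_norm A))// lerDl.
by rewrite mulrC -ler_pdivlMr// ltr_wpDl.
Qed.

Lemma int_kerB_cvg tau : D tau ->
  Rintegral leb D (kerB tau (u n)) @[n --> \oo] --> pi.
Proof.
move=> /IopenP/andP[t1 t2].
rewrite (_ : (fun n => _) = (fun n => atan ((e - tau) / u n) + atan ((e + tau) / u n))); last first.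
  by apply/funext => n; exact: int_kerB.
rewrite [X in _ --> X](_ : _ = pi / 2 + pi / 2); last by field.
apply: cvgD.
  have h : 0 < e - tau by rewrite subr_gt0.
  exact: (cvg_comp (fun n => (e - tau) / u n) atan (cvg_div_y h) (@cvgy_atan R)).
have h : 0 < e + tau by rewrite -ltrBlDl sub0r.
exact: (cvg_comp (fun n => (e + tau) / u n) atan (cvg_div_y h) (@cvgy_atan R)).
Qed.

(** u n * [kerA] is bounded by 1 and tends to 0 for t <> tau, so dominated convergence applies; no
    bound on the integral without the factor u n is claimed. *)
Lemma kerA_cvg tau f : L1 leb D f ->
  u n * Rintegral leb D (fun t => f t * kerA tau (u n) t) @[n --> \oo] --> 0.
Proof.
move=> Lf.
have LA n := L1_kerA tau (u0 n) Lf.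
have -> : 0 = Rintegral leb D (fun=> 0 : R) by rewrite /Rintegral integral0.
rewrite (_ : (fun n => _) = (fun n => Rintegral leb D (fun t => u n * (f t * kerA tau (u n) t)))); last first.
  by apply/funext => n; rewrite (RintegralZl _ mD (LA n)).
apply: (L1_dominated mD (g := fun t => `|f t|)).
- by move=> n; exact: L1_measurable (L1Z mD (u n) (LA n)).
- exists [set tau]; split; first exact: measurable_set1.
    exact: lebesgue_measure_set1.
  move=> t /= /not_implyP[Dt]; apply: contra_notP => /eqP tt.
  rewrite /kerA [X in _ --> X](_ : _ = 0 * (f t * ((tau - t) / ((tau - t) ^+ 2 + 0 ^+ 2)))); last by rewrite mul0r.
  apply: cvgM => //; apply: cvgM; first exact: cvg_cst.
  apply: cvgM; first exact: cvg_cst.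
  apply: cvgV.
    by rewrite expr0n/= addr0 expf_neq0// subr_eq0 eq_sym.
  by apply: cvgD; [exact: cvg_cst|exact: cvgM].
- exact: measurable_cst.
- exact: L1_norm.
- move=> n t Dt; rewrite mulrCA normrM ler_piMr// normrM gtr0_norm//.
  by rewrite mulrC -ler_pdivlMr// mul1r; exact: kerA_le.
Qed.

Lemma kerB_end_cvg tau a : tau != a -> kerB tau (u n) a @[n --> \oo] --> 0.
Proof.
move=> ta; rewrite /kerB [X in _ --> X](_ : _ = 0 / ((tau - a) ^+ 2 + 0 ^+ 2)); last by rewrite mul0r.
apply: cvgM => //; apply: cvgV.
  by rewrite expr0n/= addr0 expf_neq0// subr_eq0.
by apply: cvgD; [exact: cvg_cst|exact: cvgM].
Qed.

(** |t - tau| * |[kerB']| is at most 2 * [kerB], whose total mass is at most pi; so a small slope of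
    H at tau gives a small integral. *)
Lemma kerB'_near tau y t (H eps : R) : 0 < y -> 0 <= eps -> `|H| <= eps * `|t - tau| ->
  `|H * kerB' tau y t| <= 2 * eps * kerB tau y t.
Proof.
move=> y0 eps0 hH; have y2 : 0 < 2 * y by rewrite mulr_gt0.
have dp := ker_den_gt0 tau y0 t.
rewrite normrM /kerB' /kerB normrM normfV (gtr0_norm (exprn_gt0 2 dp)).
rewrite (normrM (2 * y)) (gtr0_norm y2) distrC.
set dn := _ + y ^+ 2 in dp *.
have d2 : (tau - t) ^+ 2 <= dn by rewrite lerDl sqr_ge0.
apply: (@le_trans _ _ (eps * `|t - tau| * (2 * y * `|t - tau| / dn ^+ 2))).
  by rewrite ler_wpM2r// divr_ge0 ?exprn_ge0 ?(ltW dp)// mulr_ge0// mulr_ge0// ltW.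
have -> : eps * `|t - tau| * (2 * y * `|t - tau| / dn ^+ 2) =
    2 * eps * (y * ((tau - t) ^+ 2 / dn ^+ 2)).
  have -> : (tau - t) ^+ 2 = `|t - tau| ^+ 2 by rewrite real_normK ?num_real//; ring.
  by field; rewrite gt_eqF.
rewrite ler_wpM2l ?mulr_ge0//; rewrite ler_wpM2l ?(ltW y0)//.
by rewrite ler_pdivrMr ?exprn_gt0// expr2 mulrA mulVf ?gt_eqF// mul1r.
Qed.

(** At distance at least d from tau, [kerB'] is at most 2 y / d^3. *)
Lemma kerB'_far tau y t (H M d : R) : 0 < y -> 0 < d -> `|H| <= M -> d <= `|t - tau| ->
  `|H * kerB' tau y t| <= y * (2 * M / d ^+ 3).
Proof.
move=> y0 d0 hH dt; have y2 : 0 < 2 * y by rewrite mulr_gt0.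
have dp := ker_den_gt0 tau y0 t.
have a0 : 0 < `|t - tau| := lt_le_trans d0 dt.
rewrite normrM /kerB' normrM normfV (gtr0_norm (exprn_gt0 2 dp)).
rewrite (normrM (2 * y)) (gtr0_norm y2) distrC.
set dn := _ + y ^+ 2 in dp *.
have -> : y * (2 * M / d ^+ 3) = M * (2 * y / d ^+ 3) by ring.
rewrite ler_pM//; first by rewrite divr_ge0 ?exprn_ge0 ?(ltW dp)// mulr_ge0// mulr_ge0// ltW.
have d2 : `|t - tau| ^+ 2 <= dn.
  by rewrite real_normK ?num_real// (_ : (t - tau) ^+ 2 = (tau - t) ^+ 2) ?lerDl ?sqr_ge0//; ring.
rewrite -!mulrA ler_pM2l// ler_pM2l//.
rewrite ler_pdivrMr ?exprn_gt0// ler_pdivlMl ?exprn_gt0//.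
apply: (@le_trans _ _ (`|t - tau| ^+ 3 * `|t - tau|)).
  by rewrite ler_pM2r// lerXn2r// ?nnegrE ltW.
by rewrite -exprSr (_ : 4 = 2 * 2)%N// exprM lerXn2r// ?nnegrE ?exprn_ge0// ltW.
Qed.

(** The constant c is split off, and integration by parts leaves the derivative of the kernel
    against H, the primitive of f - c. As H has derivative 0 at tau, H t - H tau is o(|t - tau|):
    this tames the kernel near tau, and away from tau the kernel is O(y). *)
Lemma kerB_cvg tau f c : L1 leb D f -> D tau -> is_derive tau 1 (prim (- e) f) c ->
  Rintegral leb D (fun t => f t * kerB tau (u n) t) @[n --> \oo] --> pi * c.
Proof.
move=> Lf Dt df; have [t1 t2] := andP ((IopenP e tau).1 Dt).
have Lc a : L1 leb D (fun=> a) by apply: (@L1_bounded_itv _ _ _ _ `|a|).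
pose H t := prim (- e) f t - c * (t - - e).
have Lg : L1 leb D (fun t => f t - c) by exact: L1B.
have HE t : D t -> prim (- e) (fun t => f t - c) t = H t.
  move=> /IopenP/andP[h1 h2].
  have sub : `]- e, t] `<=` `[- e, e] by apply: subset_itv; rewrite bnd_simp// ltW.
  have mt : measurable (`]- e, t] : set (measurableTypeR R)) by exact: measurable_itv.
  rewrite /prim RintegralB//; [|exact: L1_subitv sub Lf|exact: L1_subitv sub (Lc c)].
  rewrite Rintegral_cst//; congr (_ - c * _).
  by rewrite -[fine _]/(fine (lebesgue_measure (`]- e, t] : set R))) lebesgue_measure_itv/= lte_fin h1.
have dH : is_derive tau 1 H 0.
  apply: (is_derive_eq (der_sub df (der_scale c (der_sub (der_id tau) (der_cst (- e) tau))))).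
  by ring.
pose H0 t := H t - H tau.
pose M := 2 * (Rintegral leb D (fun s => `|f s|) + `|c| * (2 * e)).
have HM t : D t -> `|H0 t| <= M.
  have P x : D x -> `|H x| <= Rintegral leb D (fun s => `|f s|) + `|c| * (2 * e).
    move=> /IopenP/andP[h1 h2]; apply: (le_trans (ler_normB _ _)); apply: lerD.
      by apply: prim_bound => //; rewrite !ltW.
    rewrite normrM ler_wpM2l// opprK ger0_norm; lra.
  move=> Dx; apply: (le_trans (ler_normB _ _)).
  by rewrite /M mulr2n mulrDl mul1r lerD// P.
have mH0 : measurable_fun (D : set (measurableTypeR R)) H0.
  have mid : measurable_fun (D : set (measurableTypeR R)) (fun t : R => t) by exact: measurable_id.
  apply: measurable_funB; last exact: measurable_cst.
  apply: measurable_funB; first exact: (prim_measurable (itvNe he) Lf).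
  apply: measurable_funM; first exact: measurable_cst.
  by apply: measurable_funB => //; exact: measurable_cst.
have Lk' n : L1 leb D (kerB' tau (u n)).
  have [B _ hB] := continuous_bounded_itv (- e) e (@kerB'_cont tau _ (u0 n)).
  apply: (L1_bounded_itv _ hB); apply: measurable_funTS.
  by apply: continuous_measurable_fun; exact: kerB'_cont.
have LH0 n : L1 leb D (fun t => H0 t * kerB' tau (u n) t).
  by apply: (eq_L1 mD _ (L1Mbounded mD (Lk' n) mH0 HM)) => t _; rewrite mulrC.
have Lk n : L1 leb D (kerB tau (u n)).
  by apply: (eq_L1 mD _ (L1_kerB tau (u0 n) (Lc 1))) => t _; rewrite mul1r.
(* The primitive vanishes at - e, so parts leave a boundary term at e only; replacing H by H0 = H -
   H tau costs H tau times the increment of the kernel. *)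
have E n : Rintegral leb D (fun t => f t * kerB tau (u n) t) =
   c * Rintegral leb D (kerB tau (u n)) + kerB tau (u n) e * Rintegral leb D (fun t => f t - c)
   - H tau * (kerB tau (u n) e - kerB tau (u n) (- e)) - Rintegral leb D (fun t => H0 t * kerB' tau (u n) t).
  have dk := @der_kerB tau _ (u0 n); have ck := @kerB'_cont tau _ (u0 n).
  have P1 := prim_by_parts (itvNe he) Lg dk ck.
  have P2 := Rintegral_FTC (itvNe he) dk ck.
  have Lfk := L1_kerB tau (u0 n) Lf.
  have P3 : Rintegral leb D (fun t => (f t - c) * kerB tau (u n) t) =
      Rintegral leb D (fun t => f t * kerB tau (u n) t) - c * Rintegral leb D (kerB tau (u n)).
    rewrite -(RintegralZl c mD (Lk n)) -(RintegralB mD Lfk (L1Z mD c (Lk n))).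
    by apply: eq_Rintegral => t _; rewrite mulrBl.
  have P4 : Rintegral leb D (fun t => prim (- e) (fun s => f s - c) t * kerB' tau (u n) t) =
      Rintegral leb D (fun t => H0 t * kerB' tau (u n) t) + H tau * Rintegral leb D (kerB' tau (u n)).
    rewrite -(RintegralZl (H tau) mD (Lk' n)) -(RintegralD mD (LH0 n) (L1Z mD (H tau) (Lk' n))).
    by apply: eq_Rintegral => t /set_mem Dx; rewrite HE// /H0; ring.
  rewrite -P2; move: P1; rewrite -/(Iopen e) P3 P4 => P1.
  by rewrite -[Rintegral leb D (fun t => H0 t * _)](addrK (H tau * Rintegral leb D (kerB' tau (u n)))) P1; ring.
have lim0 : Rintegral leb D (fun t => H0 t * kerB' tau (u n) t) @[n --> \oo] --> 0.
  apply/cvgrPdist_le => eps eps0.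
  have pi0 := @pi_gt0 R.
  (* The part near tau contributes at most 2 * ep * pi = eps / 2, and the far part takes the other
     half for large n. *)
  pose ep := eps / (4 * pi).
  have ep0 : 0 < ep by rewrite divr_gt0// mulr_gt0.
  have /is_derive1_caratheodory [gg [ggE ggc gg0]] := dH.
  have [d /= d0 hd] : nbhs tau (fun z => `|gg z| <= ep).
    move/cvgrPdist_le : ggc => /(_ _ ep0); apply: filterS => z; rewrite gg0 sub0r normrN //.
  have M0 : 0 <= M := le_trans (normr_ge0 _) (HM tau Dt).
  pose C := 2 * M / d ^+ 3.
  have C0 : 0 <= C by apply: divr_ge0; [exact: mulr_ge0|exact: exprn_ge0 (ltW d0)].
  have bnd n t : D t -> `|H0 t * kerB' tau (u n) t| <= 2 * ep * kerB tau (u n) t + u n * C.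
    move=> Dx; have [td|td] := ltP `|t - tau| d.
      have h : `|H0 t| <= ep * `|t - tau|.
        rewrite /H0 ggE normrM ler_wpM2r//.
        by apply: hd; rewrite /ball_/= distrC.
      apply: (le_trans (kerB'_near (u0 n) (ltW ep0) h)).
      by rewrite lerDl mulr_ge0// ltW.
    apply: (le_trans (kerB'_far (u0 n) d0 (HM _ Dx) td)).
    rewrite lerDr; apply: mulr_ge0; last exact: kerB_ge0 (u0 n) t.
    by rewrite mulr_ge0// ltW.
  have bI n : `|Rintegral leb D (fun t => H0 t * kerB' tau (u n) t)| <= eps / 2 + u n * (C * (2 * e)).
    apply: (le_trans (le_normr_Rintegral mD (LH0 n))).
    apply: (le_trans (le_Rintegral mD (L1_norm (LH0 n)) _ (bnd n))).
      by apply: L1D => //; exact: L1Z.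
    rewrite (RintegralD mD (L1Z mD (2 * ep) (Lk n)) (Lc (u n * C))).
    rewrite (RintegralZl (2 * ep) mD (Lk n)); apply: lerD.
      apply: (@le_trans _ _ (2 * ep * pi)).
        have /andP[_ hpi] := int_kerB_bound tau (u0 n).
        by apply: ler_wpM2l => //; rewrite mulr_ge0// ltW.
      rewrite (_ : 2 * ep * pi = eps / 2)//; rewrite /ep.
      by move: (lt0r_neq0 pi0); move: (pi : R) => x x0; field.
    rewrite Rintegral_cst// -[fine _]/(fine (lebesgue_measure (`]- e, e[ : set R))).
    rewrite lebesgue_measure_itv/= lte_fin (itvNe he) /=.
    by rewrite le_eqVlt; apply/orP; left; apply/eqP; ring.
  have q0 : 0 < eps / 2 / (C * (2 * e) + 1).
    by rewrite divr_gt0 ?divr_gt0// ltr_wpDl// mulr_ge0// mulr_ge0// ltW.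
  have /cvgrPdist_le/(_ _ q0)[K _ hK] := ucvg.
  exists K => // n /hK /=; rewrite !sub0r !normrN (gtr0_norm (u0 n)) => h.
  apply: (le_trans (bI n)); rewrite [leRHS]splitr lerD2l.
  apply: (@le_trans _ _ (u n * (C * (2 * e) + 1))).
    by rewrite ler_wpM2l ?(ltW (u0 n))// lerDl.
  by rewrite -ler_pdivlMr// ltr_wpDl// mulr_ge0// mulr_ge0// ltW.
rewrite (funext E).
rewrite [X in _ --> X](_ : _ = c * pi + 0 * Rintegral leb D (fun t => f t - c) - H tau * (0 - 0) - 0); last by ring.
have ke : kerB tau (u n) e @[n --> \oo] --> 0 by apply: kerB_end_cvg; rewrite lt_eqF.
have kNe : kerB tau (u n) (- e) @[n --> \oo] --> 0 by apply: kerB_end_cvg; rewrite gt_eqF.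
apply: cvgB => //; apply: cvgB.
  apply: cvgD; first by apply: cvgM; [exact: cvg_cst|exact: int_kerB_cvg].
  by apply: cvgM => //; exact: cvg_cst.
by apply: cvgM; [exact: cvg_cst|exact: cvgB].
Qed.

End Fatou.

(** * The regularised finite part and its limit *)

Section finite_part.
Variables (R : realType) (e : R) (he : 0 < e).
Notation leb := (@lebesgue_measure R).
Notation D := (Iopen e).
Notation w := (wgt e).
Notation X := (L2 leb D w).
Let mD := @measurable_Iopen R e.
Let mw := @wgt_measurable R e D.
Let w0 t (Dt : D t) : 0 < w t := wgt_gt0 Dt.

Definition Jreg (mu : R -> R) (tau h : R) : R := Rintegral leb D
  (fun t => ((tau - t) ^+ 2 - h) * mu t / ((tau - t) ^+ 2 + h) ^+ 2).

(** With y = sqrt h the regularised kernel is the derivative of [kerA]; the boundary term is [kerA]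
    at e times the mean of nu, which is 0. *)
Lemma Jreg_kerA nu mu tau h : L1 leb D nu -> Rintegral leb D nu = 0 ->
  (forall t, D t -> mu t = prim (- e) nu t) -> 0 < h ->
  Jreg mu tau h = - Rintegral leb D (fun t => nu t * kerA tau (Num.sqrt h) t).
Proof.
move=> Lnu nu0 muE h0.
have s0 : 0 < Num.sqrt h by rewrite sqrtr_gt0.
have := prim_by_parts (itvNe he) Lnu (der_kerA tau s0) (@kerA'_cont _ tau _ s0).
rewrite nu0 mulr0 sub0r => <-; apply: eq_Rintegral => t /set_mem Dt.
by rewrite -muE// sqr_sqrtr ?(ltW h0)//; ring.
Qed.

(** The exceptional points are those where the primitive of w g does not have derivative w g.
    Elsewhere [conj_pair_kernel] passes to the limit: q tends to w tau and p = tau y / q to 0, B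
    tends to pi * (w tau * g tau), and p A tends to 0 because y A does. *)
Lemma Jreg_cvg nu g mu : X nu -> X g -> conj_pair e nu g ->
  (forall t, D t -> mu t = prim (- e) nu t) ->
  {ae leb, forall tau, D tau -> Jreg mu tau h @[h --> 0^'+] --> pi * g tau}.
Proof.
move=> Xnu Xg cp muE.
have Lnu := X_L1 he Xnu; have nu0 := conj_pair_mean0 he Xnu Xg cp.
have Lwg := X_L1w he Xg.
have := prim_derive_ae Lwg; apply: filterS; first exact: (ae_filter_ringOfSetsType leb).
move=> tau H Dt; have wt := w0 Dt; have dp := H ((IopenP e tau).1 Dt).
apply/cvg_at_rightP => u [u0 ucvg].
pose y n := Num.sqrt (u n).
have y0 n : 0 < y n by rewrite sqrtr_gt0.
have ycvg : y n @[n --> \oo] --> 0.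
  rewrite -(sqrtr0 R); apply: (continuous_cvg _ _ ucvg); exact: sqrt_continuous.
pose A n := Rintegral leb D (fun t => w t * g t * kerA tau (y n) t).
pose B n := Rintegral leb D (fun t => w t * g t * kerB tau (y n) t).
have cA : y n * A n @[n --> \oo] --> 0 := kerA_cvg y0 ycvg tau Lwg.
have cB : B n @[n --> \oo] --> pi * (w tau * g tau) := kerB_cvg he y0 ycvg Lwg Dt dp.
(* p is eliminated through p q = tau y, so that only q has to be chosen for each n. *)
have K n : exists q : R, w tau <= q /\ q ^+ 2 = (tau * y n / q) ^+ 2 + w tau ^+ 2 + y n ^+ 2 /\
    Jreg mu tau (u n) = (q * B n - tau / q * (y n * A n)) / ((tau * y n / q) ^+ 2 + q ^+ 2).
  have [p [q [h1 h2 h3 h4]]] := conj_pair_kernel he (y0 n) Dt Xnu Xg cp.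
  have q0 : 0 < q := lt_le_trans wt h1.
  exists q; have -> : tau * y n / q = p by rewrite -h2 mulfK// gt_eqF.
  split => //; split; first by lra.
  rewrite (Jreg_kerA tau Lnu nu0 muE (u0 n)) -/(y n) h4 -mulNr opprB.
  congr ((_ - _) / _).
  by rewrite mulrA (_ : tau / q * y n = p) //; rewrite -[p](mulfK (lt0r_neq0 q0)) h2 mulrAC.
have [q hq] := choice K.
have q0 n : 0 < q n := lt_le_trans wt (hq n).1.
pose p n := tau * y n / q n.
have pcvg : p n @[n --> \oo] --> 0.
  apply/norm_cvg0P.
  apply: (@squeeze_cvgr _ _ _ _ (cst 0) (fun n => `|tau| * y n / w tau)).
  - apply: nearW => n; rewrite normr_ge0/= /p !normrM normfV.
    rewrite (gtr0_norm (y0 n)) (gtr0_norm (q0 n)) ler_wpM2l ?mulr_ge0 ?(ltW (y0 n))//.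
    by rewrite lef_pV2 ?posrE//; exact: (hq n).1.
  - exact: cvg_cst.
  - rewrite [X in _ --> X](_ : _ = `|tau| * 0 / w tau); last by rewrite mulr0 mul0r.
    by apply: cvgM; [apply: cvgM => //; exact: cvg_cst|exact: cvg_cst].
have q2cvg : q n ^+ 2 @[n --> \oo] --> w tau ^+ 2.
  rewrite (_ : (fun n => _) = (fun n => p n ^+ 2 + w tau ^+ 2 + y n ^+ 2)); last first.
    by apply/funext => n; exact: (hq n).2.1.
  rewrite [X in _ --> X](_ : _ = 0 * 0 + w tau ^+ 2 + 0 * 0); last by ring.
  apply: cvgD; last exact: cvgM.
  by apply: cvgD; [exact: cvgM|exact: cvg_cst].
have qcvg : q n @[n --> \oo] --> w tau.
  rewrite (_ : q = fun n => Num.sqrt (q n ^+ 2)); last first.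
    by apply/funext => n; rewrite sqrtr_sqr gtr0_norm.
  rewrite -[X in _ --> X](gtr0_norm wt) -sqrtr_sqr.
  by apply: (continuous_cvg _ _ q2cvg); exact: sqrt_continuous.
rewrite (_ : (fun n => _) = (fun n => (q n * B n - tau / q n * (y n * A n)) / (p n ^+ 2 + q n ^+ 2))); last first.
  by apply/funext => n; exact: (hq n).2.2.
rewrite [X in _ --> X](_ : _ = (w tau * (pi * (w tau * g tau)) - tau / w tau * 0) / (0 * 0 + w tau ^+ 2)); last first.
  by move: (pi : R) => x; field; rewrite gt_eqF.
apply: cvgM.
  apply: cvgB; first exact: cvgM.
  apply: cvgM => //; apply: cvgM; first exact: cvg_cst.
  by apply: cvgV => //; rewrite gt_eqF.
apply: cvgV; first by rewrite mul0r add0r expf_neq0// gt_eqF.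
by apply: cvgD => //; exact: cvgM.
Qed.

End finite_part.

(** * Measurability of a one-sided limit *)

Section measurable_lim.
Variables (R : realType) (J : R -> R -> R).
Hypothesis cJ : forall h, 0 < h -> continuous (J ^~ h).

(* The sets of the Cauchy criterion are closed by continuity in [tau], so that no
   restriction to countably many values of [h] is needed. *)
Lemma cauchy_at_rightE : [set tau | cvg (J tau h @[h --> 0^'+])] =
  \bigcap_k \bigcup_m [set tau | forall h h', 0 < h < m.+1%:R^-1 ->
     0 < h' < m.+1%:R^-1 -> `|J tau h - J tau h'| <= k.+1%:R^-1].
Proof.
apply/seteqP; split => tau /=.
  move=> /cvg_ex[/= l /cvgrPdist_lt jl] k _.
  have k0 : (0 : R) < k.+1%:R^-1 / 2 by rewrite divr_gt0// invr_gt0.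
  have [d /= d0 H] := jl _ k0.
  have [m hm] : exists m : nat, m.+1%:R^-1 < d.
    by have [m _ hm] := near_infty_natSinv_lt (PosNum d0); exists m; exact: hm (leqnn m).
  exists m => // h h' /andP[h0 h1] /andP[h'0 h'1].
  have G x : 0 < x -> x < m.+1%:R^-1 -> `|l - J tau x| < k.+1%:R^-1 / 2.
    move=> x0 x1; apply: H => //=; rewrite sub0r normrN gtr0_norm//.
    exact: lt_trans x1 hm.
  rewrite (_ : J tau h - J tau h' = (l - J tau h') - (l - J tau h)); last by ring.
  apply: (le_trans (ler_normB _ _)); rewrite [leRHS]splitr lerD//; apply: ltW; exact: G.
move=> H; apply/cauchy_cvgP/cauchy_exP => eps e0.
have [k _ hk] := near_infty_natSinv_lt (PosNum e0).
have {}hk := hk k (leqnn k).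
have [m _ hm] := H k Logic.I.
have m1 : (0 : R) < m.+2%:R^-1 < (m.+1%:R^-1 : R).
  by apply/andP; split; [rewrite invr_gt0|rewrite ltf_pV2 ?posrE// ltr_nat].
exists (J tau m.+2%:R^-1); exists m.+1%:R^-1 => /=; first by rewrite invr_gt0.
move=> h /= + h0; rewrite sub0r normrN gtr0_norm// => h1.
by rewrite /ball/=; apply: le_lt_trans hk; apply: hm => //; rewrite h0.
Qed.

Lemma measurable_cvg_at_right :
  measurable ([set tau | cvg (J tau h @[h --> 0^'+])] : set (measurableTypeR R)).
Proof.
rewrite cauchy_at_rightE; apply: bigcap_measurable; first by exists 0%N.
move=> k _; apply: bigcup_measurable => m _; apply: closed_measurable.
rewrite (_ : mkset _ = \bigcap_(p in [set p : R * R | 0 < p.1 < m.+1%:R^-1 /\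
    0 < p.2 < m.+1%:R^-1]) [set tau | `|J tau p.1 - J tau p.2| <= k.+1%:R^-1]); last first.
  apply/seteqP; split => [tau H [h h']/= [h0 h1]|tau H h h' h0 h1]; first exact: H.
  exact: (H (h, h')).
apply: closed_bigI => -[h h']/= [/andP[h0 _] /andP[h'0 _]].
apply: (@closed_comp _ _ (fun tau => `|J tau h - J tau h'|) [set x | x <= k.+1%:R^-1]).
  move=> x _; apply: cvg_norm; apply: cvgB; exact: cJ.
exact: closed_le.
Qed.

(** Where no limit exists [lim] returns the default [point]. The function is therefore the
    everywhere limit of J tau 1/(n+1), replaced by [point] outside the measurable set of
    convergence. *)
Lemma measurable_lim_at_right (A : set (measurableTypeR R)) : measurable A ->
  measurable_fun A (fun tau => lim (J tau h @[h --> 0^'+])).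
Proof.
move=> mA; pose C := [set tau | cvg (J tau h @[h --> 0^'+])].
apply: (@measurable_fun_cvg _ _ _ _ (fun n tau => if `[< C tau >] then J tau n.+1%:R^-1 else point)).
  move=> n; apply: measurable_fun_if => //.
  - apply: (measurable_fun_bool true); apply: measurableI => //.
    rewrite (_ : _ @^-1` _ = C); first exact: measurable_cvg_at_right.
    by apply/seteqP; split => x /=; [move/asboolP|move=> ?; apply/asboolP].
  - apply: measurable_funTS; apply: continuous_measurable_fun; apply: cJ.
    by rewrite invr_gt0.
move=> tau _; case: asboolP => [Ct|nCt]; last by rewrite dvgP//; exact: cvg_cst.
have /cvg_at_rightP := Ct; apply; split => [n|]; first by rewrite invr_gt0.
exact: cvg_harmonic.
Qed.

End measurable_lim.

(** * Measurability of the images under J and L *)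

Lemma sequential_continuity (R : realType) (f : R -> R) (p : R) :
  (forall u : nat -> R, u n @[n --> \oo] --> p -> f (u n) @[n --> \oo] --> f p) ->
  {for p, continuous f}.
Proof.
move=> H; apply/cvgrPdist_lt => eps e0; apply: contrapT => nH.
have K n : exists x : R, `|p - x| < n.+1%:R^-1 /\ eps <= `|f p - f x|.
  apply: contrapT => nK; apply: nH; exists n.+1%:R^-1 => /=; first by rewrite invr_gt0.
  move=> x /= px; rewrite ltNge; apply/negP => ex; apply: nK; exists x; split => //.
have [u hu] := choice K.
have up : u n @[n --> \oo] --> p.
  apply/cvgrPdist_lt => d d0; near=> n; apply: lt_trans (hu n).1 _.
  by near: n; exact: (near_infty_natSinv_lt (PosNum d0)).
have /cvgrPdist_lt/(_ _ e0)[n _ /(_ n (leqnn n))] := H u up.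
by rewrite ltNge (hu n).2.
Unshelve. all: by end_near. Qed.

Section measurability.
Variables (R : realType) (e : R) (he : 0 < e).
Notation leb := (@lebesgue_measure R).
Notation D := (Iopen e : set (measurableTypeR R)).
Let mD := @measurable_Iopen R e.

(** For fixed h > 0 the kernel is continuous in tau and bounded by 1 / h, so |mu| / h dominates. *)
Lemma Jreg_continuous mu h : L1 leb D mu -> 0 < h -> continuous (fun tau => Jreg e mu tau h).
Proof.
move=> Lmu h0 tau.
suff H u : u n @[n --> \oo] --> tau -> Jreg e mu (u n) h @[n --> \oo] --> Jreg e mu tau h.
  exact: sequential_continuity.
move=> utau.
have P x t : 0 < (x - t) ^+ 2 + h by rewrite ltr_wpDl ?sqr_ge0.
have kc (T : Type) (F : set_system T) (FF : ProperFilter F) (v : T -> R) (d : R) :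
    v x @[x --> F] --> d ->
    (v x ^+ 2 - h) / (v x ^+ 2 + h) ^+ 2 @[x --> F] --> (d ^+ 2 - h) / (d ^+ 2 + h) ^+ 2.
  move=> vd; have v2 : v x ^+ 2 @[x --> F] --> d ^+ 2 by exact: cvgM.
  apply: cvgM; first by apply: cvgB => //; exact: cvg_cst.
  have v3 : v x ^+ 2 + h @[x --> F] --> d ^+ 2 + h by apply: cvgD => //; exact: cvg_cst.
  apply: cvgV; last exact: cvgM.
  by rewrite expf_neq0// gt_eqF// ltr_wpDl ?sqr_ge0.
have mk x : measurable_fun D (fun t => ((x - t) ^+ 2 - h) * mu t / ((x - t) ^+ 2 + h) ^+ 2).
  rewrite (_ : (fun t => _) = fun t => mu t * (((x - t) ^+ 2 - h) / ((x - t) ^+ 2 + h) ^+ 2)); last first.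
    by apply/funext => t; rewrite mulrAC mulrC.
  apply: measurable_funM; first exact: L1_measurable Lmu.
  apply: measurable_funTS; apply: continuous_measurable_fun => t.
  have c : (x - s) @[s --> t] --> x - t by apply: cvgB; [exact: cvg_cst|exact: cvg_id].
  exact: (kc _ _ _ _ _ c).
apply: (@L1_dominated _ _ _ _ _ mD _ _ (fun t => h^-1 * `|mu t|)) => //.
- apply: aeW => t Dt.
  rewrite mulrAC; under eq_fun do rewrite mulrAC.
  apply: cvgM; last exact: cvg_cst.
  have c : u n - t @[n --> \oo] --> tau - t by apply: cvgB => //; exact: cvg_cst.
  exact: (kc _ _ _ _ _ c).
- by apply: (L1Z mD); exact: L1_norm.
- move=> n t Dt; have p0 := P (u n) t.
  rewrite normrM normrM normfV normrX (gtr0_norm p0) mulrAC ler_wpM2r//.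
  rewrite ler_pdivrMr ?exprn_gt0// expr2 mulrA.
  apply: (@le_trans _ _ ((u n - t) ^+ 2 + h)).
    by have := sqr_ge0 (u n - t); rewrite ler_norml; lra.
  by rewrite ler_peMl ?(ltW p0)// mulrC ler_pdivlMr// mul1r lerDr sqr_ge0.
Qed.

Lemma Jop_measurable mu : L1 leb D mu -> measurable_fun D (Jop e mu).
Proof.
move=> Lmu; apply: measurable_lim_at_right mD => h h0; exact: Jreg_continuous.
Qed.

(** Tonelli's theorem is applied to the positive and negative parts of the integrand extended by 0.
    This asks for no integrability, since [Rintegral] is the [fine] of the difference of the two
    integrals. *)
Lemma Lop_measurable mu : measurable_fun D mu -> measurable_fun D (Lop e mu).
Proof.
move=> mmu; apply: measurable_funTS.
pose F (x : measurableTypeR R * measurableTypeR R) := ((mu \_ D) x.2 * ln `|x.1 - x.2|)%:E.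
have mF : measurable_fun setT F.
  apply/measurable_EFinP; apply: measurable_funM.
    apply: (@measurableT_comp _ _ _ _ _ _ (mu \_ D) _ snd); last exact: measurable_snd.
    exact/(measurable_restrictT _ mD).
  apply: measurableT_comp; first exact: measurable_ln.
  apply: measurableT_comp => //; exact: measurable_funB.
rewrite (_ : Lop e mu = fun tau => fine (fubini_F leb F^\+ tau - fubini_F leb F^\- tau)%E); last first.
  apply/funext => tau; congr fine; rewrite integral_mkcond integralE /fubini_F.
  by congr (_ - _)%E; apply: eq_integral => t _; rewrite ?funeposE ?funenegE /F /patch;
    case: ifP; rewrite ?mul0r.
apply: measurableT_comp => //; apply: emeasurable_funB; apply: measurable_fun_fubini_tonelli_F => //.
- exact: measurable_funepos.
- exact: measurable_funeneg.
Qed.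

End measurability.

(** * Inverse square roots and the logarithm *)

Section inverse_sqrt.
Variable R : realType.
Notation leb := (@lebesgue_measure R).

Lemma inv_sqrt_int_right (a b : R) : a < b ->
  L1 leb `]a, b[ (fun t => (Num.sqrt (t - a))^-1) /\
  Rintegral leb `]a, b[ (fun t => (Num.sqrt (t - a))^-1) = 2 * Num.sqrt (b - a).
Proof.
move=> ab; have cs : continuous (fun t : R => Num.sqrt (t - a)).
  move=> t; apply: (@continuous_comp R R R (fun t => t - a) Num.sqrt).
    by apply: cvgB; [exact: cvg_id|exact: cvg_cst].
  exact: sqrt_continuous.
have [|x /andP[xa xb]|x|x _|L1f ->] := @ge0_FTC2_oo R (fun t => (Num.sqrt (t - a))^-1)
    (fun t => 2 * Num.sqrt (t - a)) a b ab.
- apply: continuous_subspaceT => t; apply: cvgM; [exact: cvg_cst|exact: cs].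
- have p : 0 < x - a by rewrite subr_gt0.
  have d1 := @is_derive1_sqrt R _ p.
  have d2 := der_comp (der_sub (der_id x) (der_cst a x)) d1.
  apply: (is_derive_eq (der_scale 2 d2)).
  have q : Num.sqrt (x - a) != 0 by rewrite gt_eqF// sqrtr_gt0.
  by field.
- rewrite in_itv/= => /andP[xa _]; apply: cvgV; last exact: cs.
  by rewrite gt_eqF// sqrtr_gt0 subr_gt0.
- by rewrite invr_ge0 sqrtr_ge0.
- by split=> //; rewrite subrr sqrtr0 mulr0 subr0.
Qed.

Lemma inv_sqrt_int_left (a b : R) : a < b ->
  L1 leb `]a, b[ (fun t => (Num.sqrt (b - t))^-1) /\
  Rintegral leb `]a, b[ (fun t => (Num.sqrt (b - t))^-1) = 2 * Num.sqrt (b - a).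
Proof.
move=> ab; have cs : continuous (fun t : R => Num.sqrt (b - t)).
  move=> t; apply: (@continuous_comp R R R (fun t => b - t) Num.sqrt).
    by apply: cvgB; [exact: cvg_cst|exact: cvg_id].
  exact: sqrt_continuous.
have [|x /andP[xa xb]|x|x _|L1f ->] := @ge0_FTC2_oo R (fun t => (Num.sqrt (b - t))^-1)
    (fun t => - 2 * Num.sqrt (b - t)) a b ab.
- apply: continuous_subspaceT => t; apply: cvgM; [exact: cvg_cst|exact: cs].
- have p : 0 < b - x by rewrite subr_gt0.
  have d1 := @is_derive1_sqrt R _ p.
  have d2 := der_comp (der_sub (der_cst b x) (der_id x)) d1.
  apply: (is_derive_eq (der_scale (- 2) d2)).
  have q : Num.sqrt (b - x) != 0 by rewrite gt_eqF// sqrtr_gt0.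
  by field.
- rewrite in_itv/= => /andP[_ xb]; apply: cvgV; last exact: cs.
  by rewrite gt_eqF// sqrtr_gt0 subr_gt0.
- by rewrite invr_ge0 sqrtr_ge0.
- by split=> //; rewrite subrr sqrtr0 mulr0 sub0r mulNr opprK.
Qed.

(** The splitting at c holds at every point, because at t = c the integrand is 1 / sqrt 0 = 0 by
    convention. *)
Lemma inv_sqrt_dist_int (a b c : R) : a < c < b ->
  L1 leb `]a, b[ (fun t => (Num.sqrt `|c - t|)^-1) /\
  Rintegral leb `]a, b[ (fun t => (Num.sqrt `|c - t|)^-1) =
    2 * Num.sqrt (c - a) + 2 * Num.sqrt (b - c).
Proof.
move=> /andP[ac cb].
have [Ll <-] := inv_sqrt_int_left ac; have [Lr <-] := inv_sqrt_int_right cb.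
set l := (fun t => (Num.sqrt (c - t))^-1) in Ll *.
set r := (fun t => (Num.sqrt (t - c))^-1) in Lr *.
have mA : measurable (`]a, c[%classic : set (measurableTypeR R)) by exact: measurable_itv.
have mB : measurable (`]c, b[%classic : set (measurableTypeR R)) by exact: measurable_itv.
have mAB : measurable (`]a, b[%classic : set (measurableTypeR R)) by exact: measurable_itv.
have E : (fun t => (Num.sqrt `|c - t|)^-1) \_ `]a, b[ =
    (fun t => (l \_ `]a, c[) t + (r \_ `]c, b[) t).
  apply/funext => t; rewrite /patch /l /r; case: ifPn => [/set_mem|].
    rewrite /= in_itv/= => /andP[at_ tb]; have [tc|ct|tc] := ltgtP t c.
    - rewrite mem_set/= ?in_itv/= ?at_// memNset/= ?in_itv/= ?addr0.
        by rewrite gtr0_norm ?subr_gt0.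
      by rewrite ltNge (ltW tc).
    - rewrite memNset/= ?in_itv/= ?add0r; last by rewrite [t < c]ltNge (ltW ct) andbF.
      by rewrite mem_set/= ?in_itv/= ?ct// distrC gtr0_norm ?subr_gt0.
    - by rewrite tc !memNset/= ?in_itv/= ?ltxx ?andbF//= subrr normr0 sqrtr0 invr0 addr0.
  move=> /negP nt; rewrite !memNset/= ?addr0// in_itv/= => /andP[t1 t2]; apply: nt;
    rewrite inE/= in_itv/= ?t1 ?t2 ?(lt_trans t2 cb) ?(lt_trans ac t1)//.
have P (A : set R) f : measurable (A : set (measurableTypeR R)) ->
    L1 leb A f <-> L1 leb setT (f \_ A).
  move=> mA'; rewrite /L1 integrable_mkcond//; rewrite (_ : EFin \o (f \_ A) = (EFin \o f) \_ A)//.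
  by apply/funext => t; rewrite /= /patch; case: ifP.
have L' := (P _ _ mA).1 Ll; have R' := (P _ _ mB).1 Lr.
split; first by apply/(P _ _ mAB); rewrite E; exact: (L1D measurableT L' R').
by rewrite !(Rintegral_mkcond leb `]_, _[) E (RintegralD measurableT L' R').
Qed.

(** ln x = 2 ln (sqrt x), and ln y < y at y = 1 / sqrt x. At x = 0 both sides are 0 by
    convention. *)
Lemma ln_le_inv_sqrt (x : R) : 0 <= x <= 1 -> `|ln x| <= 2 * (Num.sqrt x)^-1.
Proof.
move=> /andP[]; rewrite le_eqVlt => /predU1P[<- _|x0 x1].
  by rewrite sqrtr0 invr0 mulr0 ln0// normr0.
have s0 : 0 < Num.sqrt x by rewrite sqrtr_gt0.
rewrite ler0_norm ?ln_le0// -{1}(sqr_sqrtr (ltW x0)) lnXn// -mulNrn -lnV ?posrE//.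
rewrite mulr2n mulrDl mul1r; apply: ltW; apply: ltrD; apply: ln_sublinear; rewrite invr_gt0//.
Qed.

End inverse_sqrt.

(** * Norm of the logarithmic operator *)

Section logarithmic_operator.
Variables (R : realType) (e : R) (he : 0 < e).
Notation leb := (@lebesgue_measure R).
Notation D := (Iopen e).
Notation w := (wgt e).
Notation X := (L2 leb D w).
Notation ipX := (ip leb D w).
Notation N f := (ipX f f).
Let mD := @measurable_Iopen R e.
Let mw := @wgt_measurable R e D.
Let w0 t (Dt : D t) : 0 < w t := wgt_gt0 Dt.

(** Cauchy-Schwarz for |nu| against 1 / w, whose squared norm in X is pi. *)
Lemma prim_sqr_le nu t : X nu -> - e <= t <= e -> prim (- e) nu t ^+ 2 <= pi * N nu.
Proof.
move=> Xnu te; have Lnu := X_L1 he Xnu.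
have Xn : X (fun s => `|nu s|).
  apply: L2_sq; first by apply: measurableT_comp => //; exact: Xnu.1.
  by apply: (eq_L1 mD _ (L2_mul mD mw w0 Xnu Xnu)) => s _; rewrite -normrM ger0_norm// -expr2 sqr_ge0.
have XV := wgtV_L2 he.
have -> : N nu = N (fun s => `|nu s|).
  by apply: eq_Rintegral => s _; rewrite -normrM ger0_norm// -expr2 sqr_ge0.
have <- : N (fun t => (w t)^-1) = pi by rewrite ip_wgtV// (wgtV_int he).2.
rewrite mulrC; apply: le_trans (ip_CS mD mw w0 Xn XV).
rewrite ip_wgtV// -real_normK ?num_real// lerXn2r ?nnegrE//.
  by apply: Rintegral_ge0.
exact: prim_bound.
Qed.

Lemma norm_bounded (f : R -> R) M : measurable_fun D f -> (forall t, D t -> `|f t| <= M) ->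
  N f <= M ^+ 2 * (2 * e ^+ 2).
Proof.
move=> mf fM; have Xf := bounded_L2 he mf fM.
have Lc : L1 leb D (fun _ => M ^+ 2 * e).
  apply: (@L1_bounded_itv _ _ _ _ `|M ^+ 2 * e|) => //.
have -> : M ^+ 2 * (2 * e ^+ 2) = Rintegral leb D (fun _ => M ^+ 2 * e).
  rewrite Rintegral_cst// -[fine _]/(fine (lebesgue_measure (`]- e, e[ : set R))).
  by rewrite lebesgue_measure_itv/= lte_fin (itvNe he)/=; ring.
apply: (le_Rintegral mD (L2_mul mD mw w0 Xf Xf) Lc) => t Dt.
rewrite mulrC; apply: ler_pM; rewrite ?wgt_ge0 ?wgt_le//; first by rewrite -expr2 sqr_ge0.
by rewrite -expr2 -real_normK ?num_real// lerXn2r ?nnegrE// ?fM// (le_trans _ (fM t Dt)).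
Qed.

Hypothesis he2 : e <= 2^-1.

(** As e <= 1/2, |tau - t| <= 1 and [ln_le_inv_sqrt] applies; the bound integrates to 4 sqrt (tau +
    e) + 4 sqrt (e - tau) <= 8. *)
Lemma log_kernel (tau : R) : D tau -> L1 leb D (fun t => ln `|tau - t|) /\
  Rintegral leb D (fun t => `|ln `|tau - t| |) <= 8.
Proof.
have h3 : e + e <= 1 by rewrite (splitr 1) -[1 / 2]/(1 * 2^-1) mul1r lerD.
move=> /IopenP Dt; have [Lk Ik] := inv_sqrt_dist_int Dt.
have m : measurable_fun D (fun t => ln `|tau - t|).
  apply: measurableT_comp; first exact: measurable_ln.
  by apply: measurableT_comp => //; exact: measurable_funB.
have L2k := L1Z mD 2 Lk.
have B (t : R) : D t -> `|ln `|tau - t| | <= 2 * (Num.sqrt `|tau - t|)^-1.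
  move=> /IopenP /andP[t1 t2]; case/andP: Dt => s1 s2.
  by apply: ln_le_inv_sqrt; rewrite normr_ge0/= ler_norml; apply/andP; split; lra.
have L1n : L1 leb D (fun t => ln `|tau - t|) by exact: (L1_le mD m B L2k).
split => //; apply: (le_trans (le_Rintegral mD (L1_norm L1n) L2k B)).
rewrite (RintegralZl 2 mD Lk) Ik.
have S (x : R) : x <= 1 -> Num.sqrt x <= 1 by move=> x1; rewrite -[leRHS]sqrtr1 ler_wsqrtr.
case/andP: Dt => s1 s2.
have S1 : tau - - e <= 1 by lra.
have S2 : e - tau <= 1 by lra.
have := S _ S1; have := S _ S2; lra.
Qed.

Lemma Lop_L1 (mu : R -> R) (M tau : R) : measurable_fun D mu -> (forall t, D t -> `|mu t| <= M) -> D tau ->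
  L1 leb D (fun t => mu t * ln `|tau - t|).
Proof.
move=> mmu muM Dt; have [L _] := log_kernel Dt.
by apply: (eq_L1 mD _ (L1Mbounded mD L mmu muM)) => t _; rewrite mulrC.
Qed.

Lemma Lop_bound (mu : R -> R) (M tau : R) : measurable_fun D mu -> (forall t, D t -> `|mu t| <= M) -> D tau ->
  `|Lop e mu tau| <= 8 * M.
Proof.
move=> mmu muM Dt; have L := Lop_L1 mmu muM Dt; have [Lk Ik] := log_kernel Dt.
have M0 : 0 <= M by exact: le_trans (muM _ Dt).
apply: (le_trans (le_normr_Rintegral mD L)).
apply: (@le_trans _ _ (Rintegral leb D (fun t => M * `|ln `|tau - t| |))).
  apply: (le_Rintegral mD (L1_norm L) (L1Z mD M (L1_norm Lk))) => t Dt'.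
  by rewrite normrM ler_wpM2r// muM.
by rewrite (RintegralZl M mD (L1_norm Lk)) mulrC ler_wpM2r.
Qed.

(** |mu| <= M with M^2 = pi |nu|^2, so |L mu| <= 8 M, and the squared norm is at most (8 M)^2 * 2
    e^2; this is the origin of 128. *)
Lemma Lop_norm (mu nu : R -> R) : X nu -> (forall t, D t -> mu t = prim (- e) nu t) ->
  X (Lop e mu) /\ N (Lop e mu) <= 128 * pi * e ^+ 2 * N nu.
Proof.
move=> Xnu muE; have Lnu := X_L1 he Xnu.
pose M := Num.sqrt (pi * N nu).
have p0 : 0 <= pi * N nu by rewrite mulr_ge0 ?pi_ge0// (ip_ge0 leb w0).
have mmu : measurable_fun D mu.
  apply: eq_measurable_fun (prim_measurable (itvNe he) Lnu) => t /set_mem Dt; by rewrite muE.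
have muM t : D t -> `|mu t| <= M.
  move=> Dt; rewrite muE// -sqrtr_sqr ler_wsqrtr// prim_sqr_le//.
  by move/IopenP: Dt => /andP[/ltW -> /ltW ->].
have mL : measurable_fun D (Lop e mu) by exact: Lop_measurable.
have LM t : D t -> `|Lop e mu t| <= 8 * M by exact: Lop_bound.
split; first exact: bounded_L2 LM.
apply: (le_trans (norm_bounded mL LM)).
rewrite exprMn sqr_sqrtr//; lra.
Qed.

End logarithmic_operator.

(** * Smooth functions with small support *)

Section smooth_functions.
Variable R : realType.
Notation leb := (@lebesgue_measure R).
Implicit Types (f : R -> R) (p : {poly R}).

Lemma poly_expRN_bounded p : exists C : R, forall s, 0 <= s -> `|p.[s]| * expR (- s) <= C.
Proof.
exists (\sum_(i < size p) `|p`_i| * i`!%:R) => s s0.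
rewrite horner_coef; apply: (@le_trans _ _ ((\sum_(i < size p) `|p`_i| * s ^+ i) * expR (- s))).
  rewrite ler_wpM2r ?expR_ge0//; apply: (le_trans (ler_norm_sum _ _ _)).
  by apply: ler_sum => i _; rewrite normrM normrX (ger0_norm s0).
rewrite mulr_suml; apply: ler_sum => i _; rewrite -mulrA ler_wpM2l//.
rewrite expRN ler_pdivrMr ?expR_gt0// mulrC -ler_pdivrMr ?ltr0n ?fact_gt0//.
case: (i : nat) => [|n]; first by rewrite expr0 fact0 divr1 -[leLHS]expR0 ler_expR.
by apply: le_trans (expR_ge1Dxn n s0); rewrite lerDr.
Qed.

(** The classical exp (- 1 / u), extended by 0, with a polynomial factor in 1 / u. Letting p vary
    closes the family under differentiation, p being replaced by X^2 (p - p'). *)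
Definition bump p (u : R) : R := if 0 < u then p.[u^-1] * expR (- u^-1) else 0.

(** This is the exponential bound for X^2 p at s = 1 / u. A quadratic bound yields derivative 0 at
    the junction u = 0. *)
Lemma bump_sqr_bound p : exists C : R, forall u, `|bump p u| <= C * u ^+ 2.
Proof.
have [C hC] := poly_expRN_bounded ('X^2 * p); exists C => u; rewrite /bump.
have C0 : 0 <= C by apply: le_trans (hC 0 (lexx _)); rewrite mulr_ge0 ?expR_ge0.
case: ifP => u0; last by rewrite normr0 mulr_ge0 ?sqr_ge0.
have u1 : 0 <= u^-1 by rewrite invr_ge0 ltW.
have := hC _ u1; rewrite hornerM hornerXn normrM ger0_norm ?exprn_ge0// exprVn.
rewrite normrM (ger0_norm (expR_ge0 _)) -mulrA mulrC ler_pdivrMr ?exprn_gt0//.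
Qed.

Lemma is_derive0_sqr_bound f (C : R) : (forall u, `|f u| <= C * u ^+ 2) -> is_derive (0 : R) 1 f 0.
Proof.
move=> fC; have f0 : f 0 = 0 by apply/normr0_eq0/le_anti; rewrite normr_ge0 andbT; have := fC 0; rewrite expr0n mulr0.
have c0 : h^-1 *: (f (h *: 1 + 0) - f 0) @[h --> 0^'] --> 0.
  apply/norm_cvg0P; apply: (@squeeze_cvgr _ _ _ _ (cst 0) (fun h => C * `|h|)).
  - near=> h; have h0 : h != 0 by near: h; exact: nbhs_dnbhs_neq.
    rewrite normr_ge0/= f0 subr0 addr0 [h *: 1]mulr1 normrZ normfV.
    rewrite ler_pdivrMl ?normr_gt0// mulrCA -expr2 real_normK ?num_real//.
  - exact: cvg_cst.
  - rewrite -[X in _ --> X](mulr0 C); apply: cvgM; first exact: cvg_cst.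
    rewrite -[X in _ --> X](@normr0 _ R); apply: cvg_norm; apply: cvg_within_filter; exact: cvg_id.
by apply: DeriveDef; [exact: cvgP c0|exact: cvg_lim c0].
Unshelve. all: by end_near. Qed.

Lemma is_derive_horner p (x : R) : is_derive x 1 (fun t => p.[t]) p^`().[x].
Proof.
have := der_scaled 1 p x.
rewrite !divr1; rewrite (_ : (fun t : R => p.[t / 1]) = horner p)//.
by apply/funext => t; rewrite divr1.
Qed.

Lemma is_derive_bump p (u : R) : is_derive u 1 (bump p) (bump ('X^2 * (p - p^`())) u).
Proof.
have [u0|u0|->] := ltgtP u 0.
- rewrite /bump ltNge (ltW u0)/=; apply: near_eq_is_derive (der_cst 0 u).
  near=> v; rewrite ltNge (_ : v <= 0)//; apply: ltW; near: v; exact: lt_nbhsl.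
- rewrite {2}/bump u0.
  have un : u != 0 by rewrite gt_eqF.
  have d1 := der_inv un (der_id u).
  have d2 := der_comp d1 (is_derive_horner p u^-1).
  have d3 := der_comp (der_opp d1) (is_derive_expR (- u^-1)).
  have d4 := der_mul d2 d3.
  apply: (@is_derive_eq _ _ _ _ _ _ _ _ (near_eq_is_derive _ d4)); last first.
    have -> v : ('X^2 * (p - p^`())).[v] = v ^+ 2 * (p.[v] - p^`().[v]) :> R.
      by rewrite hornerM hornerXn hornerD hornerN.
    move: (p.[_]) (p^`().[_]) (expR _) => x y z; field.
    by rewrite un.
  near=> v; rewrite /bump ifT//; near: v; exact: lt_nbhsr.
- rewrite {2}/bump ltxx; have [C hC] := bump_sqr_bound p; exact: is_derive0_sqr_bound hC.
Unshelve. all: by end_near. Qed.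

(* A class of functions closed under differentiation, hence made of smooth functions. *)
Inductive bumpy : (R -> R) -> Prop :=
| Bumpy_bump p a b : bumpy (fun t => bump p (a + b * t))
| Bumpy_cst c : bumpy (fun=> c)
| Bumpy_add f g : bumpy f -> bumpy g -> bumpy (fun t => f t + g t)
| Bumpy_mul f g : bumpy f -> bumpy g -> bumpy (fun t => f t * g t).

Lemma bumpy_derive f : bumpy f -> exists2 f', bumpy f' & forall x : R, is_derive x 1 f (f' x).
Proof.
elim=> {f} [p a b|c|f g _ [f' bf' df] _ [g' bg' dg]|f g bf [f' bf' df] bg [g' bg' dg]].
- exists (fun t => bump ('X^2 * (p - p^`())) (a + b * t) * b).
    by apply: Bumpy_mul; [exact: Bumpy_bump|exact: Bumpy_cst].
  move=> x; have d1 := der_add (der_cst a x) (der_scale b (der_id x)).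
  apply: (is_derive_eq (der_comp d1 (is_derive_bump p (a + b * x)))).
  by rewrite add0r mulr1.
- by exists (fun=> 0); [exact: Bumpy_cst|move=> x; exact: der_cst].
- by exists (fun t => f' t + g' t); [exact: Bumpy_add|move=> x; exact: der_add].
- exists (fun t => f' t * g t + f t * g' t); last by move=> x; exact: der_mul.
  by apply: Bumpy_add; exact: Bumpy_mul.
Qed.

Lemma bumpy_smooth f : bumpy f -> forall n x, derivable (derive1n n f) x 1.
Proof.
move=> bf n; elim: n f bf => [|n IH] f /bumpy_derive[f' bf' df] x.
  by rewrite derive1n0; exact: (@ex_derive _ _ _ _ _ _ _ (df x)).
rewrite derive1Sn (_ : derive1 f = f'); first exact: IH.
by apply/funext => y; rewrite derive1E (@derive_val _ _ _ _ _ _ _ (df y)).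
Qed.

Lemma bumpy_continuous f : bumpy f -> continuous f.
Proof. by move=> /bumpy_derive[f' _ df] x; exact: der_cont (df x). Qed.

Lemma bumpy_local (x d : R) : 0 < d -> exists b : R -> R,
  [/\ bumpy b, forall t, 0 <= b t, 0 < b x & forall t, d <= `|t - x| -> b t = 0].
Proof.
move=> d0; exists (fun t => bump 1 ((d - x) + 1 * t) * bump 1 ((d + x) + (-1) * t)); split.
- by apply: Bumpy_mul; exact: Bumpy_bump.
- move=> t; apply: mulr_ge0; rewrite /bump; case: ifP => // _; rewrite -polyC1 hornerC mul1r expR_ge0//.
- rewrite /bump !ifT; [|lra|lra].
  by rewrite -polyC1 !hornerC !mul1r mulr_gt0 ?expR_gt0.
- move=> t; rewrite ler_normr => /orP[H|H].
  + by rewrite mulrC /bump ifF ?mul0r//; apply/negbTE; rewrite -leNgt; lra.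
  + by rewrite /bump ifF ?mul0r//; apply/negbTE; rewrite -leNgt; lra.
Qed.

End smooth_functions.

(** * Weak derivatives and primitives *)

Section du_Bois_Reymond.
Variables (R : realType) (e : R) (he : 0 < e).
Notation leb := (@lebesgue_measure R).
Notation D := (Iopen e).
Notation w := (wgt e).
Notation X := (L2 leb D w).
Notation ipX := (ip leb D w).
Notation N f := (ipX f f).
Let mD := @measurable_Iopen R e.
Let mw := @wgt_measurable R e D.
Let w0 t (Dt : D t) : 0 < w t := wgt_gt0 Dt.

Lemma continuous_L1_itv (g : R -> R) a b : continuous g -> L1 leb `]a, b[ g.
Proof.
move=> cg; have [M M0 hM] := continuous_bounded_itv a b cg.
apply: (L1_bounded_itv _ hM).
by apply: measurable_funTS; exact: continuous_measurable_fun.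
Qed.

Lemma prim_is_derive (g : R -> R) (a x : R) : continuous g -> a < x ->
  is_derive x 1 (prim a g) (g x).
Proof.
move=> cg ax; have xx : x < x + 1 by rewrite ltrDl.
have L : L1 leb `]a, (x + 1)] g.
  apply: (@L1_subitv _ a (x + 1)); last exact: continuous_L1_itv.
    exact: measurable_itv.
  by move=> t /=; rewrite !in_itv/= => /andP[/ltW -> ->].
have ab : (BRight a < BRight x)%O by rewrite bnd_simp.
have [dF F'] := continuous_FTC1 xx L ab (cg x).
rewrite derive1E in F'; exact: DeriveDef.
Qed.

(** The mean zero of g is what makes its primitive vanish again to the right of the support. *)
Lemma test_fun_prim (g : R -> R) (d : R) : bumpy g -> 0 < d <= e ->
  (forall t, e - d <= `|t| -> g t = 0) -> Rintegral leb D g = 0 ->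
  test_fun e (prim (- e) g) /\ forall x : R, is_derive x 1 (prim (- e) g) (g x).
Proof.
move=> bg /andP[d0 de] g0 Ig; have cg := bumpy_continuous bg.
have pl t : t <= - (e - d) -> prim (- e) g t = 0.
  move=> ht; rewrite /prim (_ : Rintegral _ _ _ = Rintegral leb `]- e, t] (fun=> 0)); last first.
    apply: eq_Rintegral => s /set_mem/=; rewrite in_itv/= => /andP[_ st].
    by rewrite g0// ler_normr; apply/orP; right; lra.
  by rewrite Rintegral_cst ?mul0r//; exact: measurable_itv.
have pr t : e - d <= t -> prim (- e) g t = 0.
  move=> ht; rewrite -Ig /prim (Rintegral_mkcond leb D) (Rintegral_mkcond leb).
  congr Rintegral; apply/funext => s; rewrite /patch.
  have [g_0|gn0] := eqVneq (g s) 0; first by rewrite g_0 !if_same.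
  have : `|s| < e - d by rewrite ltNge; apply: contra gn0 => /g0 ->.
  rewrite ltr_norml => /andP[s1 s2]; rewrite !mem_set// /Iopen/= in_itv/=; apply/andP; split; lra.
have dg (x : R) : is_derive x 1 (prim (- e) g) (g x).
  have [xl|xr] := ltP x (- (e - d)); last by apply: prim_is_derive => //; lra.
  rewrite g0; last by rewrite ler_normr; apply/orP; right; lra.
  apply: near_eq_is_derive (der_cst 0 x); near=> v; rewrite pl//; apply: ltW.
  by near: v; exact: lt_nbhsl.
split => //; split.
  case=> [|n] x; first by rewrite derive1n0; exact: (@ex_derive _ _ _ _ _ _ _ (dg x)).
  rewrite derive1Sn (_ : derive1 _ = g); first exact: bumpy_smooth.
  by apply/funext => y; rewrite derive1E (@derive_val _ _ _ _ _ _ _ (dg y)).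
exists d => // x; rewrite ler_normr => /orP[|h]; first exact: pr.
by apply: pl; lra.
Unshelve. all: by end_near. Qed.

Lemma local_average (q : R -> R) (x r eta : R) : L1 leb D q -> D x ->
  {for x, continuous q} -> 0 < r -> 0 < eta ->
  exists b : R -> R, [/\ bumpy b, forall t, r <= `|t - x| -> b t = 0,
    Rintegral leb D b = 1 & `|Rintegral leb D (fun t => q t * b t) - q x| <= eta].
Proof.
move=> Lq Dx /cvgrPdist_lt cq r0 eta0.
have [d /= d0 qd] := cq _ eta0.
have s0 : 0 < Num.min r d by rewrite lt_min r0.
have [b [bb b0 bx bs]] := bumpy_local x s0.
have cb := bumpy_continuous bb.
have Lb : L1 leb D b by exact: continuous_L1_itv.
(* If the integral were 0, the primitive of the nonnegative b would vanish near x, whereas its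
   derivative there is b x > 0. *)
have B0 : 0 < Rintegral leb D b.
  rewrite lt0r Rintegral_ge0 ?andbT//; apply/eqP => B0.
  have /IopenP/andP[x1 x2] := Dx.
  have d1 := prim_is_derive cb x1.
  suff d2 : is_derive x 1 (prim (- e) b) 0.
    by move: bx; rewrite -(@derive_val _ _ _ _ _ _ _ d1) (@derive_val _ _ _ _ _ _ _ d2) ltxx.
  apply: near_eq_is_derive (der_cst 0 x).
  have /near_in_itvoo nx : x \in `]- e, e[ by rewrite in_itv/= x1.
  near=> y; apply/esym/eqP; rewrite -normr_le0.
  have /andP[y1 y2] : - e <= y <= e.
    suff : y \in `]- e, e[ by rewrite in_itv/= => /andP[/ltW -> /ltW ->].
    by near: y.
  have -> : 0 = Rintegral leb D (fun t => `|b t|).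
    by rewrite -B0; apply: eq_Rintegral => t _; rewrite ger0_norm.
  by apply: prim_bound => //; rewrite y1.
set B := Rintegral leb D b in B0.
have [M _ hM] := continuous_bounded_itv (- e) e cb.
have mb : measurable_fun D b by exact: L1_measurable Lb.
have Lqb : L1 leb D (fun t => q t * b t) by exact: (L1Mbounded mD Lq mb hM).
exists (fun t => B^-1 * b t); split.
- by apply: Bumpy_mul => //; exact: Bumpy_cst.
- by move=> t rt; rewrite bs ?mulr0//; apply: le_trans rt; rewrite ge_min lexx.
- by rewrite (RintegralZl _ mD Lb) mulVf// gt_eqF.
have -> : Rintegral leb D (fun t => q t * (B^-1 * b t)) = B^-1 * Rintegral leb D (fun t => q t * b t).
  by rewrite -(RintegralZl _ mD Lqb); apply: eq_Rintegral => t _; rewrite mulrCA.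
have -> : q x = B^-1 * Rintegral leb D (fun t => q x * b t).
  by rewrite (RintegralZl _ mD Lb) -/B; field; rewrite gt_eqF.
rewrite -mulrBr -(RintegralB mD Lqb (L1Z mD (q x) Lb)) normrM gtr0_norm ?invr_gt0//.
rewrite ler_pdivrMl// mulrC -(RintegralZl _ mD Lb).
have L3 := L1B mD Lqb (L1Z mD (q x) Lb).
apply: (le_trans (le_normr_Rintegral mD L3)).
apply: (le_Rintegral mD (L1_norm L3) (L1Z mD eta Lb)) => t _.
rewrite -mulrBl normrM (ger0_norm (b0 t)).
have [h|h] := ltP `|t - x| (Num.min r d); last by rewrite bs// !mulr0.
rewrite ler_wpM2r// distrC; apply/ltW/qd => /=; rewrite distrC.
by apply: lt_le_trans h _; rewrite ge_min lexx orbT.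
Unshelve. all: by end_near. Qed.

(** The difference of two averaging bumps around x and y has mean zero, so its primitive is a test
    function and the two averages of q agree. They lie within eta = |q x - q y| / 3 of q x and q y,
    which is absurd unless q x = q y. *)
Lemma weak_zero_const (q : R -> R) : L1 leb D q -> {in `]- e, e[, continuous q} ->
  (forall phi, test_fun e phi -> Rintegral leb D (fun t => q t * derive1 phi t) = 0) ->
  forall x y, D x -> D y -> q x = q y.
Proof.
move=> Lq cq q0 x y Dx Dy; apply/eqP; rewrite -subr_eq0 -normr_eq0; apply/negPn/negP => n0.
have eta0 : 0 < `|q x - q y| / 3 by rewrite divr_gt0// lt0r n0 normr_ge0.
set eta := _ / 3 in eta0.
have P z : D z -> {for z, continuous q} by move=> Dz; apply: cq.
have /IopenP Dx' := Dx; have /IopenP Dy' := Dy.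
rewrite -ltr_norml in Dx'; rewrite -ltr_norml in Dy'.
(* r + r is the smaller of the distances of x and y to the boundary, so bumps of radius r vanish for
   |t| >= e - r. *)
pose r := Num.min (e - `|x|) (e - `|y|) / 2.
have m0 : 0 < Num.min (e - `|x|) (e - `|y|) by rewrite lt_min !subr_gt0 Dx'.
have r0 : 0 < r by rewrite divr_gt0.
have r2 : r + r = Num.min (e - `|x|) (e - `|y|) by rewrite -splitr.
have [b1 [bb1 s1 I1 A1]] := local_average Lq Dx (P _ Dx) r0 eta0.
have [b2 [bb2 s2 I2 A2]] := local_average Lq Dy (P _ Dy) r0 eta0.
pose g t := b1 t + (-1) * b2 t.
have bg : bumpy g by apply: Bumpy_add => //; apply: Bumpy_mul => //; exact: Bumpy_cst.
have c1 := bumpy_continuous bb1; have c2 := bumpy_continuous bb2.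
have L1b : L1 leb D b1 by exact: continuous_L1_itv.
have L2b : L1 leb D b2 by exact: continuous_L1_itv.
have Ig : Rintegral leb D g = 0.
  by rewrite (RintegralD mD L1b (L1Z mD (-1) L2b)) (RintegralZl _ mD L2b) I1 I2; ring.
have re : 0 < r <= e.
  have : Num.min (e - `|x|) (e - `|y|) <= e - `|x| by rewrite ge_min lexx.
  have := normr_ge0 x; rewrite r0/=; lra.
have gs t : e - r <= `|t| -> g t = 0.
  move=> ht; have S z : r + r <= e - `|z| -> r <= `|t - z|.
    by have := ler_normD (t - z) z; rewrite subrK; lra.
  rewrite /g s1 ?s2 ?mulr0 ?addr0//; apply: S; rewrite r2 ge_min lexx ?orbT//.
have [tf dp] := test_fun_prim bg re gs Ig.
have := q0 _ tf; rewrite (_ : derive1 _ = g); last first.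
  by apply/funext => t; rewrite derive1E (@derive_val _ _ _ _ _ _ _ (dp t)).
have K b : bumpy b -> L1 leb D (fun t => q t * b t).
  move=> bb; have cb := bumpy_continuous bb.
  have [M _ hM] := continuous_bounded_itv (- e) e cb.
  apply: (L1Mbounded mD Lq _ hM); apply: L1_measurable; exact: continuous_L1_itv.
rewrite (_ : Rintegral _ _ _ = Rintegral leb D (fun t => q t * b1 t) - Rintegral leb D (fun t => q t * b2 t)); last first.
  rewrite -(RintegralB mD (K _ bb1) (K _ bb2)); apply: eq_Rintegral => t _; rewrite /g; ring.
move=> /eqP; rewrite subr_eq0 => /eqP E; rewrite E in A1.
have : `|q x - q y| <= eta + eta.
  apply: le_trans _ (lerD A2 A1); apply: le_trans _ (ler_normB _ _).
  by rewrite le_eqVlt; apply/orP; left; apply/eqP; congr `|_|; ring.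
by have : `|q x - q y| = eta * 3 by [rewrite /eta mulfVK]; lra.
Qed.

Lemma inX_L2 (f : R -> R) : inX e f <-> X f.
Proof.
have P (f0 : R -> R) : measurable_fun D f0 -> measurable_fun D (fun t => w t * f0 t ^+ 2).
  by move=> mf; apply: measurable_funM => //; exact: measurable_funX.
have E : Xnorm2 e f = (\int[leb]_(t in D) `|(w t * f t ^+ 2)%:E|)%E.
  by apply: eq_integral => t _; rewrite gee0_abs// lee_fin mulr_ge0 ?wgt_ge0 ?sqr_ge0.
split=> -[mf h]; split=> //.
  by apply/integrableP; split; [apply/measurable_EFinP; exact: P|rewrite /= -E].
by case/integrableP: h => _; rewrite E.
Qed.

Lemma Xnorm2E (f : R -> R) : X f -> Xnorm2 e f = (N f)%:E.
Proof.
move=> Xf; rewrite (EFin_Rintegral mD); last exact: (L2_mul mD mw w0 Xf Xf).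
by apply: eq_integral => t _; rewrite expr2.
Qed.

(** mu minus the primitive of nu has weak derivative 0, hence is constant on D; being continuous and
    0 at - e, it vanishes up to both ends, and its value at e says that nu has mean zero. *)
Lemma inYPi_prim (mu nu : R -> R) : inYPi e mu nu ->
  [/\ X nu, Rintegral leb D nu = 0 &
     forall t, Iclosed e t -> mu t = prim (- e) nu t].
Proof.
move=> [[cmu [_ [/inX_L2 Xnu wd]]] [mul mur]].
have Lnu := X_L1 he Xnu; have ee := itvNe he.
have cp : {within `[- e, e], continuous (prim (- e) nu)} := prim_continuous (ltW ee) Lnu.
pose q t := mu t - prim (- e) nu t.
have cq : {within `[- e, e], continuous q} by move=> t; apply: cvgB; [exact: cmu|exact: cp].
have LC f : {within `[- e, e], continuous f} -> L1 leb D f.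
  move=> cf; have L : leb.-integrable `[- e, e] (EFin \o f).
    by apply: continuous_compact_integrable => //; exact: segment_compact.
  apply: (integrableS _ mD _ L); first exact: measurable_itv.
  by move=> t /=; rewrite !in_itv/= => /andP[/ltW -> /ltW ->].
have Lq := LC _ cq; have Lmu := LC _ cmu; have Lp := LC _ cp.
have /(continuous_within_itvP _ ee)[cqi cql cqr] := cq.
have q0 phi : test_fun e phi -> Rintegral leb D (fun t => q t * derive1 phi t) = 0.
  move=> tf; have [dphi [d d0 phi0]] := tf.
  have dd (x : R) : is_derive x 1 phi (derive1 phi x).
    by apply: DeriveDef; [exact: (dphi 0%N x)|rewrite derive1E].
  have cphi' : continuous (derive1 phi).
    move=> x; apply: differentiable_continuous; apply/derivable1_diffP.
    by have := dphi 1%N x; rewrite derive1n1.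
  have [M _ hM] := continuous_bounded_itv (- e) e cphi'.
  have mphi : measurable_fun D (derive1 phi).
    by apply: measurable_funTS; exact: continuous_measurable_fun.
  have := prim_by_parts ee Lnu dd cphi'.
  rewrite (phi0 e) ?mul0r ?sub0r => [H|]; last by rewrite gtr0_norm//; lra.
  have := wd _ tf; rewrite -H => {}H.
  transitivity (Rintegral leb D (fun t => mu t * derive1 phi t) - Rintegral leb D (fun t => prim (- e) nu t * derive1 phi t)).
    rewrite -(RintegralB mD (L1Mbounded mD Lmu mphi hM) (L1Mbounded mD Lp mphi hM)).
    by apply: eq_Rintegral => t _; rewrite /q; ring.
  by rewrite H subrr.
have qc := weak_zero_const Lq cqi q0.
have D0 : D 0 by apply/IopenP; rewrite oppr_lt0 he.
have ql0 : q (- e) = 0 by rewrite /q mul prim_left subrr.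
have q00 : q 0 = 0.
  have c0 : q t @[t --> (- e)^'+] --> q 0.
    apply: cvg_near_cst; near=> t; apply: qc => //; apply/IopenP; apply/andP; split; near: t.
      exact: nbhs_right_gt.
    exact: nbhs_right_lt.
  by rewrite -[RHS]ql0; exact: (cvg_unique (@Rhausdorff R) c0 cql).
have qr0 : q e = 0.
  have c0 : q t @[t --> e^'-] --> q 0.
    apply: cvg_near_cst; near=> t; apply: qc => //; apply/IopenP; apply/andP; split; near: t.
      exact: nbhs_left_gt.
    exact: nbhs_left_lt.
  by rewrite -[RHS]q00; exact: (cvg_unique (@Rhausdorff R) cqr c0).
split=> //.
  by have : mu e - prim (- e) nu e = 0 := qr0; rewrite mur (primE Lnu) sub0r => /eqP; rewrite oppr_eq0 => /eqP.
move=> t; rewrite /Iclosed/= in_itv/= => /andP[]; rewrite le_eqVlt => /predU1P[<- _|t1].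
  by rewrite prim_left.
rewrite le_eqVlt => /predU1P[->|t2]; apply/eqP; rewrite -subr_eq0 -/(q _) ?qr0//.
by rewrite (qc t 0)// ?q00//; apply/IopenP; rewrite t1.
Unshelve. all: by end_near. Qed.

Lemma prim_inYPi (nu : R -> R) : X nu -> Rintegral leb D nu = 0 ->
  inYPi e (prim (- e) nu) nu.
Proof.
move=> Xnu nu0; have Lnu := X_L1 he Xnu; have ee := itvNe he.
split; last by rewrite prim_left (primE Lnu).
split; first exact: (prim_continuous (ltW ee) Lnu).
split; last split.
- apply/inX_L2; apply: (@bounded_L2 _ _ he _ (Rintegral leb D (fun s => `|nu s|))).
    exact: prim_measurable ee Lnu.
  by move=> t /IopenP/andP[/ltW t1 /ltW t2]; apply: prim_bound => //; rewrite t1.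
- exact/inX_L2.
- move=> phi [dphi [d d0 phi0]].
  have dd (x : R) : is_derive x 1 phi (derive1 phi x).
    by apply: DeriveDef; [exact: (dphi 0%N x)|rewrite derive1E].
  have cphi' : continuous (derive1 phi).
    move=> x; apply: differentiable_continuous; apply/derivable1_diffP.
    by have := dphi 1%N x; rewrite derive1n1.
  by rewrite (prim_by_parts ee Lnu dd cphi') nu0 mulr0 sub0r.
Qed.

End du_Bois_Reymond.

(** * The operator on mean-zero functions and the Neumann iteration *)

Section assembly.
Variables (R : realType) (e : R) (he : 0 < e).
Notation leb := (@lebesgue_measure R).
Notation D := (Iopen e).
Notation w := (wgt e).
Notation X := (L2 leb D w).
Notation ipX := (ip leb D w).
Notation N f := (ipX f f).
Notation mean0 nu := (Rintegral leb D nu = 0).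
Notation G nu := (Jop e (prim (- e) nu)).
Notation L nu := (Lop e (prim (- e) nu)).
Let mD := @measurable_Iopen R e.
Let mw := @wgt_measurable R e D.
Let w0 t (Dt : D t) : 0 < w t := wgt_gt0 Dt.
Let aeF := ae_filter_ringOfSetsType leb.
Implicit Types (f g nu : R -> R).

Lemma L2_ae f g : X f -> measurable_fun D g -> ae_eq_on e f g -> X g.
Proof.
move=> [mf Lf] mg fg; split => //.
have m (h : R -> R) : measurable_fun D h -> measurable_fun D (fun t => w t * h t ^+ 2).
  by move=> mh; apply: measurable_funM => //; exact: measurable_funX.
case/integrableP: Lf => _ Lf; apply/integrableP; split; first by apply/measurable_EFinP; exact: m.
apply: le_lt_trans Lf; rewrite le_eqVlt; apply/orP; left; apply/eqP.
apply: ae_eq_integral => //.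
- by apply: measurableT_comp => //; apply/measurable_EFinP; exact: m.
- by apply: measurableT_comp => //; apply/measurable_EFinP; exact: m.
- have := fg; apply: filterS; first exact: aeF.
  by move=> t H Dt /=; rewrite H.
Qed.

Lemma norm_ae f g : X f -> X g -> ae_eq_on e f g -> N f = N g.
Proof.
move=> Xf Xg fg; rewrite (ip_ae_eq mD mw w0 Xf Xg Xf fg) ipC.
exact: (ip_ae_eq mD mw w0 Xf Xg Xg fg).
Qed.

Lemma normZ c f : X f -> N (fun t => c * f t) = c ^+ 2 * N f.
Proof.
move=> Xf; have Xc := L2Z mD c Xf.
rewrite (ipZl mD mw w0 c Xf Xc) ipC (ipZl mD mw w0 c Xf Xf); ring.
Qed.

Lemma prim_lin (c1 c2 : R) nu1 nu2 t : L1 leb D nu1 -> L1 leb D nu2 -> - e <= t <= e ->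
  prim (- e) (fun s => c1 * nu1 s + c2 * nu2 s) t =
  c1 * prim (- e) nu1 t + c2 * prim (- e) nu2 t.
Proof.
move=> L1n L2n /andP[_ te].
have mI : measurable (`]- e, t]%classic : set (measurableTypeR R)) by exact: measurable_itv.
have sI : `]- e, t]%classic `<=` `[- e, e]%classic.
  by move=> s /=; rewrite !in_itv/= => /andP[/ltW -> /le_trans -> //].
have K1 := L1_subitv mI sI L1n; have K2 := L1_subitv mI sI L2n.
by rewrite /prim (RintegralD mI (L1Z mI c1 K1) (L1Z mI c2 K2))
  (RintegralZl c1 mI K1) (RintegralZl c2 mI K2).
Qed.

Lemma mean0_lin (c1 c2 : R) nu1 nu2 : L1 leb D nu1 -> L1 leb D nu2 -> mean0 nu1 -> mean0 nu2 ->
  mean0 (fun s => c1 * nu1 s + c2 * nu2 s).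
Proof.
move=> L1n L2n m1 m2; rewrite (RintegralD mD (L1Z mD c1 L1n) (L1Z mD c2 L2n)).
by rewrite (RintegralZl c1 mD L1n) (RintegralZl c2 mD L2n) m1 m2 !mulr0 addr0.
Qed.

Lemma L2_lin (c1 c2 : R) f g : X f -> X g -> X (fun s => c1 * f s + c2 * g s).
Proof. by move=> Xf Xg; apply: (L2D mD mw w0); exact: (L2Z mD). Qed.

Lemma Jreg_lin (c1 c2 : R) nu1 nu2 tau h : X nu1 -> X nu2 -> mean0 nu1 -> mean0 nu2 -> 0 < h ->
  Jreg e (prim (- e) (fun s => c1 * nu1 s + c2 * nu2 s)) tau h =
  c1 * Jreg e (prim (- e) nu1) tau h + c2 * Jreg e (prim (- e) nu2) tau h.
Proof.
move=> X1 X2 m1 m2 h0; have L1n := X_L1 he X1; have L2n := X_L1 he X2.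
have s0 : 0 < Num.sqrt h by rewrite sqrtr_gt0.
have K1 := L1_kerA tau s0 L1n; have K2 := L1_kerA tau s0 L2n.
have L3 := L1D mD (L1Z mD c1 L1n) (L1Z mD c2 L2n).
rewrite (Jreg_kerA he tau L1n m1 (fun t _ => erefl) h0) (Jreg_kerA he tau L2n m2 (fun t _ => erefl) h0).
rewrite (Jreg_kerA he tau L3 (mean0_lin c1 c2 L1n L2n m1 m2) (fun t _ => erefl) h0).
rewrite !mulrN -opprD -(RintegralZl c1 mD K1) -(RintegralZl c2 mD K2).
rewrite -(RintegralD mD (L1Z mD c1 K1) (L1Z mD c2 K2)); congr (- _).
by apply: eq_Rintegral => t _; ring.
Qed.

Lemma G_cvg nu : X nu -> mean0 nu -> exists2 g, X g & N nu = N g /\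
  {ae leb, forall tau, D tau -> Jreg e (prim (- e) nu) tau h @[h --> 0^'+] --> pi * g tau}.
Proof.
move=> Xnu m0; have [g Xg cp] := conj_pair_exists he Xnu m0; exists g => //.
by split; [exact: (conj_pair_norm he Xnu Xg cp)|exact: (Jreg_cvg he Xnu Xg cp)].
Qed.

Lemma G_ae nu g : {ae leb, forall tau, D tau ->
  Jreg e (prim (- e) nu) tau h @[h --> 0^'+] --> pi * g tau} ->
  ae_eq_on e (fun t => pi * g t) (G nu).
Proof.
apply: filterS; first exact: aeF.
move=> tau H Dt; apply/esym; have := H Dt; exact: cvg_lim.
Qed.

Lemma G_measurable nu : X nu -> measurable_fun D (G nu).
Proof.
move=> Xnu; apply: Jop_measurable; have Lnu := X_L1 he Xnu.
apply: (X_L1 he); apply: (bounded_L2 he (prim_measurable (itvNe he) Lnu)).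
move=> t /IopenP/andP[/ltW t1 /ltW t2]; apply: (prim_bound _ Lnu); by rewrite t1.
Qed.

Lemma G_L2 nu : X nu -> mean0 nu -> X (G nu).
Proof.
move=> Xnu m0; have [g Xg [_ /G_ae H]] := G_cvg Xnu m0.
exact: L2_ae (L2Z mD pi Xg) (G_measurable Xnu) H.
Qed.

Lemma G_norm nu : X nu -> mean0 nu -> N (G nu) = pi ^+ 2 * N nu.
Proof.
move=> Xnu m0; have [g Xg [-> /G_ae H]] := G_cvg Xnu m0.
rewrite -normZ//; apply/esym; apply: norm_ae H; first exact: (L2Z mD).
exact: G_L2.
Qed.

Lemma G_onto g : X g -> exists2 nu, X nu & mean0 nu /\ ae_eq_on e g (G nu).
Proof.
move=> Xg; have Xg' := L2Z mD pi^-1 Xg.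
have [nu Xnu cp] := conj_pair_exists_inv he Xg'; exists nu => //.
split; first exact: (conj_pair_mean0 he Xnu Xg' cp).
have /G_ae := Jreg_cvg he Xnu Xg' cp (fun t _ => erefl).
apply: filterS; first exact: aeF.
move=> t H Dt; rewrite -H// mulrA mulfV ?mul1r// gt_eqF// pi_gt0//.
Qed.

(** [lim] respects linear combinations only at points where both limits exist, hence almost
    everywhere. *)
Lemma G_lin (c1 c2 : R) nu1 nu2 : X nu1 -> X nu2 -> mean0 nu1 -> mean0 nu2 ->
  ae_eq_on e (G (fun s => c1 * nu1 s + c2 * nu2 s)) (fun t => c1 * G nu1 t + c2 * G nu2 t).
Proof.
move=> X1 X2 m1 m2; have [g1 _ [_ H1]] := G_cvg X1 m1; have [g2 _ [_ H2]] := G_cvg X2 m2.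
apply: (@filterS2 _ _ aeF _ _ _ _ H1 H2) => tau /= C1 C2 Dt; have {}C1 := C1 Dt; have {}C2 := C2 Dt.
have E1 : G nu1 tau = pi * g1 tau by exact: cvg_lim C1.
have E2 : G nu2 tau = pi * g2 tau by exact: cvg_lim C2.
rewrite E1 E2; apply: cvg_lim => //.
have C3 : c1 * Jreg e (prim (- e) nu1) tau h + c2 * Jreg e (prim (- e) nu2) tau h
    @[h --> 0^'+] --> c1 * (pi * g1 tau) + c2 * (pi * g2 tau).
  by apply: cvgD; apply: cvgM => //; exact: cvg_cst.
apply: cvg_trans C3; apply: near_eq_cvg; near=> h; apply/esym/Jreg_lin => //.
Unshelve. all: by end_near. Qed.

Hypothesis he2 : e <= 2^-1.

Lemma L_lin (c1 c2 : R) nu1 nu2 tau : X nu1 -> X nu2 -> D tau ->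
  L (fun s => c1 * nu1 s + c2 * nu2 s) tau = c1 * L nu1 tau + c2 * L nu2 tau.
Proof.
move=> X1 X2 Dt; have L1n := X_L1 he X1; have L2n := X_L1 he X2.
have K nu : L1 leb D nu -> L1 leb D (fun t => prim (- e) nu t * ln `|tau - t|).
  move=> Lnu; apply: (Lop_L1 he2 (prim_measurable (itvNe he) Lnu) _ Dt).
  by move=> t /IopenP/andP[/ltW t1 /ltW t2]; apply: (prim_bound _ Lnu); rewrite t1.
have K1 := K _ L1n; have K2 := K _ L2n.
rewrite /Lop -(RintegralZl c1 mD K1) -(RintegralZl c2 mD K2).
rewrite -(RintegralD mD (L1Z mD c1 K1) (L1Z mD c2 K2)).
apply: eq_Rintegral => t /set_mem /IopenP/andP[/ltW t1 /ltW t2].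
by rewrite prim_lin ?t1// mulrDl !mulrA.
Qed.

Variables (a b : R) (a0 : 0 < a).
(** By [Lop_norm] this means |b L nu| <= |a J mu| / 4; the squared ratio 1/16 is the decay that
    [L2_complete] asks for. *)
Hypothesis small : b ^+ 2 * (128 * pi * e ^+ 2) * 16 <= (a * pi) ^+ 2.
Notation T nu := (Top a b e (prim (- e) nu)).

Lemma L_norm nu : X nu -> X (L nu) /\ b ^+ 2 * N (L nu) <= (a * pi) ^+ 2 / 16 * N nu.
Proof.
move=> Xnu; have [XL NL] := Lop_norm he he2 Xnu (fun t _ => erefl); split=> //.
apply: (le_trans (ler_wpM2l (sqr_ge0 b) NL)); rewrite mulrA ler_wpM2r ?(ip_ge0 leb w0)//.
by rewrite ler_pdivlMr.
Qed.

Lemma T_L2 nu : X nu -> mean0 nu -> X (T nu).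
Proof.
by move=> Xnu m0; apply: L2_lin; [exact: G_L2|exact: (L_norm Xnu).1].
Qed.

Lemma T_lin (c1 c2 : R) nu1 nu2 : X nu1 -> X nu2 -> mean0 nu1 -> mean0 nu2 ->
  ae_eq_on e (T (fun s => c1 * nu1 s + c2 * nu2 s)) (fun t => c1 * T nu1 t + c2 * T nu2 t).
Proof.
move=> X1 X2 m1 m2; have := G_lin c1 c2 X1 X2 m1 m2; apply: filterS; first exact: aeF.
move=> t H Dt.
rewrite /Top (H Dt) (L_lin c1 c2 X1 X2 Dt).
by move: (Jop _ _ _) (Jop _ _ _) (Lop _ _ _) (Lop _ _ _) => j1 j2 l1 l2; ring.
Qed.

(** The squares add up to 2 + 2/16 <= 3 times (a pi)^2 |nu|^2. *)
Lemma T_upper nu : X nu -> mean0 nu -> N (T nu) <= 3 * (a * pi) ^+ 2 * N nu.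
Proof.
move=> Xnu m0; have XG := G_L2 Xnu m0; have [XL NL] := L_norm Xnu.
have := ip_add_le mD mw w0 (L2Z mD (- a) XG) (L2Z mD b XL).
rewrite !normZ// (G_norm Xnu m0) sqrrN => H; apply: (le_trans H).
have := ip_ge0 leb w0 nu; move: NL; rewrite exprMn; move: (pi : R) (N nu) (N (L nu)) => p n l NL n0.
have q : 0 <= a ^+ 2 * p ^+ 2 * n by apply: mulr_ge0 => //; apply: mulr_ge0; exact: sqr_ge0.
move: NL; rewrite mulrAC; nra.
Qed.

(** - a J = T - b L gives (a pi)^2 |nu|^2 <= 2 |T|^2 + (a pi)^2 |nu|^2 / 8, and the last term is
    absorbed on the left. *)
Lemma T_lower nu : X nu -> mean0 nu -> (a * pi) ^+ 2 * N nu <= 4 * N (T nu).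
Proof.
move=> Xnu m0; have XG := G_L2 Xnu m0; have [XL NL] := L_norm Xnu; have XT := T_L2 Xnu m0.
have := ip_add_le mD mw w0 XT (L2Z mD (- b) XL).
have -> : (fun t => T nu t + - b * L nu t) = (fun t => - a * G nu t).
  by apply/funext => t; rewrite /Top; ring.
rewrite !normZ// (G_norm Xnu m0) !sqrrN mulrA -exprMn => H.
have := ip_ge0 leb w0 nu; move: NL H; move: ((a * pi) ^+ 2) (sqr_ge0 (a * pi)) => p p0.
move: (N nu) (b ^+ 2 * N (L nu)) (N (T nu)) => n l k NL H n0.
have q : 0 <= p * n by rewrite mulr_ge0.
move: NL; rewrite mulrAC; lra.
Qed.

(** The equation is read as a J nu' = b L nu - f, which [G_onto] solves for nu'. In consecutive
    differences f cancels, and their squared norms shrink by 16 at each step, so the iterates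
    converge. *)
Lemma T_onto f : X f -> exists2 nu, X nu & mean0 nu /\ ae_eq_on e (T nu) f.
Proof.
move=> Xf.
(* The condition on nu sits inside the existential, so that [choice] gives a map S defined on all
   functions. *)
have step nu : exists nu', X nu -> [/\ X nu', mean0 nu' &
    ae_eq_on e (fun t => a^-1 * (b * L nu t + (-1) * f t)) (G nu')].
  have [Xnu|] := pselect (X nu); last by exists nu.
  have [nu' Xnu' [m0 H]] := G_onto (L2Z mD a^-1 (L2_lin b (-1) (L_norm Xnu).1 Xf)).
  by exists nu'.
have [S hS] := choice step.
(* Starting at S 0 makes every u k a value of S, so that membership in X and mean zero come from
   [hS]. *)
pose u k := iter k.+1 S (fun=> 0).
have X00 : X (fun=> 0) by apply: L2_0; exact: mD.
have Xm k : X (u k) /\ mean0 (u k).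
  elim: k => [|k [Xk _]]; first by have [] := hS _ X00.
  by have [] := hS _ Xk.
have Gu k : ae_eq_on e (fun t => a^-1 * (b * L (u k) t + (-1) * f t)) (G (u k.+1)).
  by have [] := hS _ (Xm k).1.
(* The factors 1 and -1 match the shape of the linearity lemmas. *)
pose dl g k (t : R) := 1 * g t + (-1) * u k t.
have Xd g k : X g -> mean0 g -> X (dl g k) /\ mean0 (dl g k).
  move=> Xg mg; have [Xk mk] := Xm k; split; first exact: L2_lin.
  exact: mean0_lin (X_L1 he Xg) (X_L1 he Xk) mg mk.
have decr k : N (dl (u k.+2) k.+1) <= N (dl (u k.+1) k) / 16.
  have [X2 m2] := Xm k.+2; have [X1 m1] := Xm k.+1; have [X0 m0] := Xm k.
  have [XA mA] := Xd _ k.+1 X2 m2; have [XB mB] := Xd _ k X1 m1.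
  have E : ae_eq_on e (G (dl (u k.+2) k.+1)) (fun t => b / a * L (dl (u k.+1) k) t).
    apply: (@filterS3 _ _ aeF _ _ _ _ _ (G_lin 1 (-1) X2 X1 m2 m1) (Gu k.+1) (Gu k)) => t H H2 H1 Dt.
    rewrite [LHS]H// -H2// -H1// [X in _ = _ * X](L_lin 1 (-1) X1 X0 Dt); field.
    by rewrite gt_eqF.
  have [XL NL] := L_norm XB.
  have := norm_ae (G_L2 XA mA) (L2Z mD (b / a) XL) E.
  rewrite normZ// (G_norm XA mA) => E2.
  have ap : 0 < (a * pi) ^+ 2 by rewrite exprn_gt0// mulr_gt0// pi_gt0.
  have E3 : (a * pi) ^+ 2 * N (dl (u k.+2) k.+1) = b ^+ 2 * N (L (dl (u k.+1) k)).
    by rewrite exprMn -mulrA E2; field; rewrite gt_eqF.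
  rewrite -(ler_pM2l ap) E3; apply: (le_trans NL).
  by rewrite mulrAC mulrA.
have geo k : N (fun t => u k.+1 t - u k t) <= N (dl (u 1) 0) / 16 ^+ k.
  have -> : N (fun t => u k.+1 t - u k t) = N (dl (u k.+1) k).
    by apply: eq_ip => t _; rewrite /dl mul1r mulN1r.
  elim: k => [|k IH]; first by rewrite expr0 divr1.
  by apply: (le_trans (decr k)); rewrite exprSr invfM mulrA ler_wpM2r.
have [nu Xnu [B hB]] := L2_complete mD mw w0 (fun k => (Xm k).1) geo.
have hB' k : N (dl nu k) <= B / 4 ^+ k.
  by apply: le_trans (hB k); rewrite le_eqVlt; apply/orP; left; apply/eqP; apply: eq_ip => t _;
    rewrite /dl mul1r mulN1r.
have vanish (x C : R) : (forall k, x <= C / 4 ^+ k) -> x <= 0.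
  move=> H; rewrite leNgt; apply/negP => x0.
  have : C / 4 ^+ k @[k --> \oo] --> C * 0.
    apply: cvgM; first exact: cvg_cst.
    rewrite (_ : (fun k => _) = (fun k => 4^-1 ^+ k)); last by apply/funext => k; rewrite exprVn.
    by apply: cvg_expr; rewrite gtr0_norm// invf_lt1// ltr1n.
  rewrite mulr0 => /cvgrPdist_lt/(_ _ x0)[k _ /(_ k (leqnn k))].
  rewrite /= sub0r normrN ltr_norml => /andP[_]; rewrite ltNge H//.
(* The mean is the inner product with 1 / w, so it passes to the limit in norm. *)
have m0 : mean0 nu.
  apply/eqP; rewrite -sqrf_eq0 eq_le sqr_ge0 andbT.
  apply: (vanish _ (B * pi)) => k; have [Xk mk] := Xm k.
  have XV := wgtV_L2 he.
  have Xdk := L2_lin 1 (-1) Xnu Xk.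
  have -> : Rintegral leb D nu = ipX (dl nu k) (fun t => (w t)^-1).
    rewrite ip_wgtV (RintegralD mD (L1Z mD 1 (X_L1 he Xnu)) (L1Z mD (-1) (X_L1 he Xk))).
    by rewrite (RintegralZl _ mD (X_L1 he Xnu)) (RintegralZl _ mD (X_L1 he Xk)) mk mulr0 addr0 mul1r.
  apply: (le_trans (ip_CS mD mw w0 Xdk XV)).
  by rewrite ip_wgtV (wgtV_int he).2 mulrAC ler_wpM2r ?pi_ge0// hB'.
exists nu => //; split => //.
have XT := T_L2 Xnu m0; have Xr := L2_lin 1 (-1) XT Xf.
suff r0 : N (fun t => 1 * T nu t + (-1) * f t) = 0.
  have ae0 := ip_eq0_ae mD mw w0 Xr r0.
  apply: (@filterS _ _ aeF _ _ _ ae0) => t H Dt.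
  by have := H Dt; rewrite mul1r mulN1r => /eqP; rewrite subr_eq0 => /eqP.
apply/eqP; rewrite eq_le (ip_ge0 leb w0) andbT.
apply: (vanish _ (4 * (a * pi) ^+ 2 * B)) => k.
have [Xk mk] := Xm k; have [Xk1 mk1] := Xm k.+1.
have [XA mA] := Xd _ k.+1 Xnu m0; have [XB mB] := Xd _ k Xnu m0.
have [XL NL] := L_norm XB; have XG := G_L2 XA mA.
(* Replacing f through the iteration equation leaves a residual that depends only on nu - u (k+1)
   and nu - u k, both of which tend to 0. *)
have E : ae_eq_on e (fun t => 1 * T nu t + (-1) * f t)
    (fun t => - a * G (dl nu k.+1) t + b * L (dl nu k) t).
  apply: (@filterS2 _ _ aeF _ _ _ _ (G_lin 1 (-1) Xnu Xk1 m0 mk1) (Gu k)) => t H H1 Dt.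
  rewrite [X in _ = - a * X + _]H// -H1// [X in _ = _ + _ * X](L_lin 1 (-1) Xnu Xk Dt) /Top; field.
  by rewrite gt_eqF.
rewrite (norm_ae Xr (L2_lin (- a) b XG XL) E).
apply: (le_trans (ip_add_le mD mw w0 (L2Z mD (- a) XG) (L2Z mD b XL))).
rewrite !normZ// (G_norm XA mA) sqrrN (mulrA (a ^+ 2)) -exprMn.
have h1 : N (dl nu k.+1) <= B / 4 ^+ k / 4.
  by apply: (le_trans (hB' k.+1)); rewrite exprSr invfM mulrA.
rewrite -[leRHS]mulrA; move: h1; have := hB' k; have := ip_ge0 leb w0 (dl nu k); move: NL.
have := ip_ge0 leb w0 (dl nu k.+1).
move: (B / 4 ^+ k) (N (dl nu k)) (N (dl nu k.+1)) (b ^+ 2 * N (L (dl nu k))) ((a * pi) ^+ 2) (sqr_ge0 (a * pi)).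
move=> B4 n n1 l p p0 n10 NL n0 h0 h1.
have q1 : p * n1 <= p * (B4 / 4) by rewrite ler_wpM2l.
have q0 : p * n <= p * B4 by rewrite ler_wpM2l.
have q2 : 0 <= p * n by exact: mulr_ge0.
have {}NL : l <= p * n / 16 by rewrite mulrAC.
lra.
Qed.

End assembly.

(** * Invertibility between the spaces of pairs (mu, nu) *)

Lemma Top_eq (R : realType) (a b e : R) (mu mu' : R -> R) :
  (forall t, Iopen e t -> mu t = mu' t) -> Top a b e mu = Top a b e mu'.
Proof.
move=> E; apply/funext => tau; rewrite /Top.
have -> : Lop e mu tau = Lop e mu' tau.
  by apply: eq_Rintegral => t /set_mem Dt; rewrite E.
have JE : Jreg e mu tau = Jreg e mu' tau.
  by apply/funext => h; apply: eq_Rintegral => t /set_mem Dt; rewrite E.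
by rewrite -[Jop e mu tau]/(lim (Jreg e mu tau h @[h --> 0^'+])) JE.
Qed.

Theorem theorem5p3 (R : realType) (a b : R) (ha : 0 < a) (hb : 0 < b) :
  exists2 e0 : R, 0 < e0 & forall e : R, 0 < e -> e < e0 ->
  [/\
    (* T maps Y_Pi into X *)
    (forall mu nu, inYPi e mu nu -> inX e (Top a b e mu)),
    (* T is linear (as a map into X, i.e. up to a.e. equality) *)
    (forall (mu1 nu1 mu2 nu2 : R -> R) (c1 c2 : R),
        inYPi e mu1 nu1 -> inYPi e mu2 nu2 ->
        ae_eq_on e (Top a b e (fun t => c1 * mu1 t + c2 * mu2 t))
                   (fun t => c1 * Top a b e mu1 t + c2 * Top a b e mu2 t)),
    (* T is bounded *)
    (exists2 C : R, 0 < C & forall mu nu, inYPi e mu nu ->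
        (Xnorm2 e (Top a b e mu) <= C%:E * Ynorm2 e mu nu)%E),
    (* T is injective *)
    (forall mu1 nu1 mu2 nu2, inYPi e mu1 nu1 -> inYPi e mu2 nu2 ->
        ae_eq_on e (Top a b e mu1) (Top a b e mu2) ->
        forall t, Iclosed e t -> mu1 t = mu2 t)
    &
    (* T is surjective onto X *)
    ((forall f, inX e f -> exists mu nu, inYPi e mu nu /\ ae_eq_on e (Top a b e mu) f)
    /\
    (* the inverse of T is bounded *)
    (exists2 C : R, 0 < C & forall mu nu, inYPi e mu nu ->
        (Ynorm2 e mu nu <= C%:E * Xnorm2 e (Top a b e mu))%E))].
Proof.
have pi0 : 0 < pi :> R := pi_gt0 R.
(* [e ^+ 2 <= c] says that [128 * pi * e ^+ 2], the constant of [Lop_norm], times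
   [b ^+ 2] is at most [(a * pi) ^+ 2 / 16]. *)
pose c : R := a ^+ 2 * pi / (2048 * b ^+ 2).
have a2 : 0 < a ^+ 2 by exact: exprn_gt0.
have b2 : 0 < 2048 * b ^+ 2 by apply: mulr_gt0; [rewrite ltr0n|exact: exprn_gt0].
have c0 : 0 < c by apply: divr_gt0 => //; exact: mulr_gt0.
(* The bound 1/2 is the one under which [log_kernel] holds, the bound sqrt c gives the smallness of
   L relative to J. *)
exists (Num.min 2^-1 (Num.sqrt c)); first by rewrite lt_min invr_gt0 ltr0n sqrtr_gt0 c0.
move=> e he; rewrite lt_min => /andP[/ltW he2 ec].
have small : b ^+ 2 * (128 * pi * e ^+ 2) * 16 <= (a * pi) ^+ 2.
  have : e ^+ 2 <= c.
    by rewrite -[leRHS]sqr_sqrtr ?(ltW c0)// lerXn2r ?nnegrE ?sqrtr_ge0 ?(ltW he)// ltW.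
  rewrite /c (ler_pdivlMr _ _ b2) => H.
  have := ler_wpM2r (ltW pi0) H; rewrite exprMn; move: (pi : R) => p; lra.
have mD := @measurable_Iopen R e.
have mw := @wgt_measurable R e (Iopen e).
have w0 t (Dt : Iopen e t) : 0 < wgt e t := wgt_gt0 Dt.
pose N (f : R -> R) := ip (@lebesgue_measure R) (Iopen e) (wgt e) f f.
have ap : 0 < (a * pi) ^+ 2 by rewrite exprn_gt0// mulr_gt0.
have sub t : Iopen e t -> Iclosed e t.
  by rewrite /Iopen /Iclosed/= !in_itv/= => /andP[/ltW -> /ltW ->].
have TE mu nu : inYPi e mu nu -> Top a b e mu = Top a b e (prim (- e) nu).
  by move=> /(inYPi_prim he)[_ _ E]; apply: Top_eq => t /sub; exact: E.
have XT mu nu : inYPi e mu nu -> L2 (@lebesgue_measure R) (Iopen e) (wgt e) (Top a b e mu).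
  move=> Y; rewrite (TE _ _ Y); have [Xnu m0 _] := inYPi_prim he Y.
  exact: (T_L2 he he2 small).
have lin mu1 nu1 mu2 nu2 (c1 c2 : R) : inYPi e mu1 nu1 -> inYPi e mu2 nu2 ->
    ae_eq_on e (Top a b e (fun t => c1 * mu1 t + c2 * mu2 t))
               (fun t => c1 * Top a b e mu1 t + c2 * Top a b e mu2 t).
  move=> Y1 Y2; rewrite (TE _ _ Y1) (TE _ _ Y2).
  have [X1 m1 E1] := inYPi_prim he Y1; have [X2 m2 E2] := inYPi_prim he Y2.
  rewrite (@Top_eq _ _ _ _ _ (prim (- e) (fun s => c1 * nu1 s + c2 * nu2 s))).
    exact: (T_lin he he2 a b c1 c2 X1 X2 m1 m2).
  move=> t Dt; have ct : - e <= t <= e by move/IopenP: Dt => /andP[/ltW -> /ltW ->].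
  by rewrite (prim_lin c1 c2 (X_L1 he X1) (X_L1 he X2) ct) (E1 _ (sub _ Dt)) (E2 _ (sub _ Dt)).
split.
- by move=> mu nu Y; apply/inX_L2; exact: XT Y.
- by move=> mu1 nu1 mu2 nu2 c1 c2; exact: lin.
- exists (3 * (a * pi) ^+ 2); first by rewrite mulr_gt0.
  move=> mu nu Y; have [Xnu m0 _] := inYPi_prim he Y.
  have /inX_L2 Xmu := Y.1.2.1.
  rewrite /Ynorm2 (Xnorm2E (XT _ _ Y)) (Xnorm2E Xmu) (Xnorm2E Xnu).
  rewrite -EFinD -EFinM lee_fin (TE _ _ Y).
  apply: (le_trans (T_upper he he2 small Xnu m0)).
  apply: ler_wpM2l; first by apply: mulr_ge0 => //; exact: ltW.
  by have := ip_ge0 (@lebesgue_measure R) w0 mu; rewrite lerDr.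
- move=> mu1 nu1 mu2 nu2 Y1 Y2 T12 t ct.
  have [X1 m1 E1] := inYPi_prim he Y1; have [X2 m2 E2] := inYPi_prim he Y2.
  have Xd := L2_lin 1 (-1) X1 X2.
  have md := mean0_lin 1 (-1) (X_L1 he X1) (X_L1 he X2) m1 m2.
  have H := T_lin he he2 a b 1 (-1) X1 X2 m1 m2.
  rewrite (TE _ _ Y1) (TE _ _ Y2) in T12.
  (* T of the difference is 0, so [T_lower] gives nu1 - nu2 norm 0, and [prim_sqr_le] turns this
     into equality of mu1 and mu2 at every point of the closed interval. *)
  have N0 : N (Top a b e (prim (- e) (fun s => 1 * nu1 s + (-1) * nu2 s))) = 0.
    rewrite /N (@norm_ae _ _ _ (fun=> 0)); last 3 first.
    + exact: (T_L2 he he2 small).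
    + by apply: L2_0; exact: mD.
    + apply: (@filterS2 _ _ (ae_filter_ringOfSetsType _) _ _ _ _ H T12) => s Hs Es Ds.
      by rewrite (Hs Ds) (Es Ds) mul1r mulN1r subrr.
    by rewrite /ip; under eq_Rintegral do rewrite !mulr0; rewrite Rintegral_cst// mul0r.
  have := T_lower he he2 small Xd md; rewrite [X in _ <= 4 * X]N0 mulr0 (pmulr_rle0 _ ap) => Nd.
  move: ct; rewrite /Iclosed/= in_itv/= => ct.
  have := prim_sqr_le he Xd ct; rewrite (prim_lin 1 (-1) (X_L1 he X1) (X_L1 he X2) ct).
  rewrite -E1 -?E2 ?mul1r ?mulN1r; try by rewrite /Iclosed/= in_itv.
  move=> H2; apply/eqP; rewrite -subr_eq0 -sqrf_eq0 eq_le sqr_ge0 andbT.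
  by apply: (le_trans H2); rewrite (pmulr_rle0 _ pi0).
- split.
    move=> f /inX_L2 Xf.
    have [nu Xnu [m0 H]] := T_onto he he2 ha small Xf.
    by exists (prim (- e) nu), nu; split => //; exact: prim_inYPi.
  (* The first factor bounds |mu|^2 + |nu|^2 by |nu|^2, through |mu|^2 <= 2 pi e^2 |nu|^2; the
     second comes from [T_lower]. *)
  pose K := (1 + 2 * pi * e ^+ 2) * (4 / (a * pi) ^+ 2).
  have K1 : 0 <= 2 * pi * e ^+ 2 by apply: mulr_ge0; [apply: mulr_ge0 => //; exact: ltW|exact: sqr_ge0].
  exists K; first by apply: mulr_gt0; [exact: ltr_wpDr|exact: divr_gt0].
  move=> mu nu Y; have [Xnu m0 E] := inYPi_prim he Y.
  have /inX_L2 Xmu := Y.1.2.1.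
  rewrite /Ynorm2 (Xnorm2E (XT _ _ Y)) (Xnorm2E Xmu) (Xnorm2E Xnu).
  rewrite -EFinD -EFinM lee_fin (TE _ _ Y).
  have n0 := ip_ge0 (@lebesgue_measure R) w0 nu.
  have Nmu : N mu <= pi * N nu * (2 * e ^+ 2).
    rewrite -(sqr_sqrtr (mulr_ge0 (ltW pi0) n0)).
    apply: (norm_bounded he Xmu.1) => t Dt; rewrite -sqrtr_sqr ler_wsqrtr// E; last exact: sub.
    by apply: (prim_sqr_le he Xnu); move/IopenP: Dt => /andP[/ltW -> /ltW ->].
  have low : N nu <= 4 / (a * pi) ^+ 2 * N (Top a b e (prim (- e) nu)).
    by rewrite mulrAC ler_pdivlMr// mulrC; exact: (T_lower he he2 small).
  rewrite /K -[leRHS]mulrA; apply: le_trans (ler_wpM2l _ low); last by rewrite addr_ge0.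
  by move: Nmu; rewrite /N => Nmu; apply: (le_trans (lerD Nmu (lexx _))); rewrite le_eqVlt; apply/orP; left; apply/eqP; ring.
Qed.
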